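(* Let $(A,\lambda_A)$ be in $\mathrm{C}_{\mathcal O}(c)$ and let $M$ be a finitely generated $A$-module with $\operatorname{depth}_AM\ge c+1$. Let $f\in\mathfrak p_A\setminus\mathfrak p_A^{(2)}$ be an element that is not a zero-divisor on $M$. Then the ring $B:=A/fA$, with the augmentation $B\to\mathcal O$ induced by $\lambda_A$, is in $\mathrm{C}_{\mathcal O}(c-1)$, and $$\delta_A(M)=\delta_B(M/fM).$$
   Context: $\mathcal O$ is a discrete valuation ring with uniformizer $\varpi$. For a finitely generated $\mathcal O$-module $U$, $\operatorname{tors}(U)$ is its torsion submodule and $U^{\mathrm{tf}}:=U/\operatorname{tors}(U)$. $\mathrm{C}_{\mathcal O}(c)$ is the category of pairs $(A,\lambda_A)$ where $A$ is a complete noetherian local $\mathcal O$-algebra and $\lambda_A\colon A\to\mathcal O$ is a surjective map of $\mathcal O$-algebras such that, with $\mathfrak p_A:=\operatorname{Ker}\lambda_A$, the local ring $A_{\mathfrak p_A}$ is regular of Krull dimension $c$. $\mathcal O$ is an $A$-module via $\lambda_A$. For a finitely generated $A$-module $M$, the natural map $M\to M/\mathfrak p_AM$ induces a map of $\mathcal O$-modules $\operatorname{Ext}^c_A(\mathcal O,M)^{\mathrm{tf}}\to \operatorname{Ext}^c_A(\mathcal O,M/\mathfrak p_AM)^{\mathrm{tf}}$; its cokernel is the congruence module $\Psi_A(M)$ (of finite length over $\mathcal O$). Put $\Phi_A:=\operatorname{tors}(\mathfrak p_A/\mathfrak p_A^2)$. The Wiles defect is $$\delta_A(M):=(\operatorname{rank}_{A_{\mathfrak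 p_A}}M_{\mathfrak p_A})\cdot\operatorname{length}_{\mathcal O}\Phi_A-\operatorname{length}_{\mathcal O}\Psi_A(M).$$ For objects of $\mathrm{C}_{\mathcal O}(c-1)$ the same definitions apply with $c-1$ in place of $c$. (Under the depth hypothesis $M_{\mathfrak p_A}$ is a free $A_{\mathfrak p_A}$-module, possibly zero.) $\mathfrak p^{(2)}$ is the second symbolic power of a prime $\mathfrak p$: the preimage of $\mathfrak p^2A_{\mathfrak p}$ under $A\to A_{\mathfrak p}$. *)

(* Defs.v *)
From HB Require Import structures.
From mathcomp Require Import all_boot all_order all_algebra ring.
From mathcomp Require Import finmap all_classical.

Set Implicit Arguments.
Unset Strict Implicit.
Unset Printing Implicit Defensive.
Import GRing.Theory.
Local Open Scope classical_set_scope.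
Local Open Scope quotient_scope.
Local Open Scope ring_scope.

Definition submod_set (R : pzRingType) (V : lmodType R) (P : set V) :=
  P 0 /\ forall a x y, P x -> P y -> P (a *: x + y).

Section SubmodOf.
Variables (R : pzRingType) (V : lmodType R) (P : set V).

(* The unused proof makes the closure instance below inferable. *)
Definition submod_of_pred of submod_set P : V -> bool := fun x => `[< P x >].

Lemma submod_of_closed (hP : submod_set P) : submod_closed (submod_of_pred hP).
Proof.
split=> [|a x y /asboolP Px /asboolP Py]; apply/asboolP; first exact: hP.1.
exact: hP.2.
Qed.

HB.instance Definition _ (hP : submod_set P) := GRing.isSubmodClosed.Build R V
  (submod_of_pred hP) (submod_of_closed hP).

Definition submod_of (hP : submod_set P) : submodClosed V :=
  (submod_of_pred hP : {pred V}).

Lemma submod_ofE (hP : submod_set P) x : (x \in submod_of hP) <-> P x.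
Proof. by split=> [/asboolP//|Px]; apply/asboolP. Qed.

End SubmodOf.

Section Submodules.
Variables (R : pzRingType) (V : lmodType R).
Implicit Types (X : set V) (S : submodClosed V).

Lemma span_subproof X :
  submod_set [set x | forall S, (forall y, X y -> y \in S) -> x \in S].
Proof.
split=> [S _|a x y hx hy S XS]; first exact: rpred0.
by rewrite rpredD ?rpredZ ?hx ?hy.
Qed.
Definition span X : submodClosed V := submod_of (span_subproof X).

Lemma zero_subproof : submod_set [set 0 : V].
Proof. by split=> // a x y -> ->; rewrite scaler0 addr0. Qed.
Definition submod0 : submodClosed V := submod_of zero_subproof.

Lemma full_subproof : submod_set [set: V].
Proof. by []. Qed.
Definition submodT : submodClosed V := submod_of full_subproof.

Definition fin_gen S := exists s : seq V, S =i span [set x | x \in s].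

Definition submod_chain (n : nat) :=
  exists S : nat -> submodClosed V, forall i, (i < n)%N ->
    {subset S i <= S i.+1} /\ ~ {subset S i.+1 <= S i}.

(* The supremum of the lengths of chains of submodules; the value is 0 when
   there is no finite supremum. *)
Definition mod_length : nat :=
  xget 0%N [set n | submod_chain n /\ forall m, submod_chain m -> (m <= n)%N].

Definition is_basis (n : nat) (e : 'I_n -> V) :=
  forall v, exists! a : 'I_n -> R, v = \sum_i a i *: e i.

(* The rank of a free module, 0 on modules having no finite basis. *)
Definition free_rank : nat :=
  xget 0%N [set n | exists e : 'I_n -> V, is_basis e].

End Submodules.
Arguments submod0 {R} V.
Arguments submodT {R} V.
Arguments mod_length {R} V.
Arguments free_rank {R} V.

Definition fg_module (R : pzRingType) (V : lmodType R) :=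
  exists s : seq V, forall x : V, x \in span [set y | y \in s].

Section LinearMaps.
Variables (R : pzRingType) (U V : lmodType R) (f : {linear U -> V}).

Lemma ker_subproof : submod_set [set x | f x = 0].
Proof.
split=> [|a x y /= hx hy]; first exact: linear0.
by rewrite linearP hx hy scaler0 addr0.
Qed.
Definition kerm : submodClosed U := submod_of ker_subproof.

Lemma range_subproof : submod_set (range f).
Proof.
split=> [|a _ _ [x _ <-] [y _ <-]]; first by exists 0; rewrite ?linear0.
by exists (a *: x + y); rewrite ?linearP.
Qed.
Definition rangem : submodClosed V := submod_of range_subproof.

Lemma preim_subproof (S : submodClosed V) : submod_set [set x | f x \in S].
Proof.
split=> [|a x y /= hx hy]; first by rewrite /= linear0 rpred0.
by rewrite linearP rpredD ?rpredZ.
Qed.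
Definition preimm (S : submodClosed V) : submodClosed U :=
  submod_of (preim_subproof S).

End LinearMaps.

Section Subm.
Variables (R : pzRingType) (V : lmodType R) (S : submodClosed V).
Definition subm := {x : V | x \in S}.
HB.instance Definition _ := SubChoice.on subm.
HB.instance Definition _ := [SubChoice_isSubLmodule of subm by <:].
End Subm.

Section Quom.
Variables (R : pzRingType) (V : lmodType R) (S : submodClosed V).

(* Over a ring a submodule is closed under opposite, but submodClosed does not
   inherit from zmodClosed. *)
Definition submod_zpred : V -> bool := fun x => x \in S.
HB.instance Definition _ := GRing.isZmodClosed.Build V submod_zpred
  (GRing.submod_closedB (GRing.submodClosedP S)).
Definition submod_zmod : zmodClosed V := (submod_zpred : {pred V}).

Definition quom := Quotient.quot submod_zmod.
HB.instance Definition _ := GRing.Zmodule.on quom.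
Definition quom_pi (x : V) : quom := \pi_(Quotient.quot submod_zmod) x.
Definition quom_repr (u : quom) : V := repr (u : Quotient.quot submod_zmod).

Lemma quom_reprK u : quom_pi (quom_repr u) = u.
Proof. exact: reprK. Qed.

Lemma quom_piP x y : quom_pi x = quom_pi y <-> x - y \in S.
Proof.
rewrite /quom_pi; split=> [/eqP|h]; first by rewrite -Quotient.idealrBE.
by apply/eqP; rewrite -Quotient.idealrBE.
Qed.

Lemma quom_pi_zmod : zmod_morphism quom_pi.
Proof. by move=> x y; rewrite /quom_pi raddfB. Qed.
HB.instance Definition _ :=
  GRing.isZmodMorphism.Build V quom quom_pi quom_pi_zmod.

Lemma quom_repr_pi x : x - quom_repr (quom_pi x) \in S.
Proof. by apply/quom_piP; rewrite quom_reprK. Qed.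

Definition quom_scale (a : R) (u : quom) : quom := quom_pi (a *: quom_repr u).

Lemma quom_scaleE a x : quom_scale a (quom_pi x) = quom_pi (a *: x).
Proof.
apply/esym/quom_piP; rewrite -scalerBr; apply: rpredZ; exact: quom_repr_pi.
Qed.

Lemma quom_scaleA a b v : quom_scale a (quom_scale b v) = quom_scale (a * b) v.
Proof. by rewrite -(quom_reprK v) !quom_scaleE scalerA. Qed.
Lemma quom_scale1 : left_id 1 quom_scale.
Proof. by move=> v; rewrite -(quom_reprK v) !quom_scaleE scale1r. Qed.
Lemma quom_scaleDr : right_distributive quom_scale +%R.
Proof.
move=> a u v; rewrite -(quom_reprK u) -(quom_reprK v) -raddfD !quom_scaleE.
by rewrite scalerDr raddfD.
Qed.
Lemma quom_scaleDl v : {morph quom_scale^~ v : a b / a + b}.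
Proof.
by move=> a b; rewrite -(quom_reprK v) !quom_scaleE scalerDl raddfD.
Qed.
HB.instance Definition _ := GRing.Zmodule_isLmodule.Build R quom
  quom_scaleA quom_scale1 quom_scaleDr quom_scaleDl.

Lemma quom_pi_scalable : scalable quom_pi.
Proof. by move=> a x; rewrite -quom_scaleE. Qed.
HB.instance Definition _ :=
  GRing.isScalable.Build R V quom *:%R quom_pi quom_pi_scalable.

End Quom.

Section InducedMaps.
Variables (R : pzRingType) (U V : lmodType R) (f : {linear U -> V}).
Variables (S : submodClosed U) (T : submodClosed V).
Hypothesis fST : forall x, x \in S -> f x \in T.

Definition subm_map (x : subm S) : subm T := Sub (f (val x)) (fST (valP x)).
Lemma subm_map_linear : linear subm_map.
Proof. by move=> a x y; apply: val_inj; rewrite /= !linearP. Qed.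
HB.instance Definition _ :=
  GRing.isLinear.Build R (subm S) (subm T) *:%R subm_map subm_map_linear.

(* The unused proof makes the linear structure below inferable. *)
Definition quom_map of (forall x, x \in S -> f x \in T) : quom S -> quom T :=
  fun u => quom_pi T (f (quom_repr u)).
Lemma quom_mapE x : quom_map fST (quom_pi S x) = quom_pi T (f x).
Proof.
by apply/esym/quom_piP; rewrite -linearB; apply: fST; exact: quom_repr_pi.
Qed.
Lemma quom_map_linear : linear (quom_map fST).
Proof.
move=> a u v; rewrite -(quom_reprK u) -(quom_reprK v) -linearP !quom_mapE.
by rewrite !linearP.
Qed.
HB.instance Definition _ := GRing.isLinear.Build R (quom S) (quom T) *:%R
  (quom_map fST) quom_map_linear.

End InducedMaps.

Section Restr.
Variables (R S : pzRingType).

(* The unused morphism selects the R-module structure given to V. *)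
Definition restr of {rmorphism R -> S} := fun V : lmodType S => (V : Type).

Variable h : {rmorphism R -> S}.

Section RestrLmod.
Variable V : lmodType S.
HB.instance Definition _ := GRing.Zmodule.copy (restr h V) V.
Definition restr_scale (a : R) (x : restr h V) : restr h V := h a *: (x : V).
Lemma restr_scaleA a b v :
  restr_scale a (restr_scale b v) = restr_scale (a * b) v.
Proof. by rewrite /restr_scale rmorphM scalerA. Qed.
Lemma restr_scale1 : left_id 1 restr_scale.
Proof. by move=> v; rewrite /restr_scale rmorph1 scale1r. Qed.
Lemma restr_scaleDr : right_distributive restr_scale +%R.
Proof. by move=> a u v; rewrite /restr_scale scalerDr. Qed.
Lemma restr_scaleDl v : {morph restr_scale^~ v : a b / a + b}.
Proof. by move=> a b; rewrite /restr_scale rmorphD scalerDl. Qed.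
HB.instance Definition _ := GRing.Zmodule_isLmodule.Build R (restr h V)
  restr_scaleA restr_scale1 restr_scaleDr restr_scaleDl.
End RestrLmod.

Definition restr_map (V W : lmodType S) (f : {linear V -> W}) :
  restr h V -> restr h W := f.
Lemma restr_map_linear V W f : linear (@restr_map V W f).
Proof. by move=> a x y; rewrite /restr_map /= linearP. Qed.
HB.instance Definition _ V W f := GRing.isLinear.Build R (restr h V) (restr h W)
  *:%R (@restr_map V W f) (@restr_map_linear V W f).

End Restr.
Arguments restr_map {R S} h {V W} f.

Notation ideal A := (submodClosed A^o).

Section Ideals.
Variable A : comPzRingType.
Implicit Types I J P : ideal A.

Lemma kerr_subproof (C : pzRingType) (h : {rmorphism A -> C}) :
  submod_set [set a : A^o | h a = 0].
Proof.
split=> [|a x y /= hx hy]; first exact: rmorph0.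
by rewrite rmorphD /= [h (a *: x)]rmorphM hx hy mulr0 addr0.
Qed.
Definition kerr (C : pzRingType) (h : {rmorphism A -> C}) : ideal A :=
  submod_of (kerr_subproof h).
Lemma kerrE (C : pzRingType) (h : {rmorphism A -> C}) (a : A) :
  a \in kerr h <-> h a = 0.
Proof. exact: (submod_ofE (kerr_subproof h) a). Qed.

Definition prime_ideal P :=
  1 \notin P /\ forall a b : A, a * b \in P -> a \in P \/ b \in P.

Definition maximal_ideal P :=
  1 \notin P /\ forall J, {subset P <= J} -> 1 \notin J -> {subset J <= P}.

Definition noetherian := forall I, fin_gen I.

Definition local_with P :=
  maximal_ideal P /\ forall J, maximal_ideal J -> J =i P.

Definition prime_chain (n : nat) :=
  exists P : nat -> ideal A, (forall i, (i <= n)%N -> prime_ideal (P i)) /\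
    forall i, (i < n)%N -> {subset P i <= P i.+1} /\ ~ {subset P i.+1 <= P i}.

Definition krull_dim (d : nat) :=
  prime_chain d /\ forall n, prime_chain n -> (n <= d)%N.

Definition smulm I (M : lmodType A) (N : submodClosed M) : submodClosed M :=
  span [set v | exists a : A, exists2 x : M, a \in I & x \in N /\ v = a *: x].

Definition powid I (n : nat) : ideal A :=
  iter n (fun J : ideal A => smulm I J) (submodT A^o).

(* A is separated and complete for the I-adic topology. *)
Definition adic_complete I :=
  forall x : nat -> A, (forall n, x n.+1 - x n \in powid I n) ->
    exists! y : A, forall n, y - x n \in powid I n.

Definition regular_local (d : nat) :=
  [/\ noetherian, krull_dim d &
      exists2 m : ideal A, local_with m &
        exists e : 'I_d -> A, m =i span (range (e : 'I_d -> A^o))].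

End Ideals.
Arguments noetherian : clear implicits.
Arguments krull_dim : clear implicits.
Arguments regular_local : clear implicits.

Section RingQuotient.
Variables (A : comPzRingType) (I : ideal A).

Definition rquot := quom I.
HB.instance Definition _ := GRing.Zmodule.on rquot.
Definition rquot_pi (a : A) : rquot := quom_pi I a.
Definition rquot_mul (x y : rquot) : rquot :=
  rquot_pi (quom_repr x * quom_repr y).

Lemma rquot_mulE a b : rquot_mul (rquot_pi a) (rquot_pi b) = rquot_pi (a * b).
Proof.
apply/esym/quom_piP; set a' := quom_repr _; set b' := quom_repr _.
have -> : a * b - a' * b' = b *: (a - a' : A^o) + a' *: (b - b' : A^o) :> A^o.
  by rewrite /GRing.scale /= mulrBr mulrBr addrA (mulrC b a) (mulrC b a') subrK.
by rewrite rpredD // rpredZ // quom_repr_pi.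
Qed.

Lemma rquot_reprK (x : rquot) : rquot_pi (quom_repr x) = x.
Proof. exact: quom_reprK. Qed.
Lemma rquot_piD a b : rquot_pi (a + b) = rquot_pi a + rquot_pi b.
Proof. by rewrite /rquot_pi raddfD. Qed.

Lemma rquot_mulA : associative rquot_mul.
Proof.
move=> x y z; rewrite -(rquot_reprK x) -(rquot_reprK y) -(rquot_reprK z).
by rewrite !rquot_mulE mulrA.
Qed.
Lemma rquot_mulC : commutative rquot_mul.
Proof. by move=> x y; rewrite /rquot_mul mulrC. Qed.
Lemma rquot_mul1 : left_id (rquot_pi 1) rquot_mul.
Proof. by move=> x; rewrite -(rquot_reprK x) rquot_mulE mul1r. Qed.
Lemma rquot_mulDl : left_distributive rquot_mul +%R.
Proof.
move=> x y z; rewrite -(rquot_reprK x) -(rquot_reprK y) -(rquot_reprK z).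
by rewrite -rquot_piD !rquot_mulE -rquot_piD mulrDl.
Qed.
HB.instance Definition _ := GRing.Zmodule_isComPzRing.Build rquot
  rquot_mulA rquot_mulC rquot_mul1 rquot_mulDl.

Lemma rquot_pi_zmod : zmod_morphism rquot_pi.
Proof. by move=> x y; rewrite /rquot_pi raddfB. Qed.
HB.instance Definition _ :=
  GRing.isZmodMorphism.Build A rquot rquot_pi rquot_pi_zmod.
Lemma rquot_pi_monoid : monoid_morphism rquot_pi.
Proof. by split=> // x y; rewrite -rquot_mulE. Qed.
HB.instance Definition _ :=
  GRing.isMonoidMorphism.Build A rquot rquot_pi rquot_pi_monoid.

Section Lift.
Variables (C : pzRingType) (h : {rmorphism A -> C}).
Hypothesis hI : forall a : A, a \in I -> h a = 0.

Definition rquot_lift of (forall a : A, a \in I -> h a = 0) : rquot -> C :=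
  fun x => h (quom_repr x).
Lemma rquot_liftE a : rquot_lift hI (rquot_pi a) = h a.
Proof.
apply/esym/eqP; rewrite -subr_eq0 -rmorphB; apply/eqP/hI.
exact: quom_repr_pi.
Qed.
Lemma rquot_lift_zmod : zmod_morphism (rquot_lift hI).
Proof.
move=> x y; rewrite -(rquot_reprK x) -(rquot_reprK y) -rmorphB !rquot_liftE.
by rewrite rmorphB.
Qed.
Lemma rquot_lift_monoid : monoid_morphism (rquot_lift hI).
Proof.
split=> [|x y]; first by rewrite -(rmorph1 h) -rquot_liftE rmorph1.
rewrite -(rquot_reprK x) -(rquot_reprK y) -rmorphM !rquot_liftE.
by rewrite rmorphM.
Qed.
HB.instance Definition _ :=
  GRing.isZmodMorphism.Build rquot C (rquot_lift hI) rquot_lift_zmod.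
HB.instance Definition _ :=
  GRing.isMonoidMorphism.Build rquot C (rquot_lift hI) rquot_lift_monoid.
End Lift.

Section ModuleQuotient.
Variable M : lmodType A.

(* Same carrier as the A-module M / I M, seen as a module over A / I. *)
Definition mquot := quom (smulm I (submodT M)).
HB.instance Definition _ := GRing.Zmodule.on mquot.
Definition mquot_scale (a : rquot) (x : mquot) : mquot :=
  quom_repr a *: (x : quom (smulm I (submodT M))).

Lemma mquot_scaleE a x : mquot_scale (rquot_pi a) x =
  a *: (x : quom (smulm I (submodT M))).
Proof.
apply/esym/eqP; rewrite -subr_eq0 -scalerBl; apply/eqP.
rewrite -(quom_reprK x) -linearZ /=; rewrite -[RHS](linear0 (quom_pi _)).
apply/quom_piP; rewrite subr0; apply/submod_ofE => S; apply.
exists (a - quom_repr (rquot_pi a)), (quom_repr x).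
  exact: quom_repr_pi.
by split=> //; apply/submod_ofE.
Qed.
Lemma mquot_scaleA a b x :
  mquot_scale a (mquot_scale b x) = mquot_scale (a * b) x.
Proof.
rewrite -(rquot_reprK a) -(rquot_reprK b) -rmorphM !mquot_scaleE.
exact: scalerA.
Qed.
Lemma mquot_scale1 : left_id 1 mquot_scale.
Proof. by move=> x; rewrite -(rmorph1 rquot_pi) mquot_scaleE; exact: scale1r. Qed.
Lemma mquot_scaleDr : right_distributive mquot_scale +%R.
Proof. by move=> a x y; exact: scalerDr. Qed.
Lemma mquot_scaleDl x : {morph mquot_scale^~ x : a b / a + b}.
Proof.
move=> a b; rewrite -(rquot_reprK a) -(rquot_reprK b) -rmorphD !mquot_scaleE.
exact: scalerDl.
Qed.
HB.instance Definition _ := GRing.Zmodule_isLmodule.Build rquot mquot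
  mquot_scaleA mquot_scale1 mquot_scaleDr mquot_scaleDl.
End ModuleQuotient.

End RingQuotient.

Section LocalizedModule.
Variables (A : comPzRingType) (S : mulrClosed A).

Definition denom := {s : A | s \in S}.
Definition den (s : denom) : A := sval s.
Arguments den : simpl never.
Lemma denP (s : denom) : den s \in S.
Proof. exact: valP. Qed.

Section Carrier.
Variable M : lmodType A.

Definition locfrac := (M * denom)%type.

Definition loc_rel (x y : locfrac) : bool :=
  `[< exists2 u : A, u \in S &
        u *: (den y.2 *: x.1) = u *: (den x.2 *: y.1) >].

Lemma loc_rel_refl : reflexive loc_rel.
Proof. by move=> x; apply/asboolP; exists 1; rewrite ?rpred1. Qed.
Lemma loc_rel_sym : symmetric loc_rel.
Proof.
by move=> x y; apply/asboolP/asboolP => -[u Su h]; exists u.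
Qed.
Lemma loc_rel_trans : transitive loc_rel.
Proof.
move=> [y t] [x s] [z r] /asboolP[u Su /= ux] /asboolP[v Sv /= vy].
apply/asboolP; exists (den t * (u * v)) => /=.
  by rewrite !rpredM ?(denP t).
have E1 : (den t * (u * v)) *: (den r *: x)
          = (v * den r) *: (u *: (den t *: x)).
  by rewrite !scalerA; congr (_ *: _); ring.
have E2 : (den t * (u * v)) *: (den s *: z)
          = (u * den s) *: (v *: (den t *: z)).
  by rewrite !scalerA; congr (_ *: _); ring.
rewrite E1 E2 ux -vy !scalerA; congr (_ *: _).
by ring.
Qed.
Canonical loc_equiv := EquivRel loc_rel loc_rel_refl loc_rel_sym loc_rel_trans.

Definition locm := {eq_quot loc_rel}.
HB.instance Definition _ : EqQuotient _ loc_rel locm := EqQuotient.on locm.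
HB.instance Definition _ := Choice.on locm.

Definition locm_frac (m : M) (s : denom) : locm :=
  \pi_locm ((m, s) : locfrac).

Lemma locm_fracP m s n t : locm_frac m s = locm_frac n t <->
  exists2 u : A, u \in S & u *: (den t *: m) = u *: (den s *: n).
Proof.
split=> [/eqmodP/asboolP[u Su E]|[u Su E]]; first by exists u.
by apply/eqmodP/asboolP; exists u.
Qed.

Lemma locm_repr (x : locm) : locm_frac (repr x).1 (repr x).2 = x.
Proof. by rewrite /locm_frac -surjective_pairing reprK. Qed.

Lemma loc_mul_subproof (s t : denom) : den s * den t \in S.
Proof. by rewrite rpredM ?denP. Qed.
Definition loc_mul (s t : denom) : denom :=
  exist _ (den s * den t) (loc_mul_subproof s t).
Definition loc_one : denom := exist _ 1 (@rpred1 _ S).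
Lemma den_mul s t : den (loc_mul s t) = den s * den t. Proof. by []. Qed.
Lemma den_one : den loc_one = 1. Proof. by []. Qed.

Definition locm_add (x y : locm) : locm :=
  locm_frac (den (repr y).2 *: (repr x).1 + den (repr x).2 *: (repr y).1)
            (loc_mul (repr x).2 (repr y).2).
Definition locm_opp (x : locm) : locm := locm_frac (- (repr x).1) (repr x).2.
Definition locm_zero : locm := locm_frac 0 loc_one.

Lemma locm_reprP m s : exists2 u : A, u \in S &
  u *: (den s *: (repr (locm_frac m s)).1)
  = u *: (den (repr (locm_frac m s)).2 *: m).
Proof. by apply/locm_fracP; rewrite locm_repr. Qed.

Lemma locm_addE m s n t : locm_add (locm_frac m s) (locm_frac n t)
  = locm_frac (den t *: m + den s *: n) (loc_mul s t).
Proof.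
rewrite /locm_add; have [u Su uE] := locm_reprP m s.
have [v Sv vE] := locm_reprP n t.
case: (repr (locm_frac m s)) uE => m' s' /= uE.
case: (repr (locm_frac n t)) vE => n' t' /= vE.
apply/locm_fracP; exists (u * v); rewrite ?rpredM //= ?den_mul !scalerDr !scalerA.
congr (_ + _).
  transitivity ((v * den t * den t') *: (u *: (den s *: m'))).
    by rewrite !scalerA; congr (_ *: _); ring.
  by rewrite uE !scalerA; congr (_ *: _); ring.
transitivity ((u * den s * den s') *: (v *: (den t *: n'))).
  by rewrite !scalerA; congr (_ *: _); ring.
by rewrite vE !scalerA; congr (_ *: _); ring.
Qed.

Lemma locm_oppE m s : locm_opp (locm_frac m s) = locm_frac (- m) s.
Proof.
rewrite /locm_opp; have [u Su uE] := locm_reprP m s.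
by apply/locm_fracP; exists u; rewrite // !scalerN uE.
Qed.

Lemma locm_addA : associative locm_add.
Proof.
move=> x y z; rewrite -(locm_repr x) -(locm_repr y) -(locm_repr z) !locm_addE.
apply/locm_fracP; exists 1; rewrite ?rpred1 // !scale1r /= ?den_mul.
rewrite !scalerDr !scalerA !addrA.
by congr (_ *: _ + _ *: _ + _ *: _); ring.
Qed.
Lemma locm_addC : commutative locm_add.
Proof.
move=> x y; rewrite -(locm_repr x) -(locm_repr y) !locm_addE.
apply/locm_fracP; exists 1; rewrite ?rpred1 // !scale1r /= ?den_mul addrC.
by congr (_ *: _); ring.
Qed.
Lemma locm_add0 : left_id locm_zero locm_add.
Proof.
move=> x; rewrite -(locm_repr x) /locm_zero locm_addE.
apply/locm_fracP; exists 1; rewrite ?rpred1 //= ?den_mul ?den_one !scale1r mul1r.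
by rewrite scaler0 add0r.
Qed.
Lemma locm_addN : left_inverse locm_zero locm_opp locm_add.
Proof.
move=> x; rewrite -(locm_repr x) locm_oppE locm_addE.
apply/locm_fracP; exists 1; rewrite ?rpred1 //= ?den_mul ?den_one !scale1r !scaler0.
by rewrite scalerN addNr.
Qed.
HB.instance Definition _ := GRing.isZmodule.Build locm
  locm_addA locm_addC locm_add0 locm_addN.

End Carrier.

Definition locr := locm A^o.
HB.instance Definition _ := GRing.Zmodule.on locr.

Definition loc_scale (M : lmodType A) (a : locr) (x : locm M) : locm M :=
  locm_frac ((repr a).1 *: (repr x).1) (loc_mul (repr a).2 (repr x).2).

Lemma loc_scaleE (M : lmodType A) (a : A) s (m : M) t :
  loc_scale (locm_frac (a : A^o) s) (locm_frac m t)
  = locm_frac (a *: m) (loc_mul s t).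
Proof.
rewrite /loc_scale; have [u Su uE] := locm_reprP (a : A^o) s.
have [v Sv vE] := locm_reprP m t.
case: (repr (locm_frac (a : A^o) s)) uE => a' s' /=; rewrite /GRing.scale /= => uE.
case: (repr (locm_frac m t)) vE => m' t' /= vE.
apply/locm_fracP; exists (u * v); rewrite ?rpredM //= ?den_mul !scalerA.
transitivity ((u * (den s * a')) *: (v *: (den t *: m'))).
  by rewrite !scalerA; congr (_ *: _); ring.
by rewrite uE vE !scalerA; congr (_ *: _); ring.
Qed.

Lemma locr_repr (a : locr) :
  exists (b : A) s, a = locm_frac (b : A^o) s.
Proof. by exists (repr a).1, (repr a).2; rewrite locm_repr. Qed.

Definition locr_mul (a b : locr) : locr := loc_scale a b.
Definition locr_of (a : A) : locr := locm_frac (a : A^o) loc_one.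

Lemma loc_scaleA (M : lmodType A) a b (x : locm M) :
  loc_scale a (loc_scale b x) = loc_scale (locr_mul a b) x.
Proof.
have [a' [s ->]] := locr_repr a; have [b' [t ->]] := locr_repr b.
rewrite -(locm_repr x) /locr_mul (@loc_scaleE A^o a' s b' t) !loc_scaleE.
by apply/locm_fracP; exists 1; rewrite ?rpred1 //= ?den_mul ?den_one !scale1r !scalerA;
  congr (_ *: _); rewrite /GRing.scale /=; ring.
Qed.
Lemma loc_scale1 (M : lmodType A) (x : locm M) :
  loc_scale (locr_of 1) x = x.
Proof.
rewrite -(locm_repr x) loc_scaleE scale1r.
by apply/locm_fracP; exists 1; rewrite ?rpred1 //= ?den_mul ?den_one mul1r.
Qed.
Lemma loc_scaleDr (M : lmodType A) a (x y : locm M) :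
  loc_scale a (x + y) = loc_scale a x + loc_scale a y.
Proof.
have [a' [s ->]] := locr_repr a.
rewrite -(locm_repr x) -(locm_repr y) /GRing.add /= locm_addE !loc_scaleE.
rewrite locm_addE; apply/locm_fracP; exists 1; rewrite ?rpred1 //= ?den_mul ?den_one !scale1r.
by rewrite !scalerDr !scalerA; congr (_ *: _ + _ *: _); ring.
Qed.
Lemma loc_scaleDl (M : lmodType A) (a b : locr) (x : locm M) :
  loc_scale (a + b) x = loc_scale a x + loc_scale b x.
Proof.
have [a' [s ->]] := locr_repr a; have [b' [t ->]] := locr_repr b.
rewrite -(locm_repr x) /GRing.add /= locm_addE !loc_scaleE.
rewrite locm_addE; apply/locm_fracP; exists 1; rewrite ?rpred1 //= ?den_mul ?den_one !scale1r.
rewrite !scalerDl !scalerDr !scalerA /GRing.scale /=.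
by congr (_ *: _ + _ *: _); ring.
Qed.

Lemma locr_mulC : commutative locr_mul.
Proof.
move=> a b; have [a' [s ->]] := locr_repr a; have [b' [t ->]] := locr_repr b.
rewrite /locr_mul !loc_scaleE; apply/locm_fracP; exists 1; rewrite ?rpred1 //= ?den_mul.
by rewrite !scale1r /GRing.scale /=; ring.
Qed.
Lemma locr_mulA : associative locr_mul.
Proof. by move=> a b c; rewrite /locr_mul loc_scaleA. Qed.
Lemma locr_mul1 : left_id (locr_of 1) locr_mul.
Proof. by move=> a; exact: loc_scale1. Qed.
Lemma locr_mulDl : left_distributive locr_mul +%R.
Proof. by move=> a b c; exact: loc_scaleDl. Qed.
HB.instance Definition _ := GRing.Zmodule_isComPzRing.Build locr
  locr_mulA locr_mulC locr_mul1 locr_mulDl.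

HB.instance Definition _ (M : lmodType A) :=
  GRing.Zmodule_isLmodule.Build locr (locm M) (@loc_scaleA M)
    (@loc_scale1 M) (@loc_scaleDr M) (fun x a b => loc_scaleDl a b x).

End LocalizedModule.

Section AtPrime.
Variables (A : comPzRingType) (P : ideal A) (hP : prime_ideal P).

Definition prime_compl_pred of prime_ideal P : A -> bool :=
  fun a => a \notin P.
Lemma prime_compl_closed : mulr_closed (prime_compl_pred hP).
Proof.
split=> [|a b Pa Pb]; first exact: hP.1.
by apply/negP => /hP.2[Pab|Pab]; [move/negP: Pa|move/negP: Pb]; apply.
Qed.
HB.instance Definition _ :=
  GRing.isMulClosed.Build A (prime_compl_pred hP) prime_compl_closed.
Definition prime_compl : mulrClosed A := (prime_compl_pred hP : {pred A}).

Definition ring_at := locr prime_compl.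
HB.instance Definition _ := GRing.ComPzRing.on ring_at.

Definition module_at (M : lmodType A) : lmodType ring_at :=
  locm prime_compl M.

(* The second symbolic power: the preimage of P^2 A_P under A -> A_P. *)
Definition symb_square : set A :=
  [set a | (locr_of prime_compl a : ring_at) \in
    span ([set locr_of prime_compl b | b in [set b : A | b \in smulm P P]]
      : set ring_at^o)].

End AtPrime.

Section Hom.
Variable A : comPzRingType.

Section HomModule.
Variables U V : lmodType A.
Lemma hom_subproof : submod_set [set f : U -> V | linear f].
Proof.
split=> [a x y|a f g hf hg b x y]; first by rewrite scaler0 addr0.
have E (h : U -> V) : a *: h = (fun x => a *: h x) by [].
rewrite E /GRing.add /= hf hg !scalerDr !scalerA mulrC addrACA.
by rewrite -!scalerA.
Qed.
Definition hom := subm (submod_of hom_subproof).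
HB.instance Definition _ := GRing.Lmodule.on hom.

Lemma hom_linear (f : hom) : linear (val f).
Proof. exact: (proj1 (submod_ofE hom_subproof _) (valP f)). Qed.
Definition hom_of (f : U -> V) (hf : linear f) : hom :=
  exist _ f (proj2 (submod_ofE hom_subproof f) hf).
End HomModule.

Section Pre.
Variables (U U' V : lmodType A) (d : {linear U' -> U}).
Lemma hom_pre_subproof (f : hom U V) : linear (val f \o d).
Proof. by move=> a x y; rewrite /= linearP hom_linear. Qed.
Definition hom_pre (f : hom U V) : hom U' V := hom_of (hom_pre_subproof f).
Lemma hom_pre_linear : linear hom_pre.
Proof. by move=> a f g; apply: val_inj. Qed.
HB.instance Definition _ :=
  GRing.isLinear.Build A (hom U V) (hom U' V) *:%R hom_pre hom_pre_linear.
End Pre.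

Section Post.
Variables (U V V' : lmodType A) (g : {linear V -> V'}).
Lemma hom_post_subproof (f : hom U V) : linear (g \o val f).
Proof. by move=> a x y; rewrite /= hom_linear linearP. Qed.
Definition hom_post (f : hom U V) : hom U V' := hom_of (hom_post_subproof f).
Lemma hom_post_linear : linear hom_post.
Proof.
by move=> a f f'; apply: val_inj; apply/funext => x; rewrite /= linearP.
Qed.
HB.instance Definition _ :=
  GRing.isLinear.Build A (hom U V) (hom U V') *:%R hom_post hom_post_linear.
End Post.

End Hom.

Section FreeModule.
Variable A : comPzRingType.

Section OnType.
Variable X : choiceType.
Lemma free_subproof :
  submod_set [set f : X -> A^o | finite_set [set x | f x != 0]].
Proof.
split=> [|a f g /= hf hg].
  by apply: (sub_finite_set _ (@finite_set0 X)) => x /=; rewrite eqxx.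
have: finite_set ([set x | f x != 0] `|` [set x | g x != 0]).
  by rewrite finite_setU.
apply: sub_finite_set => x /=; have [f0|] := eqVneq (f x) 0; last by left.
have [g0|] := eqVneq (g x) 0; last by right.
have -> : (a *: f + g) x = a *: f x + g x by [].
by rewrite f0 g0 scaler0 addr0 eqxx.
Qed.
(* The free A-module on X: the finitely supported functions X -> A. *)
Definition free := subm (submod_of free_subproof).
HB.instance Definition _ := GRing.Lmodule.on free.
End OnType.

Section Augmentation.
Variable N : lmodType A.
Definition free_aug (f : free N) : N := \sum_(x \in [set: N]) val f x *: x.

Lemma free_augE (f : free N) (s : {fset N}) :
  (forall x, x \notin s -> val f x = 0) ->
  free_aug f = \sum_(x <- s) val f x *: x.
Proof.
by move=> hs; apply: fsbigTE => x /hs ->; rewrite scale0r.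
Qed.
Lemma free_support (f : free N) : finite_set [set x | val f x != 0].
Proof. exact: (proj1 (submod_ofE (free_subproof N) _) (valP f)). Qed.

Lemma free_aug_linear : linear free_aug.
Proof.
move=> a f g.
pose s := fset_set ([set x | val f x != 0] `|` [set x | val g x != 0]).
have fin : finite_set ([set x | val f x != 0] `|` [set x | val g x != 0]).
  by rewrite finite_setU; split; exact: free_support.
have hf x : x \notin s -> val f x = 0.
  rewrite in_fset_set // notin_setE /= => /not_orP[h _].
  by apply/eqP; apply: contra_notT h.
have hg x : x \notin s -> val g x = 0.
  rewrite in_fset_set // notin_setE /= => /not_orP[_ h].
  by apply/eqP; apply: contra_notT h.
rewrite (free_augE hf) (free_augE hg) (@free_augE _ s); last first.
  by move=> x hx; rewrite linearP /= /GRing.add /= /GRing.scale /= hf ?hg //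
    scaler0 addr0.
rewrite scaler_sumr -big_split; apply: eq_bigr => x _.
by rewrite linearP /= scalerA -scalerDl.
Qed.
HB.instance Definition _ :=
  GRing.isLinear.Build A (free N) N *:%R free_aug free_aug_linear.
End Augmentation.
End FreeModule.

Section Ext.
Variables (A : comPzRingType) (N : lmodType A).

(* The standard free resolution of N: F_n is free on the elements of the n-th
   syzygy module, which is the kernel of F_(n-1) -> (n-1)-st syzygy. *)
Fixpoint syz (n : nat) : lmodType A :=
  if n is m.+1 then subm (kerm (@free_aug A (syz m))) else N.

Definition res (n : nat) : lmodType A := free A (syz n).
Definition res_d (n : nat) : res n.+1 -> res n :=
  fun x => val (free_aug x : subm (kerm (@free_aug A (syz n)))).
Lemma res_d_linear n : linear (@res_d n).
Proof. by move=> a x y; rewrite /res_d !linearP. Qed.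
HB.instance Definition _ n :=
  GRing.isLinear.Build A (res n.+1) (res n) *:%R (@res_d n) (@res_d_linear n).

Section Groups.
Variable M : lmodType A.

Definition cocycles (n : nat) : submodClosed (hom (res n) M) :=
  kerm (@hom_pre A _ _ M (@res_d n)).
Definition coboundaries (n : nat) : submodClosed (hom (res n) M) :=
  match n with
  | 0%N => submod0 _
  | m.+1 => rangem (@hom_pre A _ _ M (@res_d m))
  end.

Definition Ext (n : nat) : lmodType A :=
  quom (preimm (\val : subm (cocycles n) -> _) (coboundaries n)).
End Groups.

Section Functoriality.
Variables (M M' : lmodType A) (g : {linear M -> M'}) (n : nat).

Lemma cocycles_post (f : hom (res n) M) :
  f \in cocycles M n -> hom_post g f \in cocycles M' n.
Proof.
move=> /submod_ofE /(congr1 val) /= hf; apply/submod_ofE.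
apply: val_inj; apply/funext => x /=.
by have /= -> := congr1 (fun h => h x) hf; rewrite linear0.
Qed.

Lemma coboundaries_post (f : hom (res n) M) :
  f \in coboundaries M n -> hom_post g f \in coboundaries M' n.
Proof.
case: n f => [|m] f /submod_ofE; first by move=> ->; rewrite linear0 rpred0.
case=> h _ <-; apply/submod_ofE; exists (hom_post g h) => //.
exact: val_inj.
Qed.

Definition cocycles_map : subm (cocycles M n) -> subm (cocycles M' n) :=
  subm_map cocycles_post.
HB.instance Definition _ := GRing.Linear.on cocycles_map.

Lemma Ext_map_subproof (f : subm (cocycles M n)) :
  f \in preimm (\val : subm (cocycles M n) -> _) (coboundaries M n) ->
  cocycles_map f \in
    preimm (\val : subm (cocycles M' n) -> _) (coboundaries M' n).
Proof.
by move=> /submod_ofE hf; apply/submod_ofE; exact: coboundaries_post.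
Qed.

Definition Ext_map : {linear Ext M n -> Ext M' n} :=
  quom_map Ext_map_subproof.

End Functoriality.
End Ext.

Section TorsionFree.
Variable O : idomainType.

Section Torsion.
Variable U : lmodType O.
Lemma tors_subproof : submod_set [set x : U | exists2 r : O, r != 0 & r *: x = 0].
Proof.
split=> [|a x y [r r0 hx] [s s0 hy]]; first by exists 1; rewrite ?oner_neq0 ?scaler0.
exists (r * s); first by rewrite mulf_neq0.
rewrite scalerDr scalerA (_ : r * s * a = s * a * r); last by ring.
by rewrite -scalerA hx scaler0 add0r -scalerA hy scaler0.
Qed.
Definition tors : submodClosed U := submod_of tors_subproof.
Definition tf : lmodType O := quom tors.
End Torsion.

Section TfMap.
Variables (U V : lmodType O) (g : {linear U -> V}).
Lemma tf_map_subproof x : x \in tors U -> g x \in tors V.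
Proof.
move=> /submod_ofE[r r0 hx]; apply/submod_ofE; exists r => //.
by rewrite -linearZ hx linear0.
Qed.
Definition tf_map : {linear tf U -> tf V} := quom_map tf_map_subproof.
End TfMap.

Definition is_dvr :=
  (forall I : ideal O, exists w : O, I =i span [set w : O^o]) /\
  exists2 m : ideal O, local_with m & exists2 w : O, w != 0 & w \in m.

End TorsionFree.

Section WilesDefect.
Variables (O : idomainType) (A : comPzRingType).
Variables (eta : {rmorphism O -> A}) (lambda : {rmorphism A -> O}).

Local Notation p := (kerr lambda).

Lemma aug_prime : prime_ideal p.
Proof.
split=> [|a b].
  by apply/negP => /(kerrE lambda)/eqP; rewrite rmorph1 oner_eq0.
move=> /(kerrE lambda)/eqP; rewrite rmorphM mulf_eq0 => /orP[] /eqP h;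
  by [left; apply/kerrE|right; apply/kerrE].
Qed.

(* The O-algebra structure of A is the ring morphism eta, so that lambda is a
   map of O-algebras exactly when lambda \o eta is the identity. *)
Definition cat_C (c : nat) : Prop :=
  [/\ noetherian A,
      exists2 m : ideal A, local_with m & adic_complete m,
      (forall r, lambda (eta r) = r),
      (forall r, exists a, lambda a = r) &
      regular_local (ring_at aug_prime) c].

Section Module.
Variables (M : lmodType A) (c : nat).

(* Ext^c_A(O, N), with its O-module structure induced by eta *)
Definition ExtO (N : lmodType A) : lmodType O :=
  restr eta (Ext (restr lambda O^o) N c).

Local Notation MpM := (quom (smulm p (submodT M))).

Definition ExtO_map : {linear tf (ExtO M) -> tf (ExtO MpM)} :=
  @tf_map O (ExtO M) (ExtO MpM) (restr_map eta (Ext_map (restr lambda O^o)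
    (quom_pi (smulm p (submodT M))) c)).

Definition congruence_module : lmodType O := quom (rangem ExtO_map).

Definition cotangent : lmodType O :=
  restr eta (quom (preimm (\val : subm p -> A^o) (smulm p p))).
Definition Phi : lmodType O := subm (tors cotangent).

Definition wiles_defect : int :=
  (free_rank (module_at aug_prime M) * mod_length Phi)%N%:Z
  - (mod_length congruence_module)%:Z.

End Module.
End WilesDefect.

Section Depth.
Variable A : comPzRingType.

Definition nzdiv (a : A) (M : lmodType A) := forall x : M, a *: x = 0 -> x = 0.

Definition regular_seq (M : lmodType A) (n : nat) (x : nat -> A) :=
  let xM i := smulm (span [set (x j : A^o) | j in [set j | (j < i)%N]]) (submodT M)
  in (forall i, (i < n)%N -> nzdiv (x i) (quom (xM i))) /\
     exists v : M, v \notin xM n.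

(* depth_A M >= n for A local; the zero module has infinite depth. *)
Definition depth_ge (M : lmodType A) (n : nat) :=
  exists2 m : ideal A, local_with m &
    (forall v : M, v = 0) \/
    exists2 x : nat -> A, (forall i, (i < n)%N -> x i \in m) & regular_seq M n x.

End Depth.

Section Hypersurface.
Variables (A : comPzRingType) (f : A).

Definition principal : ideal A := span [set f : A^o].

Variables (C : pzRingType) (h : {rmorphism A -> C}) (hf : f \in kerr h).
Lemma principal_ker (a : A) : a \in principal -> h a = 0.
Proof.
move=> /(proj1 (submod_ofE (span_subproof [set f : A^o]) a)) ha.
by apply/kerrE/ha => y ->.
Qed.

Definition quo_aug : {rmorphism rquot principal -> C} :=
  rquot_lift principal_ker.
End Hypersurface.

Definition quo_struct (O A : comPzRingType) (I : ideal A)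
  (eta : {rmorphism O -> A}) : {rmorphism O -> rquot I} := rquot_pi I \o eta.

(* Main.v *)
Require Import Defs.
From HB Require Import structures.
From mathcomp Require Import all_boot all_order all_algebra ring.
From mathcomp Require Import finmap all_classical.
Import Defs.
Set Implicit Arguments.
Unset Strict Implicit.
Unset Printing Implicit Defensive.
Import GRing.Theory.
Local Open Scope classical_set_scope.
Local Open Scope ring_scope.

(** Write p for the kernel of the augmentation of A and T for the torsion-free
    quotient of M/pM, which is free over O of rank r. As A is regular at p, the
    torsion-free quotient of p/p^2 is free of rank c over O. The class of f in it
    is nonzero because f is not in the second symbolic power of p, so it is t
    times the first vector x_1 of a basis x_1, ..., x_c, with t nonzero
    ([cotangent_basis_ex], [cotangent_dim]). The depth hypothesis allows one to
    lift x_2, ..., x_c to elements y_2, ..., y_c of p such that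
    ws = (f, y_2, ..., y_c) is a regular sequence on M ([choose_sequence]); ws
    generates p after localization at p ([adapted_gen]).

    Let F be a free resolution of O over A. Multiplication by an element w of p
    is null-homotopic on F; composing the homotopies of the entries of ws gives an
    element z of F_c ([zel]), the image of the top generator of the Koszul
    complex. Evaluation at z followed by the projection to T is a map Ext^c -> T
    which is well defined on classes, and
    - Ext^c(O, M) has image I1, the set of classes of those x in M for which p x
      lies in (ws)M ([zel_eval_socle], [socle_lift]);
    - Ext^c(O, M/pM) has image tT: contraction by f is t times contraction by x_1
      ([slot_congr]), and cup products with the classes in Ext^1(O, O) dual to ws
      give all of tT ([zel_eval_lower]);
    - the classes in Ext^c(O, M/pM) that evaluate to 0 are torsion: if r > 0 then
      ws is regular on A at p, and F agrees there with the Koszul complex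
      ([zel_eval_kernel]).
    Hence the congruence module is tT/I1 and
      length (T/I1) = length Psi_A(M) + r length (O/t)
    ([congruence_module_length]). As r is also the rank of M at p
    ([free_rank_at_aug_prime]), the Wiles defect is
      r (length Phi_A + length (O/t)) - length (T/I1)
    ([wiles_defect_eval]).

    For B = A/f and M/fM the sequence y_2, ..., y_c plays the part of ws, with 1
    in place of t, while T and I1 do not change. Killing f = t x_1 makes x_1
    torsion in the cotangent module, so length Phi_B = length Phi_A + length (O/t)
    ([Phi_length]), and the two formulas agree ([wiles_defect_quotient]).

    That B is again an object of the category ([quotient_cat]) uses Krull's
    intersection theorem for completeness. Its localization is regular of
    dimension c - 1: the y_i generate its maximal ideal, which bounds the
    dimension by Krull's height theorem ([height_le]), and a chain of c + 1 primes
    ending at p can be rerouted through f, losing one member ([pch_through]).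

    Localizations are handled by denominators outside p, and maps out of quotient
    modules by relations between representatives. *)

(** * Submodules and linear combinations *)

Section Combinations.
Variables (R : comPzRingType) (V : lmodType R).
Implicit Types (I : set R^o) (N P Q : set V) (s : seq V).

Lemma sub0 P : submod_set P -> P 0. Proof. by case. Qed.
Lemma subD P x y : submod_set P -> P x -> P y -> P (x + y).
Proof. by case=> _ h Px Py; rewrite -[x]scale1r; apply: h. Qed.
Lemma subZ P a x : submod_set P -> P x -> P (a *: x).
Proof. by case=> P0 h Px; rewrite -[_ *: _]addr0; apply: h. Qed.
Lemma subN P x : submod_set P -> P x -> P (- x).
Proof. by move=> hP Px; rewrite -scaleN1r; apply: subZ. Qed.
Lemma subB P x y : submod_set P -> P x -> P y -> P (x - y).
Proof. by move=> hP Px Py; apply: subD => //; apply: subN. Qed.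
Lemma subDr P x y : submod_set P -> P y -> P (x + y) -> P x.
Proof. by move=> hP Py Pxy; rewrite -(addrK y x); apply: subB. Qed.

Lemma submod_closed_set (S : submodClosed V) : submod_set [set x | x \in S].
Proof.
by split=> [|a x y /= Sx Sy]; [exact: rpred0|rewrite /= rpredD ?rpredZ].
Qed.

Lemma submod_setT : submod_set [set: V].
Proof. by []. Qed.
Lemma submod_set0 : submod_set [set 0 : V].
Proof. exact: zero_subproof. Qed.

Lemma submod_setI P Q : submod_set P -> submod_set Q -> submod_set (P `&` Q).
Proof.
move=> hP hQ; split=> [|a x y [Px Qx] [Py Qy]]; first by split; apply: sub0.
by split; apply: subD => //; apply: subZ.
Qed.

Lemma span_sub (X : set V) P : submod_set P -> X `<=` P ->
  [set x | x \in span X] `<=` P.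
Proof.
move=> hP XP x /= /submod_ofE h; apply/(submod_ofE hP); apply: h => y Xy.
by apply/submod_ofE/XP.
Qed.
Lemma span_gen (X : set V) x : X x -> x \in span X.
Proof. by move=> Xx; apply/submod_ofE => S; apply. Qed.

(** The coefficients in I are peeled off along the list, so that a finite
    generating list is handled by induction. *)
Fixpoint comb I N s (x : V) : Prop :=
  if s is v :: s' then exists2 a, I a & comb I N s' (x - a *: v) else N x.

Lemma comb_sub I N s : submod_set I -> submod_set N -> submod_set (comb I N s).
Proof.
move=> hI hN; elim: s => [|v s IH] //=; split.
  by exists 0; rewrite ?scale0r ?subr0; [exact: hI.1|exact: IH.1].
move=> a x y [b Ib hx] [c Ic hy]; exists (a * b + c); first exact: (hI.2 a b c Ib Ic).
have -> : a *: x + y - (a * b + c) *: v = a *: (x - b *: v) + (y - c *: v).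
  by rewrite scalerDl scalerBr scalerA opprD addrACA.
by apply: subD => //; apply: subZ.
Qed.

Lemma combN I N P s : N `<=` P -> comb I N s `<=` comb I P s.
Proof.
move=> NP; elim: s => [|v s IH] x /=; first exact: NP.
by case=> a Ia h; exists a => //; apply: IH.
Qed.
Lemma comb_base I N s : submod_set I -> N `<=` comb I N s.
Proof.
move=> hI; elim: s => [|v s IH] x Nx //=.
by exists 0; rewrite ?scale0r ?subr0; [exact: hI.1|apply: IH].
Qed.
Lemma comb_mem I N s v a : submod_set I -> submod_set N -> I a ->
  v \in s -> comb I N s (a *: v).
Proof.
move=> hI hN Ia; elim: s => // w s IH; rewrite inE => /orP[/eqP->|vs] /=.
  by exists a => //; rewrite subrr; apply: comb_base => //; apply: sub0.
by exists 0; [exact: hI.1|rewrite scale0r subr0; apply: IH].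
Qed.
Lemma comb_ind I N P s : submod_set P -> N `<=` P ->
  (forall a v, I a -> v \in s -> P (a *: v)) -> comb I N s `<=` P.
Proof.
move=> hP NP; elim: s => [|v s IH] hs x /=; first exact: NP.
case=> a Ia /IH h; rewrite -(subrK (a *: v) x); apply: subD => //.
  by apply: h => b w Ib ws; apply: hs; rewrite // inE ws orbT.
by apply: hs; rewrite // mem_head.
Qed.

Definition lc s := comb setT [set 0] s.
Lemma lc_sub s : submod_set (lc s).
Proof. by apply: comb_sub => //; exact: submod_set0. Qed.
Lemma lc_mem s v : v \in s -> lc s v.
Proof.
by move=> vs; rewrite -[v]scale1r; apply: comb_mem => //; apply: submod_set0.
Qed.
Lemma lc_ind s P : submod_set P -> (forall v, v \in s -> P v) -> lc s `<=` P.
Proof.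
move=> hP h; apply: comb_ind => // [x ->|a v _ vs]; first exact: sub0.
by apply: subZ => //; apply: h.
Qed.
Lemma span_lc s x : x \in span [set y | y \in s] <-> lc s x.
Proof.
split=> [h|h].
  by apply: (span_sub (lc_sub s) _ h) => y /=; apply: lc_mem.
move: x h; apply: lc_ind; first exact: submod_closed_set.
by move=> v vs /=; apply: span_gen.
Qed.

Definition fgs P := exists s, forall x, P x <-> lc s x.
Definition noeth_mod := forall P, submod_set P -> fgs P.
End Combinations.

(** * Noetherian modules and Nakayama's lemma *)

Section Noetherian.
Variable R : comPzRingType.

Lemma noetherianP : noetherian R -> noeth_mod R^o.
Proof.
move=> h P hP; have [s hs] := h (submod_of hP); exists s => x.
split=> [Px|/(@span_lc _ R^o) ].
  by apply/(@span_lc _ R^o); rewrite -hs; apply/submod_ofE.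
by rewrite -hs => /submod_ofE.
Qed.

Lemma noetherianI : noeth_mod R^o -> noetherian R.
Proof.
move=> h I; have [s hs] := h _ (submod_closed_set I); exists s => x.
by apply/idP/idP => [/hs/(@span_lc _ R^o)|/(@span_lc _ R^o)/hs].
Qed.

(** Induction on the number of generators of V: the coefficients of one
    generator in the elements of a submodule form a finitely generated ideal,
    and correcting by finitely many elements of the submodule leaves it inside
    the span of the other generators. *)
Lemma noeth_fg (V : lmodType R) : noeth_mod R^o -> fg_module V -> noeth_mod V.
Proof.
move=> noeR [s0 hs0] P0 hP0.
have h s : forall P, submod_set P -> P `<=` lc s -> fgs (P : set V).
  elim: s => [|v s IH] P hP Ps.
    exists [::] => x; split; first exact: Ps.
    by move=> /= ->; apply: sub0.
  pose I : set R^o := [set a | exists2 x, P x & lc s (x - a *: v)].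
  have hI : submod_set I.
    split=> [|a b c [x Px hx] [y Py hy]].
      by exists 0; [exact: sub0|rewrite scale0r subr0; apply: sub0; exact: lc_sub].
    exists (a *: x + y); first exact: hP.2.
    have -> : a *: x + y - (a *: b + c) *: v = a *: (x - b *: v) + (y - c *: v).
      by rewrite scalerDl scalerBr scalerA opprD addrACA.
    exact: (lc_sub s).2.
  have [t ht] := noeR _ hI.
  have /choice[g hg] : forall a : R^o, exists x, I a -> P x /\ lc s (x - a *: v).
    move=> a; have [[x Px hx]|nI] := pselect (I a); first by exists x.
    by exists 0 => /nI.
  have [r hr] := IH _ (submod_setI hP (lc_sub s)) (@subIsetr _ _ _).
  exists (map g t ++ r) => x; split; last first.
    apply: lc_ind => // y; rewrite mem_cat => /orP[/mapP[a at_ ->]|yr].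
      by have [] := hg a (proj2 (ht _) (lc_mem at_)).
    by have [] := proj2 (hr _) (lc_mem yr).
  move=> Px; have [a _ hx] := Ps x Px.
  have /ht ha : I a by exists x.
  have : exists2 y, lc (map g t) y & lc s (y - a *: v).
    have hc : submod_set
      [set b : R^o | exists2 y, lc (map g t) y & lc s (y - b *: v)].
      split=> [|b c d [y y1 y2] [z z1 z2]].
        by exists 0; [exact: (lc_sub _).1|rewrite scale0r subr0; exact: (lc_sub _).1].
      exists (b *: y + z); first exact: (lc_sub _).2.
      have -> : b *: y + z - (b *: c + d) *: v = b *: (y - c *: v) + (z - d *: v).
        by rewrite scalerDl scalerBr scalerA opprD addrACA.
      exact: (lc_sub s).2.
    apply: (lc_ind hc _ ha) => b bt /=; have Ib := proj2 (ht _) (lc_mem bt).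
    by exists (g b); [apply/lc_mem/map_f|exact: (hg _ Ib).2].
  case=> y ly hy; rewrite -(subrK y x).
  have sub_l : lc (map g t) `<=` lc (map g t ++ r).
    by apply: lc_ind; [exact: lc_sub|move=> w wt; apply: lc_mem; rewrite mem_cat wt].
  have sub_r : lc r `<=` lc (map g t ++ r).
    by apply: lc_ind; [exact: lc_sub|move=> w wt; apply: lc_mem; rewrite mem_cat wt orbT].
  apply: subD; [exact: lc_sub| |exact: sub_l].
  apply/sub_r/hr; split.
    apply: subB => //; move: y ly hy => y ly _; apply: (lc_ind hP _ ly) => w /mapP[b bt ->].
    by have [] := hg b (proj2 (ht _) (lc_mem bt)).
  have -> : x - y = (x - a *: v) - (y - a *: v) by rewrite opprB addrA subrK.
  by apply: subB => //; exact: lc_sub.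
apply: (h s0 _ hP0) => x _; apply/span_lc; exact: hs0.
Qed.

Section Module.
Variable V : lmodType R.
Hypothesis noeV : noeth_mod V.

Lemma noeth_chain (P : nat -> set V) : (forall n, submod_set (P n)) ->
  (forall n, P n `<=` P n.+1) -> exists n, P n.+1 `<=` P n.
Proof.
move=> hP mono; have mon m n : (m <= n)%N -> P m `<=` P n.
  move=> /subnK <-; elim: (n - m)%N => // k IH; rewrite addSn.
  by apply: (subset_trans IH); exact: mono.
pose U := [set x | exists n, P n x].
have hU : submod_set U.
  split=> [|a x y [m Px] [n Py]]; first by exists 0; apply: sub0.
  exists (maxn m n); apply: (hP _).2; first by apply: mon Px; rewrite leq_maxl.
  by apply: mon Py; rewrite leq_maxr.
have [s hs] := noeV hU.
have [n hn] : exists n, forall v, v \in s -> P n v.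
  have : forall v, v \in s -> U v by move=> v vs; apply/hs/lc_mem.
  elim: s {hs} => [|v s IH] h; first by exists 0.
  have [|n hn] := IH; first by move=> w ws; apply: h; rewrite inE ws orbT.
  have [m hm] : U v by apply: h; rewrite mem_head.
  exists (maxn m n) => w; rewrite inE => /orP[/eqP->|ws].
    by apply: mon hm; rewrite leq_maxl.
  by apply: mon (hn w ws); rewrite leq_maxr.
exists n => x Px; have /hs : U x by exists n.+1.
exact: lc_ind.
Qed.

(** Otherwise each member could be enlarged, and iterated choice would build an
    ascending chain that never stops. *)
Lemma noeth_max (Fam : set (set V)) (P0 : set V) :
  (forall P, Fam P -> submod_set P) -> Fam P0 ->
  exists P, [/\ Fam P, P0 `<=` P & forall Q, Fam Q -> P `<=` Q -> Q `<=` P].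
Proof.
move=> hF F0; apply: contrapT => /forallNP hno.
have /choice[g hg] : forall P, exists Q, Fam P -> P0 `<=` P ->
    [/\ Fam Q, P `<=` Q & ~ (Q `<=` P)].
  move=> P; have [FP|] := pselect (Fam P); last by exists P0.
  have [P0P|] := pselect (P0 `<=` P); last by exists P0.
  have [|/existsNP[Q] /not_implyP[FQ] /not_implyP[PQ nQ]] :=
    pselect (forall Q, Fam Q -> P `<=` Q -> Q `<=` P); last by exists Q.
  by move=> hm; case: (hno P).
pose P n := iter n g P0.
have hP n : Fam (P n) /\ P0 `<=` P n.
  elim: n => [|n [FPn P0Pn]]; first by split.
  have [FQ PQ _] := hg _ FPn P0Pn.
  by split=> //; apply: subset_trans PQ.
have [||n hn] := @noeth_chain P; first by move=> n; apply/hF; case: (hP n).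
  by move=> n; have [FP P0P] := hP n; have [] := hg _ FP P0P.
by have [FP P0P] := hP n; have [_ _] := hg _ FP P0P; apply.
Qed.
End Module.
End Noetherian.

Lemma prime1 (R : comPzRingType) (P : ideal R) a b :
  prime_ideal P -> a \notin P -> b \notin P -> a * b \notin P.
Proof. by move=> hP aP bP; apply/negP => /hP.2[]; apply/negP. Qed.

Section Nakayama.
Variables (R : comPzRingType) (P : ideal R) (hP : prime_ideal P).
Variable V : lmodType R.
Local Notation setP := ([set a : R^o | a \in P]).

Lemma idealMl a b : b \in P -> a * b \in P.
Proof. by move=> bP; apply: (@rpredZ _ _ P a). Qed.
Lemma idealMr a b : b \in P -> b * a \in P.
Proof. by rewrite mulrC; apply: idealMl. Qed.
Lemma ideal_setP : submod_set setP.
Proof. exact: submod_closed_set. Qed.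

(** The generators are eliminated one at a time: in the relation for w the
    factor t - q is outside P and multiplies w into the span of the remaining
    generators. *)
Lemma nakayama_gen (N : set V) (s : seq V) : submod_set N ->
  (forall v, v \in s -> exists2 t, t \notin P & comb setP N s (t *: v)) ->
  exists2 t, t \notin P & forall v, v \in s -> N (t *: v).
Proof.
move=> hN; elim: s => [|w s IH] h; first by exists 1; [exact: hP.1|].
have [t tP [q qP hw]] := h w (mem_head _ _).
have cs := comb_sub s ideal_setP hN.
have uP : t - q \notin P.
  by apply/negP => uP; move/negP: tP; apply; rewrite -(subrK q t) rpredD.
have hu : comb setP N s ((t - q) *: w) by rewrite scalerBl.
have [v vs|r rP hr] := IH.
  have [t' t'P [b bP hb]] := h v (mem_behead (s := w :: s) vs).
  exists (t' * (t - q)); first exact: prime1.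
  have -> : (t' * (t - q)) *: v = (t - q) *: (t' *: v - b *: w) + b *: ((t - q) *: w).
    by rewrite scalerBr !scalerA (mulrC (t - q) t') (mulrC (t - q) b) subrK.
  by apply: subD => //; apply: subZ.
exists (r * (t - q)); first exact: prime1.
move=> v; rewrite inE => /orP[/eqP->|vs]; last first.
  by rewrite mulrC -scalerA; apply: subZ => //; apply: hr.
rewrite -scalerA.
have hr' : submod_set [set x | N (r *: x)].
  split=> [|a x y /= hx hy]; first by rewrite /= scaler0; apply: sub0.
  by rewrite /= scalerDr scalerA mulrC -scalerA; apply: hN.2.
apply: (comb_ind hr' _ _ hu); first by move=> x Nx /=; apply: subZ.
by move=> a x _ xs /=; rewrite scalerA mulrC -scalerA; apply: subZ (hr _ xs).
Qed.

(** Nakayama's lemma over the local ring at P, freed of localizations: the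
    hypothesis says K = N + P K at P, and the conclusion provides one
    denominator for the whole of K. *)
Lemma nakayama (N K : set V) : submod_set N -> fgs K ->
  (forall v, K v -> exists2 t, t \notin P &
     exists S : seq V, (forall x, x \in S -> K x) /\ comb setP N S (t *: v)) ->
  exists2 t, t \notin P & forall v, K v -> N (t *: v).
Proof.
move=> hN [s hs] h.
have [v vs|t tP ht] := @nakayama_gen N s hN.
  have [t tP [S [SK hS]]] := h v (proj2 (hs _) (lc_mem vs)).
  exists t => //; apply: comb_ind hS.
  - exact: comb_sub ideal_setP hN.
  - exact: comb_base ideal_setP.
  move=> a x aP /SK/hs xs; move: x xs; apply: lc_ind.
    split=> [|b y z /= hy hz].
      by rewrite /= scaler0; exact: (comb_sub s ideal_setP hN).1.
    rewrite /= scalerDr scalerA mulrC -scalerA.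
    exact: (comb_sub s ideal_setP hN).2.
  by move=> y ys /=; apply: comb_mem => //; exact: ideal_setP.
exists t => // v /hs; move: v; apply: lc_ind => [|w ws /=]; last exact: ht.
split=> [|a x y /= hx hy]; first by rewrite /= scaler0; apply: sub0.
by rewrite /= scalerDr scalerA mulrC -scalerA; apply: hN.2.
Qed.

(** Nakayama's lemma with empty combinations. *)
Lemma common_den (K : set V) (D : set V) : fgs K -> submod_set D ->
  (forall v, K v -> exists2 t, t \notin P & D (t *: v)) ->
  exists2 t, t \notin P & forall v, K v -> D (t *: v).
Proof.
move=> fK hD h; apply: nakayama => // v /h[t tP Dt]; exists t => //.
by exists [::].
Qed.
End Nakayama.

(** * Associated primes, prime avoidance and regular sequences *)

Section Primes.
Variable R : comPzRingType.
Implicit Types (P Q : ideal R).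

Lemma idealD Q (a b : R) : a \in Q -> b \in Q -> a + b \in Q.
Proof. exact: (@rpredD _ Q a b). Qed.
Lemma idealB Q (a b : R) : a \in Q -> b \in Q -> a - b \in Q.
Proof. exact: (@subB _ _^o _ a b (submod_closed_set Q)). Qed.
Lemma ideal0 Q : (0 : R) \in Q.
Proof. exact: (@rpred0 _ Q). Qed.

Lemma maximal_prime Q : maximal_ideal Q -> prime_ideal Q.
Proof.
case=> Q1 hQ; split=> // a b abQ; have [|aQ] := boolP (a \in Q); first by left.
right; pose K : set R^o := [set x | exists2 q, q \in Q & exists c, x = q + c * a].
have hK : submod_set K.
  split=> [|c x y [q qQ [d ->]] [q' q'Q [d' ->]]].
    by exists 0; [exact: rpred0|exists 0; rewrite mul0r addr0].
  exists (c * q + q'); first by apply: idealD => //; apply: idealMl.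
  by exists (c * d + d'); rewrite /GRing.scale /=; ring.
have QK : {subset Q <= submod_of hK}.
  by move=> q qQ; apply/submod_ofE; exists q => //; exists 0; rewrite mul0r addr0.
have [|K1] := boolP (1 \in submod_of hK); last first.
  have := hQ _ QK K1 a; rewrite (negbTE aQ) => /(_ _)/notF; case.
  by apply/submod_ofE; exists 0; [exact: rpred0|exists 1; rewrite mul1r add0r].
move=> /submod_ofE[q qQ [c e]].
by rewrite -[b]mul1r e mulrDl; apply: idealD; [apply: idealMr|rewrite -mulrA; apply: idealMl].
Qed.

Hypothesis noeR : noeth_mod R^o.

Lemma max_ideal_ex (I : set R^o) : submod_set I -> ~ I 1 ->
  exists2 Q, maximal_ideal Q & forall a, I a -> a \in Q.
Proof.
move=> hI I1; have [|//|P [[hP P1] IP hmax]] :=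
  @noeth_max _ _ noeR [set P : set R^o | @submod_set R R^o P /\ ~ P 1] I; first by move=> ? [].
exists (submod_of hP); last by move=> a Ia; apply/submod_ofE/IP.
split=> [|J PJ J1]; first by apply/negP => /submod_ofE.
have h : [set a : R^o | a \in J] `<=` P.
  apply: hmax; first by split; [exact: submod_closed_set|apply/negP].
  by move=> b Pb; apply: PJ; apply/submod_ofE.
by move=> a aJ; apply/submod_ofE/h.
Qed.

Lemma local_unit (m : ideal R) a : local_with m -> a \notin m ->
  exists b, a * b = 1.
Proof.
move=> [_ hm] am; apply: contrapT => hno.
pose I : set R^o := [set x | exists b, x = a * b].
have hI : submod_set I.
  split=> [|c x y [b ->] [b' ->]]; first by exists 0; rewrite mulr0.
  by exists (c * b + b'); rewrite /GRing.scale /=; ring.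
have [|Q /hm QJ IQ] := max_ideal_ex hI; first by case=> b e; apply: hno; exists b.
by move/negP: am; apply; rewrite -QJ; apply: IQ; exists 1; rewrite mulr1.
Qed.

Section Module.
Variable V : lmodType R.

(** A maximal annihilator among those of the multiples of v modulo N is
    prime. *)
Lemma assoc_prime (N : set V) v : submod_set N -> ~ N v ->
  exists b Q, [/\ ~ N (b *: v), prime_ideal Q &
    forall a, a \in Q <-> N (a *: (b *: v))].
Proof.
move=> hN Nv; pose ann b : set R^o := [set a | N (a *: (b *: v))].
have hann b : submod_set (ann b).
  split=> [|c x y /= hx hy]; first by rewrite /ann /= scale0r; exact: hN.1.
  by rewrite /ann /= scalerDl -scalerA; apply: hN.2.
have [||P [[b Nb ->] _ hmax]] := @noeth_max _ _ noeR
  [set P : set R^o | exists2 b, ~ N (b *: v) & P = ann b] (ann 1).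
- by move=> P [b _ ->].
- by exists 1; rewrite ?scale1r.
exists b, (submod_of (hann b)); split=> //; last by move=> a; exact: submod_ofE.
split=> [|x y /(submod_ofE (hann b)) xy].
  by apply/negP => /(submod_ofE (hann b)); rewrite /ann /= scale1r.
have [|nx] := pselect (N (x *: (b *: v))); first by left; apply/(submod_ofE (hann b)).
right; apply/(submod_ofE (hann b)).
have h : ann (x * b) `<=` ann b.
  apply: hmax; first by exists (x * b); rewrite // -scalerA.
  move=> z hz; rewrite /ann /=.
  have -> : z *: ((x * b) *: v) = x *: (z *: (b *: v)).
    by rewrite !scalerA; congr (_ *: _); ring.
  exact: (subZ x hN hz).
by apply: (h (y : R^o)); move: xy; rewrite /ann /= !scalerA mulrA (mulrC y).
Qed.

(** Noetherian induction on a submodule N whose zero divisors are already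
    covered: if N is not everything, V/N has an associated prime Q, the
    annihilator of some w, and adding w to N costs at most the prime Q. *)
Lemma zdiv_primes : noeth_mod V -> exists s : seq (ideal R),
  (forall Q, List.In Q s -> prime_ideal Q /\
     exists2 v : V, v <> 0 & forall a, a \in Q -> a *: v = 0) /\
  (forall (v : V) a, v <> 0 -> a *: v = 0 -> exists2 Q, List.In Q s & a \in Q).
Proof.
move=> noeV; pose good (s : seq (ideal R)) := forall Q, List.In Q s -> prime_ideal Q /\
     exists2 v : V, v <> 0 & forall a, a \in Q -> a *: v = 0.
pose cov (N : set V) s := forall (v : V) (a : R), N v -> v <> 0 -> a *: v = 0 ->
  exists2 Q : ideal R, List.In Q s & a \in Q.
have [||N [[hN [s [gs cs]]] _ hmax]] := @noeth_max _ _ noeV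
   [set N | submod_set N /\ exists s, good s /\ cov N s] [set 0].
- by move=> N [].
- split; first exact: submod_set0.
  by exists [::]; split=> // v a ->.
suff hT v : N v.
  by exists s; split=> // v a; apply: cs.
apply: contrapT => /(assoc_prime hN)[b [Q [Nw hQ hw]]].
set w := b *: v in Nw hw.
pose N2 : set V := [set x | exists2 n, N n & exists c, x = n + c *: w].
have hN2 : submod_set N2.
  split=> [|d x y [n Nn [c ->]] [n' Nn' [c' ->]]].
    by exists 0; [exact: hN.1|exists 0; rewrite scale0r addr0].
  exists (d *: n + n'); first exact: hN.2.
  by exists (d * c + c'); rewrite scalerDr scalerDl scalerA addrACA.
have outQ x a : N2 x -> ~ N x -> N (a *: x) <-> a \in Q.
  move=> [n Nn [c ->]] Nx.
  have cQ : c \notin Q.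
    by apply/negP => /hw h; apply: Nx; apply: subD.
  split=> [h|aQ].
    have : a * c \in Q.
      by apply/hw; rewrite -scalerA; apply: (subDr (y := a *: n)) => //;
        rewrite ?scalerDr in h *; [exact: subZ|rewrite addrC].
    by case/hQ.2 => //; rewrite (negbTE cQ).
  rewrite scalerDr scalerA; apply: subD => //; first exact: subZ.
  by apply/hw; rewrite mulrC idealMl.
suff : N2 `<=` N.
  by move=> h; apply: Nw; apply: h; exists 0; [exact: hN.1|exists 1; rewrite scale1r add0r].
apply: hmax; last by move=> x Nx; exists x => //; exists 0; rewrite scale0r addr0.
split=> //.
have [[u [N2u Nu hu]]|hno] := pselect (exists u, [/\ N2 u, ~ N u &
    forall a, N (a *: u) -> a *: u = 0]).
  exists (Q :: s); split.
    move=> Q' [<-|/gs//]; split=> //; exists u.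
      by move=> u0; apply: Nu; rewrite u0; exact: hN.1.
    by move=> a aQ; apply/hu/outQ.
  move=> x a N2x x0 ax; have [Nx|Nx] := pselect (N x).
    by have [Q' Qs aQ] := cs x a Nx x0 ax; exists Q'; [right|].
  by exists Q; [left|apply/(outQ x) => //; rewrite ax; exact: hN.1].
exists s; split=> // x a N2x x0 ax; have [Nx|Nx] := pselect (N x).
  exact: (cs x a Nx x0 ax).
have [c Ncx cx] : exists2 c, N (c *: x) & c *: x <> 0.
  apply: contrapT => h; apply: hno; exists x; split=> // c Nc.
  by apply: contrapT => cx; apply: h; exists c.
by apply: (cs (c *: x)) => //; rewrite scalerA mulrC -scalerA ax scaler0.
Qed.
End Module.

Lemma In_filter (T : Type) (p : pred T) s x :
  List.In x [seq y <- s | p y] <-> List.In x s /\ p x.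
Proof.
elim: s => [|y s IH] /=; first by split=> [|[]].
case: ifP => py /=; rewrite IH; split.
- by case=> [<-|[]]; split=> //; [left|right].
- by case=> -[->|]; [left|right].
- by case=> ? ?; split=> //; right.
- by case=> -[e|//]; rewrite -e py.
Qed.

(** Multiply an element of J outside Q by elements of the Q' outside Q. *)
Lemma prime_mul_avoid (J : set R^o) (s : seq (ideal R)) Q : submod_set J ->
  prime_ideal Q -> ~ (J `<=` [set a | a \in Q]) ->
  (forall Q', List.In Q' s -> ~ {subset Q' <= Q}) ->
  exists u, [/\ J u, u \notin Q & forall Q', List.In Q' s -> u \in Q'].
Proof.
move=> hJ hQ JQ; elim: s => [|P s IH] hs.
  have /existsNP[u /not_implyP[Ju /negP uQ]] := JQ.
  by exists u.
have [|u [Ju uQ us]] := IH; first by move=> Q' hQ'; apply: hs; right.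
have /existsNP[a /not_implyP[aP /negP aQ]] := hs P (or_introl erefl).
exists (a * u); split.
- exact: (subZ a hJ Ju).
- exact: prime1.
- by move=> Q' [<-|/us uQ']; [apply: idealMr|apply: idealMl].
Qed.

(** Davis's form of prime avoidance. Induction handles the primes of the list
    not contained in the first one, Q. If x + u still lies in Q, then u is
    corrected by an element of J outside Q that lies in all these other
    primes. *)
Lemma avoid_coset (J : set R^o) (x : R) (s : seq (ideal R)) : submod_set J ->
  (forall Q, List.In Q s -> prime_ideal Q /\ ~ (J `<=` [set a | a \in Q])) ->
  exists2 u, J u & forall Q, List.In Q s -> x + u \notin Q.
Proof.
move=> hJ; have [n] := ubnP (size s); elim: n s => // n IH [|Q s] sz hs.
  by exists 0; [exact: hJ.1|].
pose s' := seq.filter (fun P : ideal R => ~~ `[< {subset P <= Q} >]) s.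
have in_s' P : List.In P s' <-> List.In P s /\ ~ {subset P <= Q}.
  rewrite In_filter; split=> -[hP h]; split=> //.
    by move=> PQ; move/asboolPn: h; apply.
  by apply/asboolPn.
have [||u Ju hu] := IH s'.
- by rewrite size_filter (leq_ltn_trans (count_size _ _)).
- by move=> P /in_s'[Ps _]; apply: hs; right.
have [hQ JQ] := hs Q (or_introl erefl).
have fin y : y \notin Q -> (forall P, List.In P s' -> y \notin P) ->
    forall P, List.In P (Q :: s) -> y \notin P.
  move=> yQ ys P [<-//|Ps]; have [PQ|nPQ] := pselect {subset P <= Q}.
    by apply/negP => /PQ; apply/negP.
  by apply/ys/in_s'.
have [xQ|xQ] := boolP (x + u \in Q); last by exists u => //; apply: fin.
have [|v [Jv vQ vs]] := @prime_mul_avoid J s' Q hJ hQ JQ.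
  by move=> P /in_s'[].
exists (u + v); first exact: subD.
rewrite addrA; apply: fin.
  apply/negP => h; move/negP: vQ; apply.
  have -> : v = (x + u + v) - (x + u) by rewrite addrC addKr.
  exact: idealB.
move=> P Ps; apply/negP => h; have /negP := hu P Ps; apply.
by rewrite -[x + u](addrK v); apply: idealB => //; apply: vs.
Qed.

(** An associated prime of V that contains J contains the squares of the
    elements of p, hence p, and would give a nonzero element of V killed by
    p. *)
Lemma regular_coset (V : lmodType R) (p : ideal R) (J : set R^o) (x : R) :
  noeth_mod V -> submod_set J -> (forall a, a \in p -> J (a * a)) ->
  (forall v : V, (forall a, a \in p -> a *: v = 0) -> v = 0) ->
  exists2 u, J u & nzdiv (x + u) V.
Proof.
move=> noeV hJ pJ hp; have [s [hs cs]] := zdiv_primes noeV.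
have [|u Ju hu] := @avoid_coset J x s hJ.
  move=> Q Qs; have [hQ [v v0 hv]] := hs Q Qs; split=> // JQ.
  (* J inside Q forces p inside Q. *)
  have [pQ|/existsNP[a /not_implyP[ap aQ]]] := pselect {subset p <= Q}.
    by apply: v0; apply: hp => a /pQ/hv.
  by have /hQ.2[] := JQ _ (pJ a ap).
exists u => // v xv; apply: contrapT => v0.
by have [Q Qs] := cs _ _ v0 xv; apply/negP/hu.
Qed.
End Primes.

Section ListIdeal.
Variable R : comPzRingType.
Implicit Types (xs ys ws : seq R).

Section Def.
Variable V : lmodType R.

(** The submodule (ws)V. *)
Fixpoint idm ws (m : V) : Prop :=
  if ws is w :: ws' then exists m', idm ws' (m - w *: m') else m = 0.

Lemma idm_sub ws : submod_set (idm ws).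
Proof.
elim: ws => [|w ws IH]; first exact: submod_set0.
split=> /= [|a x y [x' hx] [y' hy]]; first by exists 0; rewrite scaler0 subr0; exact: IH.1.
exists (a *: x' + y').
have -> : a *: x + y - w *: (a *: x' + y') = a *: (x - w *: x') + (y - w *: y').
  by rewrite scalerBr scalerDr !scalerA (mulrC w a) opprD addrACA.
exact: IH.2.
Qed.

Lemma idm_mem ws w (m : V) : w \in ws -> idm ws (w *: m).
Proof.
elim: ws => // x ws IH; rewrite inE => /orP[/eqP->|/IH h] /=.
  by exists m; rewrite subrr; exact: (idm_sub ws).1.
by exists 0; rewrite scaler0 subr0.
Qed.
Lemma idm_ind ws (P : set V) : submod_set P ->
  (forall w m, w \in ws -> P (w *: m)) -> idm ws `<=` P.
Proof.
move=> hP; elim: ws => [|w ws IH] hs x /=; first by move=> ->; exact: hP.1.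
case=> m h; rewrite -(subrK (w *: m) x); apply: subD => //.
  by apply: IH => // w' m' hw; apply: hs; rewrite inE hw orbT.
by apply: hs; rewrite mem_head.
Qed.
Lemma idm_subset ws ys : {subset ws <= ys} -> idm ws `<=` idm ys.
Proof.
by move=> h; apply: idm_ind => [|w m /h]; [exact: idm_sub|apply: idm_mem].
Qed.

(** ws is a regular sequence on V/(xs)V, except that the last quotient may
    vanish. The entries already used are accumulated in xs. *)
Fixpoint mreg xs ws : Prop :=
  if ws is w :: ws' then
    (forall m : V, idm xs (w *: m) -> idm xs m) /\ mreg (w :: xs) ws'
  else True.

Lemma mreg_eq xs ys ws : xs =i ys -> mreg xs ws -> mreg ys ws.
Proof.
elim: ws xs ys => //= w ws IH xs ys e [h1 h2]; split.
  move=> m /(@idm_subset _ xs) h; apply: (@idm_subset xs); first by move=> z; rewrite e.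
  by apply/h1/h => z; rewrite e.
by apply: IH h2 => z; rewrite !inE e.
Qed.

(** Two adjacent entries w, b may be exchanged over a local ring: if b kills v
    modulo (xs), then v is w times another such element modulo (xs), so
    Nakayama's lemma makes v vanish. Repeating this moves w to the end. *)
Lemma mreg_rotate (m : ideal R) (xs : seq R) (w : R) (ws : seq R) : noeth_mod V -> prime_ideal m ->
  (forall a : R, a \notin m -> exists b, a * b = 1) -> {subset w :: ws <= m} ->
  mreg xs (w :: ws) ->
  (forall v : V, idm (xs ++ ws) (w *: v) -> idm (xs ++ ws) v) /\ mreg xs ws.
Proof.
move=> noeV hm um; elim: ws xs => [|b ws IH] xs wsm; first by rewrite cats0.
move=> [/= regw [regb regws]].
have wm : w \in m by apply: wsm; rewrite mem_head.
have sub_xs z : idm xs `<=` idm (z :: xs).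
  by apply: idm_subset => y; rewrite inE orbC => ->.
have regb' (v : V) : idm xs (b *: v) -> idm xs v.
  pose K : set V := [set v | idm xs (b *: v)].
  have hK : submod_set K.
    split=> [|a y z hy hz]; first by rewrite /K /= scaler0; exact: (idm_sub xs).1.
    by rewrite /K /= scalerDr scalerA mulrC -scalerA; exact: (idm_sub xs).2.
  have [|t tm ht] := @nakayama _ _ hm _ (idm xs) K (idm_sub xs) (noeV _ hK).
    move=> y Ky; exists 1; first exact: hm.1.
    have /sub_xs/regb [y' hy'] : idm xs (b *: y) by [].
    exists [:: y']; split; last by exists w; rewrite // scale1r.
    move=> z; rewrite inE => /eqP->; rewrite /K /=; apply: regw.
    have -> : w *: (b *: y') = b *: y - b *: (y - w *: y').
      by rewrite scalerBr !scalerA (mulrC w) opprB addrC subrK.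
    by apply: subB => //; [exact: idm_sub|apply: subZ => //; exact: idm_sub].
  move=> hv; have [c tc] := um t tm.
  by rewrite -[v]scale1r -tc mulrC -scalerA; apply: subZ (ht v hv); exact: idm_sub.
(* After the exchange, w is regular modulo b and xs. *)
have regw' (v : V) : idm (b :: xs) (w *: v) -> idm (b :: xs) v.
  case=> v' h.
  have [|v2 hv2] := regb v'.
    exists v.
    have -> : b *: v' - w *: v = - (w *: v - b *: v') by rewrite opprB.
    by apply: subN h; exact: idm_sub.
  exists v2; apply: regw.
  have -> : w *: (v - b *: v2) = (w *: v - b *: v') + b *: (v' - w *: v2).
    by rewrite !scalerBr !scalerA (mulrC w b) addrA subrK.
  by apply: subD => //; [exact: idm_sub|apply: subZ hv2; exact: idm_sub].
have [||h1 h2] := IH (b :: xs).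
- by move=> z; rewrite !inE => /orP[/eqP->//|h]; apply: wsm; rewrite !inE h !orbT.
- split=> //; apply: mreg_eq regws => z; rewrite !inE; exact: orbCA.
split=> // v h; have e : (b :: xs) ++ ws =i xs ++ b :: ws.
  by move=> z; rewrite !(inE, mem_cat) orbCA.
apply: (@idm_subset ((b :: xs) ++ ws)); first by move=> z; rewrite e.
by apply/h1/(@idm_subset (xs ++ b :: ws)) => // z; rewrite e.
Qed.
End Def.

Lemma idm_map (U V : lmodType R) (f : {linear U -> V}) ws x :
  idm ws x -> idm ws (f x).
Proof.
elim: ws x => [|w ws IH] x /=; first by move=> ->; rewrite linear0.
by case=> y /IH; rewrite linearB linearZ => h; exists (f y).
Qed.

Lemma smulm_ind (V : lmodType R) (I : ideal R) (N : submodClosed V) (P : set V) :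
  submod_set P -> (forall a x, a \in I -> x \in N -> P (a *: x)) ->
  forall v, v \in smulm I N -> P v.
Proof.
move=> hP h; apply: (span_sub hP) => v [a [x aI [xN ->]]]; exact: h.
Qed.
Lemma smulm_mem (V : lmodType R) (I : ideal R) (N : submodClosed V) a x :
  a \in I -> x \in N -> a *: x \in smulm I N.
Proof. by move=> aI xN; apply: span_gen; exists a, x. Qed.

Lemma smulm_idm (V : lmodType R) (I : ideal R) ws (v : V) :
  I =i span [set y : R^o | y \in ws] ->
  v \in smulm I (submodT V) <-> idm ws v.
Proof.
move=> hI; split.
  move: v; apply: smulm_ind; first exact: idm_sub.
  move=> a x; rewrite hI => /(@span_lc _ R^o) h _.
  have hP : submod_set [set b : R^o | idm ws (b *: x)].
    split=> [|b y z hy hz]; first by rewrite /= scale0r; exact: (idm_sub V ws).1.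
    have -> : (b *: y + z : R^o) = b * y + z by [].
    by rewrite /= scalerDl -scalerA; apply: (idm_sub V ws).2.
  by apply: (lc_ind hP _ h) => w ww; apply: idm_mem.
move: v; apply: idm_ind; first exact: submod_closed_set.
move=> w m ww /=; apply: smulm_mem; last by apply/submod_ofE.
by rewrite hI; apply: span_gen.
Qed.
End ListIdeal.

(** * Projective modules, homotopies and the standard resolution *)

Definition mklin (R : pzRingType) (U V : lmodType R) (f : U -> V)
  (hf : linear f) : {linear U -> V} :=
  HB.pack f (GRing.isLinear.Build R U V *:%R f hf).

Section LinearOps.
Variables (R : comPzRingType) (U V W : lmodType R).
Lemma lsub_subproof (f g : {linear U -> V}) : linear (fun x => f x - g x).
Proof. by move=> a x y; rewrite [f _]linearP [g _]linearP scalerBr opprD addrACA. Qed.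
Lemma ladd_subproof (f g : {linear U -> V}) : linear (fun x => f x + g x).
Proof. by move=> a x y; rewrite !linearP /= scalerDr addrACA. Qed.
Lemma lscale_subproof (a : R) (f : {linear U -> V}) : linear (fun x => a *: f x).
Proof. by move=> b x y; rewrite linearP /= scalerDr !scalerA mulrC. Qed.
Lemma lcomp_subproof (g : {linear V -> W}) (f : {linear U -> V}) :
  linear (fun x => g (f x)).
Proof. by move=> b x y; rewrite !linearP. Qed.
Definition lsub f g := mklin (lsub_subproof f g).
Definition ladd f g := mklin (ladd_subproof f g).
Definition lscale a f := mklin (lscale_subproof a f).
Definition lcomp g f := mklin (lcomp_subproof g f).
End LinearOps.

Lemma lin_Z (R : pzRingType) (U V : lmodType R) (f : {linear U -> V}) a x :
  f (a *: x) = a *: f x.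
Proof. exact: linearZ. Qed.

Lemma lid_subproof (R : comPzRingType) (U : lmodType R) : linear (fun x : U => x).
Proof. by []. Qed.
Definition lid (R : comPzRingType) (U : lmodType R) := mklin (@lid_subproof R U).

(** Used for all maps out of quotients and submodules, where it avoids a linear
    choice of representatives. *)
Lemma lin_of_rel (R : pzRingType) (U V : lmodType R) (rel : U -> V -> Prop) :
  (forall x, exists y, rel x y) -> (forall y, rel 0 y -> y = 0) ->
  (forall a x y x' y', rel x y -> rel x' y' -> rel (a *: x + x') (a *: y + y')) ->
  exists f : {linear U -> V}, forall x y, rel x y <-> f x = y.
Proof.
move=> tot zero lin; have [f hf] := choice tot.
have uni x y y' : rel x y -> rel x y' -> y = y'.
  move=> h h'; apply/eqP; rewrite -subr_eq0; apply/eqP/zero.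
  have := lin (-1) _ _ _ _ h' h; rewrite !scaleN1r addNr addrC.
  by rewrite addrC (addrC _ y).
have lf : linear f.
  by move=> a x y; apply: (uni (a *: x + y)) => //; apply: lin.
exists (mklin lf) => x y; split=> [h|<- //]; exact: uni (hf x) h.
Qed.

(** Dependent choice along the degrees of a complex, with an invariant that
    makes the next step possible. *)
Lemma dep_choice (T : nat -> Type) (t0 : T 0%N) (Inv : forall n, T n -> Prop)
  (rel : forall n, T n -> T n.+1 -> Prop) :
  Inv 0%N t0 -> (forall n t, Inv n t -> exists2 t', Inv n.+1 t' & rel n t t') ->
  exists f : forall n, T n, f 0%N = t0 /\ forall n, rel n (f n) (f n.+1).
Proof.
move=> i0 step.
have step' n (t : {t : T n | Inv n t}) :
    {t' : {t : T n.+1 | Inv n.+1 t} | rel n (sval t) (sval t')}.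
  apply: cid; case: t => t it; have [t' it' r] := step n t it.
  by exists (exist _ t' it').
pose f := nat_rect (fun n => {t : T n | Inv n t}) (exist _ t0 i0)
  (fun n t => sval (step' n t)).
exists (fun n => sval (f n)); split=> // n.
exact: (svalP (step' n (f n))).
Qed.

Section Free.
Variable R : comPzRingType.

(** Lifts are required only modulo a submodule N of the target, since the maps
    to be lifted below often agree only modulo (ws)M. *)
Definition projective (P : lmodType R) := forall (U V : lmodType R)
  (g : {linear U -> V}) (f : {linear P -> V}) (N : set V), submod_set N ->
  (forall x, exists u, N (f x - g u)) ->
  exists f' : {linear P -> U}, forall x, N (f x - g (f' x)).

Lemma proj_lift (P U V : lmodType R) (g : {linear U -> V}) (f : {linear P -> V}) :
  projective P -> (forall x, exists u, f x = g u) ->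
  exists f' : {linear P -> U}, forall x, f x = g (f' x).
Proof.
move=> hP h; have [|f' hf'] := hP _ _ g f [set 0] (@submod_set0 _ _).
  by move=> x; have [u ->] := h x; exists u; rewrite /= subrr.
by exists f' => x; apply/eqP; rewrite -subr_eq0; apply/eqP/hf'.
Qed.

Section OnType.
Variable X : choiceType.

Lemma free_supp (v : free R X) : finite_set [set x | val v x != 0].
Proof. exact: (proj1 (submod_ofE (free_subproof R X) _) (valP v)). Qed.

Lemma delta_subproof (x : X) :
  (fun y => (y == x)%:R : R^o) \in submod_of (free_subproof R X).
Proof.
apply/submod_ofE => /=; apply: (sub_finite_set _ (finite_set1 x)) => y /=.
by have [->//|_] := eqVneq y x; move=> /eqP.
Qed.
Definition free_delta (x : X) : free R X  :=
  exist (fun f : X -> R^o => f \in submod_of (free_subproof R X))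
    (fun y => (y == x)%:R : R^o) (delta_subproof x).

Section Lift.
Variables (V : lmodType R) (t : X -> V).

Definition free_lift (v : free R X) : V := \sum_(x \in [set: X]) val v x *: t x.

Lemma free_liftE (v : free R X) (s : {fset X}) :
  (forall x, x \notin s -> val v x = 0) ->
  free_lift v = \sum_(x <- s) val v x *: t x.
Proof. by move=> hs; apply: fsbigTE => x /hs ->; rewrite scale0r. Qed.

Lemma free_lift_linear : linear free_lift.
Proof.
move=> a f g.
have fin : finite_set ([set x | val f x != 0] `|` [set x | val g x != 0]).
  by rewrite finite_setU; split; exact: free_supp.
pose s := fset_set ([set x | val f x != 0] `|` [set x | val g x != 0]).
have hf x : x \notin s -> val f x = 0.
  rewrite in_fset_set // notin_setE /= => /not_orP[h _].
  by apply/eqP; apply: contra_notT h.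
have hg x : x \notin s -> val g x = 0.
  rewrite in_fset_set // notin_setE /= => /not_orP[_ h].
  by apply/eqP; apply: contra_notT h.
rewrite (free_liftE hf) (free_liftE hg) (@free_liftE _ s); last first.
  by move=> x hx; rewrite linearP /= /GRing.add /= /GRing.scale /= hf ?hg //
    scaler0 addr0.
rewrite scaler_sumr -big_split; apply: eq_bigr => x _.
by rewrite linearP /= scalerA -scalerDl.
Qed.

Lemma free_lift_delta x : free_lift (free_delta x) = t x.
Proof.
rewrite (@free_liftE _ [fset x]%fset).
  by rewrite big_seq_fset1 /= eqxx scale1r.
by move=> y; rewrite inE /= => /negbTE ->.
Qed.
End Lift.

Lemma free_decomp (v : free R X) (s : {fset X}) :
  (forall x, x \notin s -> val v x = 0) ->
  v = \sum_(x <- s) val v x *: free_delta x.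
Proof.
move=> hs; apply: val_inj; apply/funext => y.
have -> : val (\sum_(x <- s) val v x *: free_delta x) y =
    \sum_(x <- s) val v x * (y == x)%:R.
  elim/big_ind2 : _ => //= u1 u2 w1 w2 e1 e2.
  by rewrite /GRing.add /= e1 e2.
have [ys|ys] := boolP (y \in s); last first.
  rewrite hs // big1_seq // => x /= xs; case: eqP => [e|_]; last by rewrite mulr0.
  by move: ys; rewrite e xs.
rewrite (big_fsetD1 y) //= eqxx mulr1 big1_seq ?addr0 // => x /=.
by rewrite !inE => /andP[/negbTE xy _]; rewrite eq_sym xy mulr0.
Qed.

Lemma free_projective : projective (free R X).
Proof.
move=> U V g f N hN h.
have /choice[t ht] : forall x, exists u, N (f (free_delta x) - g u).
  by move=> x; apply: h.
exists (mklin (free_lift_linear t)) => v /=.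
pose s := fset_set [set x | val v x != 0].
have hs x : x \notin s -> val v x = 0.
  rewrite in_fset_set; last exact: free_supp.
  by rewrite notin_setE /= => n; apply/eqP; apply: contra_notT n.
rewrite (free_liftE t hs) {1}(free_decomp hs) (linear_sum f) (linear_sum g) -sumrB.
elim/big_ind: _ => [|x y|x _]; [exact: hN.1|exact: subD|].
by rewrite [f _]linearZ [g _]linearZ /= -scalerBr; apply: subZ.
Qed.
End OnType.
End Free.

Section Homotopy.
Variables (R : comPzRingType) (F : nat -> lmodType R).
Variable d : forall n, {linear F n.+1 -> F n}.
Hypothesis projF : forall n, projective (F n).
Hypothesis dd : forall n x, d n (d n.+1 x) = 0.
Variables (G : nat -> lmodType R) (dG : forall n, {linear G n.+1 -> G n}).
Variable a : R.

(** The comparison theorem for maps that induce zero on homology. The scalar a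
    is 1 for chain maps and -1 for maps of odd degree; a power of it absorbs
    the denominators when the maps are chain maps up to a factor. *)
Lemma homotopy (del : forall n, {linear F n -> G n}) :
  (forall n x, dG n x = 0 -> exists y, x = dG n.+1 y) ->
  (forall x, exists y, del 0%N x = dG 0 y) ->
  (forall n x, dG n (del n.+1 x) = a *: del n (d n x)) ->
  exists k : forall n, {linear F n -> G n.+1},
    (forall x, del 0%N x = dG 0 (k 0%N x)) /\
    (forall n x, del n.+1 x = dG n.+1 (k n.+1 x) + a *: k n (d n x)).
Proof.
move=> exG h0 hd.
have [k0 hk0] := proj_lift (@projF 0%N) h0.
have [|n k hk|k [e hk]] := @dep_choice (fun n => {linear F n -> G n.+1}) k0
  (fun n k => forall x, del n (d n x) = dG n (k (d n x)))
  (fun n k k' => forall x, del n.+1 x = dG n.+1 (k' x) + a *: k (d n x)).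
- by move=> x.
- have [|k' hk'] := proj_lift (g := dG n.+1)
    (f := lsub (del n.+1) (lscale a (lcomp k (d n)))) (@projF n.+1).
    move=> x; apply: exG => /=.
    by rewrite linearB hd linearZ hk subrr.
  have e x : del n.+1 x = dG n.+1 (k' x) + a *: k (d n x).
    by rewrite -hk' /= subrK.
  by exists k' => // x; rewrite e dd linear0 scaler0 addr0.
by exists k; split=> // x; rewrite e.
Qed.

(** The comparison theorem when the target is exact only up to the factor a,
    which then reappears in the commutation with the differentials. With a = -1
    it lifts a map of odd degree. *)
Lemma lift_complex (f0 : {linear F 0 -> G 0}) :
  (forall n x, dG n x = 0 -> exists y, a *: x = dG n.+1 y) ->
  (forall x, exists y, a *: f0 (d 0 x) = dG 0 y) ->
  exists f : forall n, {linear F n -> G n},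
    f 0%N = f0 /\ forall n x, dG n (f n.+1 x) = a *: f n (d n x).
Proof.
move=> exG h0.
have [//|n f hf|f [e hf]] := @dep_choice (fun n => {linear F n -> G n}) f0
  (fun n f => forall x, exists y, a *: f (d n x) = dG n y)
  (fun n f f' => forall x, dG n (f' x) = a *: f (d n x)).
  have [|f' hf'] := proj_lift (g := dG n) (f := lscale a (lcomp f (d n))) (@projF n.+1).
    by move=> x; apply: hf.
  exists f' => x; last by rewrite -hf'.
  by apply: exG; rewrite -hf' /= dd linear0 scaler0.
by exists f; split.
Qed.
End Homotopy.

Section StandardResolution.
Variables (R : comPzRingType) (N : lmodType R).

Lemma free_aug_delta (V : lmodType R) (x : V) : free_aug (free_delta R x) = x.
Proof. exact: (free_lift_delta (@id V) x). Qed.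

Lemma res_proj n : projective (res N n).
Proof. exact: free_projective. Qed.

Lemma res_dd n (x : res N n.+2) : res_d (res_d x) = 0.
Proof.
have : val (free_aug x : subm (kerm (@free_aug R (syz N n.+1))))
  \in kerm (@free_aug R (syz N n.+1)) by exact: valP.
by move=> /submod_ofE h; rewrite {1}/res_d h linear0.
Qed.

Lemma res_exact n (x : res N n.+1) : res_d x = 0 -> exists y, x = res_d (y : res N n.+2).
Proof.
rewrite /res_d => h.
have hx : x \in kerm (@free_aug R (syz N n.+1)).
  by apply/submod_ofE; apply: val_inj; rewrite h linear0.
by exists (free_delta R (exist _ x hx)); rewrite /res_d free_aug_delta.
Qed.

Lemma res_aug_surj (v : N) : exists x : res N 0, free_aug x = v.
Proof. by exists (free_delta R v); rewrite free_aug_delta. Qed.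

Lemma res_augd (x : res N 1) : free_aug (res_d x : res N 0) = 0.
Proof.
have /submod_ofE // : res_d x \in kerm (@free_aug R N).
exact: valP.
Qed.

Lemma res_aug_exact (x : res N 0) : free_aug x = 0 ->
  exists y : res N 1, x = res_d y.
Proof.
move=> h; have hx : x \in kerm (@free_aug R N) by apply/submod_ofE.
by exists (free_delta R (exist _ x hx : syz N 1)); rewrite /res_d free_aug_delta.
Qed.
End StandardResolution.

(** * Length, and modules over a discrete valuation ring *)

Lemma principal_set (R : comPzRingType) (g : R) :
  submod_set [set a : R^o | exists c, a = c * g].
Proof.
split=> [|k _ _ [c ->] [c' ->]]; first by exists 0; rewrite mul0r.
by exists (k * c + c'); rewrite mulrDl -mulrA.
Qed.
Lemma span1E (R : comPzRingType) (g a : R) :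
  (a : R^o) \in span [set g : R^o] <-> exists c, a = c * g.
Proof.
split=> [h|[c ->]]; last by apply: (idealMl c); apply: span_gen.
by apply: (span_sub (principal_set g) _ h) => _ ->; exists 1; rewrite mul1r.
Qed.

Section Chains.
Variables (R : comPzRingType) (V : lmodType R).
Implicit Types (B P Q : set V).

(** n + 1 submodules containing B, strictly increasing up to P. *)
Fixpoint ch B n P : Prop :=
  match n with
  | 0%N => submod_set P /\ B `<=` P
  | m.+1 => submod_set P /\ exists P', [/\ ch B m P', P' `<=` P & exists2 x, P x & ~ P' x]
  end.

Lemma ch_sub B n P : ch B n P -> submod_set P. Proof. by case: n => [|n] []. Qed.
Lemma ch_base B n P : ch B n P -> B `<=` P.
Proof.
elim: n P => [|n IH] P; first by case.
by case=> _ [P' [/IH BP' P'P _]]; exact: subset_trans BP' P'P.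
Qed.
Lemma ch_top B n P Q : submod_set Q -> P `<=` Q -> ch B n P -> ch B n Q.
Proof.
move=> hQ PQ; case: n => [[_ BP]|n [hP [P' [c P'P [x Px nx]]]]].
  by split=> //; exact: subset_trans PQ.
split=> //; exists P'; split=> //; first exact: subset_trans PQ.
by exists x => //; apply: PQ.
Qed.

Lemma ch_chain n : submod_chain V n <-> exists P, ch [set 0] n P.
Proof.
split=> [[S hS]|[P c]].
  exists [set x | x \in S n].
  have h : forall i, (i <= n)%N -> ch [set 0] i [set x | x \in S i].
    elim=> [|i IH] lt.
      split; first exact: submod_closed_set.
      by move=> x ->; exact: rpred0.
    split; first exact: submod_closed_set.
    exists [set x | x \in S i]; have [s1 s2] := hS i lt.
    split; [exact: IH (ltnW lt)|by move=> x /s1|].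
    have [x /not_implyP[xS nx]] : exists x, ~ (x \in S i.+1 -> x \in S i).
      by apply/existsNP => h; apply: s2.
    by exists x.
  exact: h.
suff [S [hS _ st]] : exists S : nat -> set V, [/\ forall i, submod_set (S i), S n = P &
    forall i, (i < n)%N -> S i `<=` S i.+1 /\ exists2 x, S i.+1 x & ~ S i x].
  exists (fun i => submod_of (hS i)) => i lt; have [s1 [x x1 x2]] := st i lt.
  split=> [y /submod_ofE h|h]; first by apply/submod_ofE/s1.
  by apply: x2; apply/(submod_ofE (hS i)); apply: h; apply/submod_ofE.
elim: n P c => [|n IH] P.
  by case=> hP _; exists (fun=> P); split.
case=> hP [P' [/IH[S [hS eS st]] P'P hx]].
exists (fun i => if (i <= n)%N then S i else P); split=> [i||i].
- by case: ifP.
- by rewrite ltnn.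
rewrite ltnS => le; rewrite le; case: ltnP => lt; first exact: st.
have -> : i = n by apply/eqP; rewrite eqn_leq le.
by rewrite eS.
Qed.

Lemma dec_stable B (I : nat -> set V) N : (forall k, submod_set (I k)) ->
  (forall k, B `<=` I k) -> (forall k, I k.+1 `<=` I k) ->
  (forall k P, ch B k P -> (k <= N)%N) -> exists k, I k `<=` I k.+1.
Proof.
move=> hI BI I_dec hN; apply: contrapT => /forallNP no.
have st k : exists2 a, I k a & ~ I k.+1 a.
  by have /existsNP[a /not_implyP[h1 h2]] := no k; exists a.
have c m : forall k, ch B m (I k).
  elim: m => [|m IH] k; first by split.
  by split=> //; exists (I k.+1).
by have := hN _ _ (c N.+1 0%N); rewrite ltnn.
Qed.
End Chains.

Definition has_length (R : comPzRingType) (V : lmodType R) n :=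
  (exists P : set V, ch [set 0] n P) /\
  forall k (P : set V), ch [set 0] k P -> (k <= n)%N.

Definition fin_length (R : comPzRingType) (V : lmodType R) :=
  exists n, forall k (P : set V), ch [set 0] k P -> (k <= n)%N.

Section Length.
Variable R : comPzRingType.

Lemma mod_lengthE (V : lmodType R) n : has_length V n -> mod_length V = n.
Proof.
move=> [[P c] hn]; rewrite /mod_length.
have hn' : [set n | submod_chain V n /\ forall m, submod_chain V m -> (m <= n)%N] n.
  by split=> [|m /ch_chain[Q /hn]//]; apply/ch_chain; exists P.
case: xgetP => [m _ [/ch_chain[Q /hn le] hm]|/(_ n)//].
by apply/eqP; rewrite eqn_leq le; apply/hm/ch_chain; exists P.
Qed.

Lemma fin_has_length (V : lmodType R) : fin_length V -> exists n, has_length V n.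
Proof.
case=> b hb; pose P n := `[< exists Q : set V, ch [set 0] n Q >].
have [||n /asboolP hn hmax] := @ex_maxnP P b.
- exists 0%N; apply/asboolP; exists setT; split=> //; exact: submod_setT.
- by move=> i /asboolP[Q /hb].
by exists n; split=> // k Q c; apply: hmax; apply/asboolP; exists Q.
Qed.

Section Maps.
Variables (X V : lmodType R) (f : {linear X -> V}).

Lemma image_sub (P : set X) : submod_set P -> submod_set (f @` P).
Proof.
move=> hP; split=> [|a _ _ [x Px <-] [y Py <-]].
  by exists 0; [exact: hP.1|rewrite linear0].
by exists (a *: x + y); [exact: hP.2|rewrite linearP].
Qed.
Lemma preim_sub (P : set V) : submod_set P -> submod_set (f @^-1` P).
Proof.
move=> hP; split=> [|a x y Px Py]; first by rewrite /= linear0; exact: hP.1.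
by rewrite /= linearP; exact: hP.2.
Qed.

Lemma ch_image n (P : set X) : (forall x, f x = 0 -> x = 0) ->
  ch [set 0] n P -> ch [set 0] n (f @` P).
Proof.
move=> inj; elim: n P => [|n IH] P.
  case=> hP _; split; first exact: image_sub.
  by move=> _ ->; exists 0; [exact: hP.1|rewrite linear0].
case=> hP [P' [c P'P [x Px nx]]]; split; first exact: image_sub.
exists (f @` P'); split; [exact: IH|exact: image_subset|].
exists (f x); first by exists x.
case=> y P'y e; apply: nx; have -> // : x = y.
by apply/eqP; rewrite -subr_eq0; apply/eqP/inj; rewrite linearB e subrr.
Qed.
End Maps.

Lemma fin_length_inj (X V : lmodType R) (f : {linear X -> V}) :
  (forall x, f x = 0 -> x = 0) -> fin_length V -> fin_length X.
Proof. by move=> inj [n hn]; exists n => k P /(ch_image inj)/hn. Qed.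
(** A chain in X is continued by the preimage of a chain in Y. Conversely, at
    each strict step of a chain in V the trace on X or the image in Y grows
    strictly. *)
Lemma length_add (X V Y : lmodType R) (i : {linear X -> V}) (q : {linear V -> Y})
    a b : (forall x, i x = 0 -> x = 0) -> (forall y, exists v, q v = y) ->
  (forall v, q v = 0 <-> exists x, v = i x) ->
  has_length X a -> has_length Y b -> has_length V (a + b).
Proof.
move=> inj surj ex [[P cP] ha] [[Q cQ] hb]; split.
  exists (q @^-1` Q); move: cQ {hb}; elim: b Q => [|b IH] Q.
    case=> hQ _; rewrite addn0.
    apply: (@ch_top _ _ _ _ (i @` P)); first exact: preim_sub.
      by move=> _ [x _ <-] /=; have -> : q (i x) = 0 by [apply/ex; exists x]; exact: hQ.1.
    exact: ch_image.
  case=> hQ [Q' [c Q'Q [y Qy ny]]]; rewrite addnS; split; first exact: preim_sub.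
  exists (q @^-1` Q'); split; [exact: IH|by move=> v /Q'Q|].
  by have [v e] := surj y; exists v; rewrite /= e.
have key n : forall W, ch [set 0] n W -> exists n1 n2, [/\ (n <= n1 + n2)%N,
    ch [set 0] n1 (i @^-1` W) & ch [set 0] n2 (q @` W)].
  elim: n => [|n IH] W.
    case=> hW _; exists 0%N, 0%N; split=> //; split.
    - exact: preim_sub.
    - by move=> _ -> /=; rewrite linear0; exact: hW.1.
    - exact: image_sub.
    - by move=> _ ->; exists 0; [exact: hW.1|rewrite linear0].
  case=> hW [W' [c W'W [x Wx nx]]]; have [n1 [n2 [le c1 c2]]] := IH _ c.
  have hW' := ch_sub c.
  have [[z Wz nz]|no] := pselect (exists2 z, W (i z) & ~ W' (i z)).
    exists n1.+1, n2; split; first by rewrite addSn ltnS.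
      split; first exact: preim_sub.
      by exists (i @^-1` W'); split=> //; [move=> ? /W'W|exists z].
    by apply: ch_top c2; [exact: image_sub|exact: image_subset].
  exists n1, n2.+1; split; first by rewrite addnS ltnS.
    by apply: ch_top c1; [exact: preim_sub|move=> ? /W'W].
  split; first exact: image_sub.
  exists (q @` W'); split=> //; first exact: image_subset.
  exists (q x); first by exists x.
  case=> y W'y e; apply: nx.
  have [z ez] : exists z, x - y = i z by apply/ex; rewrite linearB e subrr.
  rewrite -(subrK y x); apply: subD => //; rewrite ez; apply: contrapT => nz.
  apply: no; exists z => //; rewrite -ez; apply: subB => //; exact: W'W.
move=> k W /key[n1 [n2 [le /ha l1 /hb l2]]].
exact: leq_trans le (leq_add l1 l2).
Qed.

Lemma length0 (V : lmodType R) : (forall v : V, v = 0) -> has_length V 0.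
Proof.
move=> v0; split.
  by exists setT; split; first exact: submod_setT.
by case=> // k P [hP [P' [c _ [x _]]]]; case; rewrite (v0 x); exact: (ch_sub c).1.
Qed.

Lemma length_power (X : lmodType R) l : has_length X l ->
  forall r (V : lmodType R) (pr : 'I_r -> {linear V -> X}),
  (forall x : 'I_r -> X, exists v, forall i, pr i v = x i) ->
  (forall v, (forall i, pr i v = 0) -> v = 0) -> has_length V (r * l).
Proof.
move=> hX; elim=> [|r IH] V pr surj inj.
  by apply: length0 => v; apply: inj => -[].
rewrite mulSnr.
apply: (@length_add (subm (kerm (pr ord0))) V X
   (\val : {linear subm (kerm (pr ord0)) -> V}) (pr ord0)) => //.
- by move=> x e; apply: val_inj.
- by move=> y; have [v hv] := surj (fun=> y); exists v.
- move=> v; split=> [e|[x ->]]; last by have /submod_ofE := valP x.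
  have vk : v \in kerm (pr ord0) by apply/submod_ofE.
  by exists (exist _ v vk).
apply: (IH _ (fun i => lcomp (pr (lift ord0 i))
   (\val : {linear subm (kerm (pr ord0)) -> V}))).
  move=> x; have [v hv] := surj (fun i => if unlift ord0 i is Some j then x j else 0).
  have vk : v \in kerm (pr ord0) by apply/submod_ofE; rewrite /= hv unlift_none.
  by exists (exist _ v vk) => i /=; rewrite hv liftK.
move=> v hv; apply: val_inj; apply: inj => i.
case: (unliftP ord0 i) => [j ->|->]; first exact: hv.
by have /submod_ofE := valP v.
Qed.

(** A finitely generated module supported at the maximal ideal only has finite
    length. By noetherian induction, let the chains inside P be bounded. If P
    is not everything, some w outside P is killed modulo P by a prime, which is
    m by hypothesis; adding w to P makes chains longer by at most one. *)
Lemma chain_bound (m : ideal R) (V : lmodType R) (B : set V) :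
  noeth_mod R^o -> noeth_mod V -> maximal_ideal m ->
  (forall a : R, a \notin m -> exists b, a * b = 1) -> submod_set B ->
  (forall Q : ideal R, prime_ideal Q -> (forall a : R, (forall v : V, B (a *: v)) -> a \in Q) ->
     {subset m <= Q}) ->
  exists n, forall k P, ch B k P -> (k <= n)%N.
Proof.
move=> noeR noeV hm um hB hQ.
have [||P [[hP [n hn]] BP hmax]] := @noeth_max _ _ noeV [set P | submod_set P /\
    exists n, forall k P', P' `<=` P -> ch B k P' -> (k <= n)%N] B.
- by move=> P [].
- split=> //; exists 0%N => -[|k] P' P'B // [hP' [P2 [c _ [x P'x nx]]]].
  by case: nx; apply: (ch_base c); apply: P'B.
suff PT v : P v by exists n => k P'; apply: hn.
apply: contrapT => /(assoc_prime noeR hP)[b [Q [nw hQp hw]]].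
set w := b *: v in nw hw.
have mQ : {subset m <= Q}.
  apply: hQ => // a ha; apply/hw; apply: BP; exact: ha.
have Qm : {subset Q <= m} by apply: hm.2 => //; exact: hQp.1.
pose P2 : set V := [set x | exists c, P (x - c *: w)].
have hP2 : submod_set P2.
  split=> [|e x y [c hx] [c' hy]].
    by exists 0; rewrite scale0r subr0; exact: hP.1.
  exists (e * c + c').
  have -> : e *: x + y - (e * c + c') *: w = e *: (x - c *: w) + (y - c' *: w).
    by rewrite scalerDl scalerBr scalerA opprD addrACA.
  exact: hP.2.
have PP2 : P `<=` P2 by move=> x Px; exists 0; rewrite scale0r subr0.
suff F2 : [set P | submod_set P /\
    exists n, forall k P', P' `<=` P -> ch B k P' -> (k <= n)%N] P2.
  apply: nw; apply: (hmax _ F2 PP2); exists 1.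
  by rewrite scale1r subrr; exact: hP.1.
split=> //; exists n.+1.
have key k : forall P', P' `<=` P2 -> ch B k P' -> exists j,
    [/\ ch B j (P' `&` P), (k <= j.+1)%N & P' `<=` P -> (k <= j)%N].
  elim: k => [|k IH] P' P'P2.
    case=> hP' BP'; exists 0%N; split=> //; split; first exact: submod_setI.
    by move=> x Bx; split; [apply: BP'|apply: BP].
  case=> hP' [P1 [c P1P' [x P'x nx]]].
  have [j [cj lj lj']] := IH _ (subset_trans P1P' P'P2) c.
  have hP1 := ch_sub c.
  have [[z [P'z Pz] nz]|no] := pselect (exists2 z, (P' `&` P) z & ~ P1 z).
    exists j.+1; split=> //.
      split; first exact: submod_setI.
      exists (P1 `&` P); split=> //; first by move=> y [/P1P'].
      by exists z => // -[].
    by move=> P'P; rewrite ltnS; apply: lj'; exact: subset_trans P'P.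
  have P'PP1 y : P' y -> P y -> P1 y.
    by move=> h1 h2; apply: contrapT => h3; apply: no; exists y.
  exists j; split.
  - by apply: ch_top cj; [exact: submod_setI|move=> y [/P1P']].
  - rewrite ltnS; apply: lj' => y P1y; apply: contrapT => nPy; apply: nx.
    have [cy hy] : P2 y by apply/P'P2/P1P'.
    have [cx hx] : P2 x by apply: P'P2.
    have [|e ce] := um cy.
      apply/negP => /mQ/hw h; apply: nPy; rewrite -(subrK (cy *: w) y).
      exact: subD.
    rewrite -(subrK ((cx * e) *: y) x); apply: subD => //; last exact: subZ.
    apply: P'PP1; first by apply: subB => //; apply: subZ => //; apply: P1P'.
    have -> : x - (cx * e) *: y = (x - cx *: w) - (cx * e) *: (y - cy *: w).
      rewrite scalerBr scalerA -mulrA [e * cy]mulrC ce mulr1 opprB.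
      by rewrite addrA subrK.
    by apply: subB => //; apply: subZ.
  - by move=> P'P; case: nx; apply: P'PP1 => //; apply: P'P.
move=> k P' P'P2 c; have [j [cj lj _]] := key k P' P'P2 c.
by apply: leq_trans lj _; rewrite ltnS; apply: hn cj; exact: subIsetr.
Qed.
End Length.

Section Bases.
Variables (O : idomainType) (hO : is_dvr O).

Lemma dvr_noeth : noeth_mod O^o.
Proof.
apply: noetherianP => I; have [w hw] := hO.1 I; exists [:: (w : O^o)].
move=> x; rewrite hw; congr (_ \in span _).
by apply/seteqP; split=> y /=; rewrite inE => /eqP.
Qed.

(** The last clause makes m the only nonzero prime: if q is a nonzero element
    of Q with (q) as large as possible, write q = c w; then c is not in Q, so w
    is. *)
Lemma dvr_uniformizer : exists (m : ideal O) (w : O), [/\ maximal_ideal m,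
  (forall a : O, a \notin m -> exists b, a * b = 1), w != 0,
  (forall a : O, a \in m <-> exists c, a = c * w) &
  forall Q : ideal O, prime_ideal Q -> forall t : O, t != 0 -> t \in Q -> {subset m <= Q}].
Proof.
have [m hm [x x0 xm]] := hO.2; have [w hw] := hO.1 m.
have mw (a : O) : a \in m <-> exists c, a = c * w.
  by rewrite hw; exact: span1E.
exists m, w; split=> //.
- exact: hm.1.
- by move=> a; apply: local_unit hm; exact: dvr_noeth.
- by apply: contra_neq x0 => w0; have /mw[c ->] := xm; rewrite w0 mulr0.
move=> Q hQ t t0 tQ.
suff wQ : w \in Q by move=> a /mw[c ->]; apply: idealMl.
pose pr (q : O) : set O^o := [set a : O^o | exists c, a = c * q].
have [||P [[q [q0 qQ ->]] _ hmax]] := @noeth_max _ _ dvr_noeth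
  [set P : set O^o | exists q, [/\ q != 0, q \in Q & P = pr q]] (pr t).
- by move=> P [q [_ _ ->]]; exact: principal_set.
- by exists t.
have qm : q \in m.
  apply/negPn/negP => qm; have [b qb] : exists b, q * b = 1.
    by apply: local_unit hm qm; exact: dvr_noeth.
  by move/negP: hQ.1; apply; rewrite -qb; apply: idealMr.
have /mw[c eq] := qm; have : c * w \in Q by rewrite -eq.
case/hQ.2 => // cQ; have c0 : c != 0 by apply: contra_neq q0 => c0; rewrite eq c0 mul0r.
have [e ec] : pr q c.
  have s : pr c `<=` pr q.
    apply: hmax; first by exists c.
    by move=> _ [e ->]; exists (e * w); rewrite eq -mulrA [w * c]mulrC.
  by apply: s; exists 1; rewrite mul1r.
have : 1 \in m.
  apply/mw; exists e; apply: (mulfI c0).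
  by rewrite mulr1 {1}ec eq; ring.
by rewrite (negbTE hm.1.1).
Qed.

(** Let g generate (a, b), with a = a' g and b = b' g. Then a' or b' is a unit,
    because together they generate the unit ideal. *)
Lemma dvr_total (a b : O) : (exists c, b = c * a) \/ (exists c, a = c * b).
Proof.
have [m [w [hm um _ mw _]]] := dvr_uniformizer.
have hI : submod_set [set z : O^o | exists x y, z = x * a + y * b].
  split=> [|c _ _ [x [y ->]] [x' [y' ->]]].
    by exists 0, 0; rewrite !mul0r addr0.
  by exists (c * x + x'), (c * y + y'); rewrite /GRing.scale /=; ring.
have [g hg] := hO.1 (submod_of hI).
have pg (z : O) : (exists x y, z = x * a + y * b) <-> exists c, z = c * g.
  split=> [h|[c e]].
    have : (z : O^o) \in submod_of hI by apply/submod_ofE.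
    by rewrite hg => /span1E.
  apply/(submod_ofE hI); rewrite hg e; apply: (idealMl c); exact: span_gen.
have /pg[a' ea] : exists x y, a = x * a + y * b by exists 1, 0; ring.
have /pg[b' eb] : exists x y, b = x * a + y * b by exists 0, 1; ring.
have [x [y eg]] : exists x y, g = x * a + y * b by apply/pg; exists 1; rewrite mul1r.
have [g0|g0] := eqVneq g 0; first by left; exists 0; rewrite eb g0 mulr0 mul0r.
have e1 : x * a' + y * b' = 1.
  by apply: (mulIf g0); rewrite mul1r mulrDl -!mulrA -ea -eb -eg.
have [am|am] := boolP (a' \in m); last first.
  by left; have [e ae] := um a' am; exists (b' * e); rewrite eb {1}ea -[LHS]mulr1 -ae; ring.
have [bm|bm] := boolP (b' \in m); last first.
  by right; have [e be] := um b' bm; exists (a' * e); rewrite ea {1}eb -[LHS]mulr1 -be; ring.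
have : 1 \in m by rewrite -e1; apply: idealD; apply: idealMl.
by rewrite (negbTE hm.1).
Qed.

Lemma dvr_torsion_length (V : lmodType O) (t : O) : fg_module V -> t != 0 ->
  (forall v : V, t *: v = 0) -> fin_length V.
Proof.
move=> fgV t0 tV; have [m [w [hm um _ _ hQ]]] := dvr_uniformizer.
apply: (chain_bound dvr_noeth (noeth_fg dvr_noeth fgV) hm um (@submod_set0 _ V)).
move=> Q hQp hann; apply: (hQ Q hQp t t0); apply: hann => v; exact: tV.
Qed.

Lemma dvr_min_div n (a : 'I_n -> O) : (exists i, a i != 0) ->
  exists j, a j != 0 /\ forall i, exists c, a i = c * a j.
Proof.
elim: n a => [|n IH] a [i0 ai0]; first by case: (i0).
have [[k ak]|no] := pselect (exists i : 'I_n, a (lift ord0 i) != 0); last first.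
  have z i : a (lift ord0 i) = 0.
    by apply/eqP; apply: contrapT => /negP h; apply: no; exists i.
  exists ord0; split.
    by case: (unliftP ord0 i0) ai0 => [j ->|-> //]; rewrite z eqxx.
  move=> i; case: (unliftP ord0 i) => [j ->|->]; last by exists 1; rewrite mul1r.
  by exists 0; rewrite z mul0r.
have [|j [aj hj]] := IH (fun i => a (lift ord0 i)); first by exists k.
have [[c e]|[c e]] := dvr_total (a (lift ord0 j)) (a ord0).
  exists (lift ord0 j); split=> // i; case: (unliftP ord0 i) => [l ->|->]; last by exists c.
  exact: hj.
exists ord0; split; first by apply: contra_neq aj => a0; rewrite e a0 mulr0.
move=> i; case: (unliftP ord0 i) => [l ->|->]; last by exists 1; rewrite mul1r.
by have [c' ->] := hj l; exists (c' * c); rewrite e mulrA.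
Qed.

Section Basis.
Variable T : lmodType O.
Hypothesis tfT : forall (r : O) (x : T), r *: x = 0 -> r = 0 \/ x = 0.

Definition generates n (e : 'I_n -> T) := forall v, exists a : 'I_n -> O, v = \sum_i a i *: e i.

Lemma fg_generates : fg_module T -> exists n (e : 'I_n -> T), generates e.
Proof.
case=> s hs; exists (size s), (fun i => nth 0 s i) => v.
have /span_lc := hs v; elim: s {hs} v => [|x s IH] v /=.
  by move=> ->; exists (fun=> 0); rewrite big_ord0.
case=> a _ /IH[b e]; exists (fun i => if unlift ord0 i is Some j then b j else a).
rewrite big_ord_recl unlift_none /= -[LHS](subrK (a *: x)) e addrC; congr (_ + _).
by apply: eq_bigr => i _; rewrite liftK.
Qed.

(** Dividing a nontrivial relation by the coefficient that divides all the
    others gives a relation with a coefficient 1, and a generator could be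
    omitted. *)
Lemma minimal_basis n (e : 'I_n -> T) : generates e ->
  (forall k (e' : 'I_k -> T), generates e' -> (n <= k)%N) -> is_basis e.
Proof.
move=> ge hmin v; have [a ea] := ge v; exists a; split=> // b eb.
apply/funext => i0; apply/eqP; rewrite -subr_eq0; apply/negPn/negP => ne.
have [|j [cj hj]] := @dvr_min_div n (fun i => a i - b i); first by exists i0.
have rel : \sum_i (a i - b i) *: e i = 0.
  under eq_bigr => i _ do rewrite scalerBl.
  by rewrite sumrB -ea -eb subrr.
have [c hc] := choice hj.
have rel' : \sum_i c i *: e i = 0.
  have : (a j - b j) *: (\sum_i c i *: e i) = 0.
    rewrite scaler_sumr -[RHS]rel; apply: eq_bigr => i _.
    by rewrite scalerA [RHS]/= {1}(hc i) mulrC.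
  by case/tfT => // z; move: cj; rewrite z eqxx.
have c1 : c j = 1 by apply: (mulIf cj); rewrite -hc mul1r.
case: n e ge hmin a b i0 j c {ea eb ne rel hj cj} rel' c1 hc => [|n] e ge hmin a b i0 j c; first by case: j.
move=> rel' c1 _.
suff /hmin : generates (fun i => e (lift j i)) by rewrite ltnn.
move=> x; have [y ex] := ge x.
exists (fun i => y (lift j i) - y j * c (lift j i)).
move: rel'; rewrite (bigD1_ord j) //= c1 scale1r => /eqP.
rewrite addr_eq0 => /eqP ej.
rewrite ex (bigD1_ord j) //= ej scalerN scaler_sumr addrC -sumrB.
by apply: eq_bigr => i _; rewrite scalerBl scalerA.
Qed.

Lemma min_generates : fg_module T -> exists n (e : 'I_n -> T), generates e /\
  forall k (e' : 'I_k -> T), generates e' -> (n <= k)%N.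
Proof.
move=> /fg_generates[n0 [e0 ge0]].
pose P n := `[< exists e : 'I_n -> T, generates e >].
have [|n /asboolP[e ge] hn] := @ex_minnP P; first by exists n0; apply/asboolP; exists e0.
by exists n, e; split=> // k e' ge'; apply: hn; apply/asboolP; exists e'.
Qed.

Lemma tf_basis : fg_module T -> exists n (e : 'I_n -> T), is_basis e.
Proof.
by move=> /min_generates[n [e [ge hn]]]; exists n, e; exact: minimal_basis.
Qed.

(** t is the coordinate of f that divides all the others, in a minimal family
    of generators; f divided by t replaces the corresponding generator. *)
Lemma tf_basis_adapted f : fg_module T -> f <> 0 ->
  exists n (e : 'I_n.+1 -> T) t, is_basis e /\ f = t *: e ord0.
Proof.
move=> /min_generates[n [e [ge hn]]] f0; have [a ea] := ge f.
have [|j [aj hj]] := @dvr_min_div n a.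
  apply: contrapT => no; apply: f0; rewrite ea big1 // => i _.
  suff -> : a i = 0 by rewrite scale0r.
  by apply/eqP; apply: contrapT => /negP h; apply: no; exists i.
have [c hc] := choice hj.
case: n e ge hn a ea j aj hj c hc => [|n] e ge hn a ea j aj hj c hc; first by case: j {hj aj hc}.
pose x := \sum_i c i *: e i.
have c1 : c j = 1 by apply: (mulIf aj); rewrite -hc mul1r.
exists n, (fun i => if unlift ord0 i is Some k then e (lift j k) else x), (a j).
split; last first.
  rewrite unlift_none ea scaler_sumr; apply: eq_bigr => i _.
  by rewrite scalerA mulrC -hc.
apply: minimal_basis => // v; have [y ey] := ge v.
exists (fun i => if unlift ord0 i is Some k then y (lift j k) - y j * c (lift j k) else y j).
rewrite big_ord_recl unlift_none.
under eq_bigr => i _ do rewrite liftK scalerBl -scalerA.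
rewrite sumrB -scaler_sumr /x (bigD1_ord j) //= c1 scale1r scalerDr.
by rewrite addrACA subrr addr0 ey (bigD1_ord j).
Qed.
End Basis.

Lemma basis_coord (T : lmodType O) n (e : 'I_n -> T) : is_basis e ->
  exists co : 'I_n -> {linear T -> O^o}, (forall v, v = \sum_i co i v *: e i) /\
    forall i j, co i (e j) = (i == j)%:R.
Proof.
move=> he; have /choice[c hc] : forall v, exists a : 'I_n -> O, v = \sum_i a i *: e i.
  by move=> v; have [a [ea _]] := he v; exists a.
have uni v a : v = \sum_i a i *: e i -> c v = a.
  by move=> ea; have [b [_ ub]] := he v; rewrite -(ub _ (hc v)) -(ub _ ea).
have lc_ i : linear (fun v => c v i : O^o).
  move=> a x y; rewrite (uni (a *: x + y) (fun i => a * c x i + c y i)) //.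
  rewrite {1}(hc x) {1}(hc y) scaler_sumr -big_split /=; apply: eq_bigr => k _.
  by rewrite scalerDl scalerA.
exists (fun i => mklin (lc_ i)); split=> // i j /=.
rewrite (uni (e j) (fun i => (i == j)%:R)) // (bigD1 j) //= eqxx scale1r.
by rewrite big1 ?addr0 // => k /negbTE ->; rewrite scale0r.
Qed.

(** In coordinates, T/tT is a power of O/t. *)
Lemma free_quot_length (T Y : lmodType O) n (e : 'I_n -> T) (q : {linear T -> Y})
    (X : lmodType O) (pi : {linear O^o -> X}) (t : O) l : is_basis e ->
  (forall y, exists v, q v = y) -> (forall v, q v = 0 <-> exists v', v = t *: v') ->
  (forall y, exists v, pi v = y) -> (forall a, pi a = 0 <-> exists b, a = t * b) ->
  has_length X l -> has_length Y (n * l).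
Proof.
move=> he qs qk ps pk hX; have [co [hco coe]] := basis_coord he.
have /choice[pr hpr] : forall i, exists pr : {linear Y -> X}, forall v, pr (q v) = pi (co i v).
  move=> i; have [|||f hf] := @lin_of_rel _ Y X
      (fun y x => exists2 v, y = q v & x = pi (co i v)).
  - by move=> y; have [v <-] := qs y; exists (pi (co i v)), v.
  - move=> x [v /esym/qk[v' ->] ->]; apply/pk; exists (co i v').
    by rewrite lin_Z.
  - move=> a _ _ _ _ [v -> ->] [v' -> ->]; exists (a *: v + v'); rewrite ?linearP //.
  by exists f => v; apply/hf; exists v.
apply: (length_power hX (pr := pr)).
  move=> x; have /choice[a ha] : forall i, exists a, pi a = x i by move=> i; apply: ps.
  exists (q (\sum_i a i *: e i)) => i; rewrite hpr -ha linear_sum; congr (pi _).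
  rewrite (bigD1 i) //= lin_Z coe eqxx big1 ?addr0.
    by rewrite -[LHS]/(a i * 1) mulr1.
  move=> j /negbTE ji; rewrite lin_Z coe eq_sym ji.
  by rewrite -[LHS]/(a j * 0) mulr0.
move=> y hy; have [v ev] := qs y; rewrite -ev; apply/qk.
have /choice[b hb] : forall i, exists b, co i v = t * b.
  by move=> i; apply/pk; rewrite -hpr ev.
exists (\sum_i b i *: e i); rewrite scaler_sumr {1}(hco v).
by apply: eq_bigr => i _; rewrite hb scalerA.
Qed.
End Bases.

(** * Null homotopies on a resolution, and classes in Ext *)

Section Resolution.
Variables (R : comPzRingType) (N : lmodType R) (F : nat -> lmodType R).
Variables (d : forall n, {linear F n.+1 -> F n}) (eps : {linear F 0 -> N}).

Definition is_resolution :=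
  [/\ (forall n, projective (F n)),
      (forall n x, d n (d n.+1 x) = 0) /\
        (forall n x, d n x = 0 -> exists y, x = d n.+1 y),
      (forall v, exists x, eps x = v),
      (forall x, eps (d 0 x) = 0) &
      (forall x, eps x = 0 -> exists y, x = d 0 y)].

Hypothesis hF : is_resolution.
Let projF n : projective (F n). Proof. by case: hF. Qed.
Let dd n x : d n (d n.+1 x) = 0. Proof. by case: hF => _ []. Qed.
Let exF n x : d n x = 0 -> exists y, x = d n.+1 y.
Proof. by case: hF => _ [_ ex] _ _ _; apply: ex. Qed.
Let epsd x : eps (d 0 x) = 0. Proof. by case: hF. Qed.
Let exeps x : eps x = 0 -> exists y, x = d 0 y. Proof. by case: hF => _ _ _ _; apply. Qed.

Definition null_homotopy (w : R) (h : forall n, {linear F n -> F n.+1}) :=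
  (forall x, w *: x = d 0 (h 0%N x)) /\
  (forall n x, w *: x = d n.+1 (h n.+1 x) + h n (d n x)).

Lemma null_homotopy_ex w : (forall v : N, w *: v = 0) ->
  exists h, null_homotopy w h.
Proof.
move=> wN; have [||h [h0 h1]] := @homotopy _ F d projF dd F d 1
  (fun n => lscale w (lid (F n))) exF.
- by move=> x; apply: exeps; rewrite /= lin_Z /= wN.
- by move=> n x; rewrite /= lin_Z scale1r.
by exists h; split=> [x|n x]; rewrite ?h0 // -[RHS]/(_ + _) -[h n _]scale1r -h1.
Qed.

Section Cohomology.
Variable V : lmodType R.

Definition cocycle n (phi : {linear F n -> V}) := forall x, phi (d n x) = 0.
Definition coboundary n : {linear F n -> V} -> Prop :=
  match n with
  | 0%N => fun phi => forall x, phi x = 0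
  | m.+1 => fun phi => exists chi : {linear F m -> V}, forall x, phi x = chi (d m x)
  end.
(** The vanishing of Ext^n(N, V). *)
Definition ext_vanish n := forall phi, @cocycle n phi -> coboundary phi.
End Cohomology.

Section Shift.
Variables (V V' : lmodType R) (q : {linear V -> V'}) (x : R).
Hypothesis xN : forall v : N, x *: v = 0.
Hypothesis xV : nzdiv x V.
Hypothesis q_surj : forall v', exists v, q v = v'.
Hypothesis q_ker : forall v, q v = 0 <-> exists v', v = x *: v'.

Let xinj (u v : V) : x *: u = x *: v -> u = v.
Proof.
by move=> e; apply/eqP; rewrite -subr_eq0; apply/eqP/xV; rewrite scalerBr e subrr.
Qed.

Lemma divide n (psi : {linear F n -> V}) : (forall y, q (psi y) = 0) ->
  exists phi : {linear F n -> V}, forall y, psi y = x *: phi y.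
Proof.
move=> h; have [|phi hphi] := proj_lift (g := lscale x (lid V)) (f := psi) (@projF n).
  by move=> y; have /q_ker := h y.
by exists phi.
Qed.

(** phi is killed by x, since multiplication by x is null-homotopic on F. *)
Lemma ext_vanish0 : ext_vanish V 0.
Proof.
move=> phi hphi y; have [h [h0 _]] := null_homotopy_ex xN.
by apply: xV; rewrite -lin_Z h0; apply: hphi.
Qed.

(** In the long exact sequence of multiplication by x on V, which acts as zero
    on Ext(N, V), Ext^n(N, V') surjects onto Ext^(n+1)(N, V). *)
Lemma ext_vanish_up n : ext_vanish V' n -> ext_vanish V n.+1.
Proof.
move=> hV' phi hphi; have [h [h0 h1]] := null_homotopy_ex xN.
have e y : x *: phi y = phi (h n (d n y)).
  by rewrite -lin_Z h1 linearD hphi add0r.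
suff [chi hchi] : exists chi : {linear F n -> V}, forall y,
    phi (h n (d n y)) = x *: chi (d n y).
  by exists chi => y; apply: xinj; rewrite e hchi.
have co : cocycle (lcomp q (lcomp phi (h n))).
  by move=> y; rewrite /= -e; apply/q_ker; exists (phi y).
case: n hV' phi hphi e co => [|m] hV' phi hphi e co.
  by have [chi hchi] := divide (hV' _ co); exists chi => y; rewrite -hchi.
have [chi hchi] := hV' _ co.
have [|chi' hchi'] := proj_lift (g := q) (f := chi) (@projF m).
  by move=> y; have [v <-] := q_surj (chi y); exists v.
have [|psi hpsi] := @divide m.+1 (lsub (lcomp phi (h m.+1)) (lcomp chi' (d m))).
  by move=> y; rewrite /= linearB -hchi' -hchi subrr.
by exists psi => y; rewrite -hpsi /= dd linear0 subr0.
Qed.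

(** In the long exact sequence of multiplication by x on V, Ext^n(N, V') lies
    between Ext^n(N, V) and Ext^(n+1)(N, V). *)
Lemma ext_vanish_down n : ext_vanish V n -> ext_vanish V n.+1 -> ext_vanish V' n.
Proof.
move=> hV hV1 phi hphi.
have [|phi' hphi'] := proj_lift (g := q) (f := phi) (@projF n).
  by move=> y; have [v <-] := q_surj (phi y); exists v.
have [|psi hpsi] := @divide n.+1 (lcomp phi' (d n)).
  by move=> y; rewrite /= -hphi'.
have [|chi hchi] := hV1 psi.
  by move=> y; apply: xV; rewrite -hpsi /= dd linear0.
have co : cocycle (lsub phi' (lscale x chi)).
  by move=> y; rewrite /= -hchi -hpsi subrr.
have q0 v : q (x *: v) = 0 by apply/q_ker; exists v.
case: n hV {hV1} phi hphi phi' hphi' psi hpsi chi hchi co => [|m] hV phi hphi phi' hphi' psi hpsi chi hchi co /=.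
  move=> y; have := hV _ co y; rewrite /= => /eqP; rewrite subr_eq0 => /eqP e.
  by rewrite hphi' e q0.
have [th hth] := hV _ co; exists (lcomp q th) => y /=.
by rewrite -hth /= linearB q0 subr0.
Qed.
End Shift.
End Resolution.

Section Augmented.
Variables (O : idomainType) (A : comPzRingType).
Variables (eta : {rmorphism O -> A}) (lambda : {rmorphism A -> O}).
Hypothesis etaK : forall r, lambda (eta r) = r.
Local Notation p := (kerr lambda).
Local Notation N := (restr lambda O^o).
Variables (F : nat -> lmodType A).
Variables (d : forall n, {linear F n.+1 -> F n}) (eps : {linear F 0 -> N}).
Hypothesis hF : is_resolution d eps.
Let projF n : projective (F n). Proof. by case: hF. Qed.
Let dd n x : d n (d n.+1 x) = 0. Proof. by case: hF => _ []. Qed.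
Let exF n x : d n x = 0 -> exists y, x = d n.+1 y.
Proof. by case: hF => _ [_ ex] _ _ _; apply: ex. Qed.
Let epsd x : eps (d 0 x) = 0. Proof. by case: hF. Qed.
Let exeps x : eps x = 0 -> exists y, x = d 0 y. Proof. by case: hF => _ _ _ _; apply. Qed.

Lemma pE (a : A) : a \in p <-> lambda a = 0. Proof. exact: kerrE. Qed.
Lemma p_sub (a : A) : a - eta (lambda a) \in p.
Proof. by apply/pE; rewrite rmorphB etaK subrr. Qed.

Lemma aug_lift : exists rho : {linear F 0 -> A^o}, forall x, lambda (rho x) = eps x.
Proof.
have ll : linear (lambda : A^o -> N).
  by move=> a x y; rewrite rmorphD -[lambda (a *: x)]/(lambda (a * x)) rmorphM.
have [|rho hrho] := proj_lift (g := mklin ll) (f := eps) (@projF 0%N).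
  by move=> x; exists (eta (eps x)); rewrite /= etaK.
by exists rho => x; rewrite hrho.
Qed.

Definition killed (W : lmodType A) := forall (a : A) (v : W), a \in p -> a *: v = 0.

Lemma killedE (W : lmodType A) a (v : W) : killed W -> a *: v = eta (lambda a) *: v.
Proof.
by move=> hW; apply/eqP; rewrite -subr_eq0 -scalerBl hW ?eqxx //; exact: p_sub.
Qed.

(** z is a cycle modulo p F, tested on maps to modules killed by p. Hence
    coboundaries with values in these modules vanish at z. *)
Definition pbd n : F n -> Prop :=
  match n with
  | 0%N => fun _ => True
  | m.+1 => fun z => forall (W : lmodType A) (phi : {linear F m -> W}),
              killed W -> phi (d m z) = 0
  end.

Section Cocycles.
Variables (W : lmodType A) (kW : killed W).

Lemma cocycle_contract n (w : A) h (phi : {linear F n.+1 -> W}) : w \in p ->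
  null_homotopy d w h -> cocycle d phi -> cocycle d (lcomp phi (h n)).
Proof.
move=> wp [_ h1] hphi x /=.
have : phi (w *: x) = 0 by rewrite lin_Z kW.
by rewrite h1 linearD hphi add0r.
Qed.

(** The difference of two null homotopies of w anticommutes with d, so it is
    itself null-homotopic; phi kills one error term as a cocycle, and the other
    one because z is a cycle modulo p F. *)
Lemma null_uniq n w h h' (phi : {linear F n.+1 -> W}) z :
  null_homotopy d w h -> null_homotopy d w h' -> cocycle d phi -> pbd z ->
  phi (h n z) = phi (h' n z).
Proof.
move=> [a0 a1] [b0 b1] hphi hz.
have [|||k [k0 k1]] := @homotopy _ F d projF dd (fun n => F n.+1) (fun n => d n.+1)
    (-1) (fun n => lsub (h n) (h' n)).
- by move=> m x /exF.
- by move=> x; apply: exF; rewrite /= linearB -a0 -b0 subrr.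
- move=> m x; rewrite /= linearB scaleN1r.
  apply/eqP; rewrite -subr_eq0 opprK addrACA -opprD -a1 -b1 subrr.
  by [].
apply/eqP; rewrite -subr_eq0 -linearB.
have -> : h n z - h' n z = lsub (h n) (h' n) z by [].
case: n phi z hphi hz => [|m] phi z hphi hz.
  by rewrite k0 hphi.
rewrite k1 linearD hphi add0r lin_Z.
by have /= -> := hz W (lcomp phi (k m)) kW; rewrite scaler0.
Qed.

Variable H : A -> forall n, {linear F n -> F n.+1}.
Hypothesis hH : forall w : A, w \in p -> null_homotopy d w (H w).

Section Slot.
Variables (n : nat) (phi : {linear F n.+1 -> W}) (z : F n).
Hypothesis (hphi : cocycle d phi) (hz : pbd z).

Lemma slotD (v w : A) : v \in p -> w \in p ->
  phi (H (v + w) n z) = phi (H v n z) + phi (H w n z).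
Proof.
move=> vp wp; rewrite -linearD.
have vwp : v + w \in p by exact: idealD.
apply: (null_uniq (h' := fun n => ladd (H v n) (H w n)) (hH vwp)) => //.
have [a0 a1] := hH vp; have [b0 b1] := hH wp; split=> [x|m x] /=.
  by rewrite scalerDl a0 b0 linearD.
by rewrite scalerDl a1 b1 linearD addrACA.
Qed.

Lemma slotZ (a w : A) : w \in p -> phi (H (a * w) n z) = a *: phi (H w n z).
Proof.
move=> wp; rewrite -lin_Z.
have awp : a * w \in p by exact: idealMl.
apply: (null_uniq (h' := fun n => lscale a (H w n)) (hH awp)) => //.
have [a0 a1] := hH wp; split=> [x|m x] /=.
  by rewrite -scalerA a0 lin_Z.
by rewrite -scalerA a1 scalerDr lin_Z.
Qed.

(** By [slotD] and [slotZ], w |-> phi (H w z) is A-linear on p with values in a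
    module killed by p. *)
Lemma slot_smulm (w : A) : w \in smulm p p -> w \in p /\ phi (H w n z) = 0.
Proof.
pose P : set A^o := [set w | w \in p /\ phi (H w n z) = 0].
have hP : submod_set P.
  have s0 : (0 : A) \in p by exact: ideal0.
  split=> [|a v w' [vp ev] [wp ew]].
    by split=> //; have := slotZ 0 s0; rewrite mul0r scale0r.
  have avp : a * v \in p by exact: idealMl.
  split; first by apply: idealD.
  by rewrite -[a *: v]/(a * v) slotD // slotZ // ev ew scaler0 addr0.
move: w; apply: (smulm_ind hP) => a b ap bp.
split; first exact: idealMl.
by rewrite -[a *: b]/(a * b) slotZ // kW.
Qed.

(** This bounds the image of Ext^c(O, M/pM) from above: if f is t x in p/p^2 up
    to torsion, then contraction by f is t times contraction by x up to
    torsion. *)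
Lemma slot_congr (f x t s : A) : f \in p -> x \in p -> s * (f - t * x) \in smulm p p ->
  s *: phi (H f n z) = (s * t) *: phi (H x n z).
Proof.
move=> fp xp /slot_smulm[_].
have tp : - t * x \in p by exact: idealMl.
have fx : f - t * x \in p by rewrite -mulNr; exact: idealD.
rewrite slotZ // -mulNr slotD // slotZ // scaleNr scalerBr scalerA => /eqP.
by rewrite subr_eq0 => /eqP.
Qed.
End Slot.
End Cocycles.

Variable H : A -> forall n, {linear F n -> F n.+1}.
Hypothesis hH : forall w : A, w \in p -> null_homotopy d w (H w).
Variable u : F 0.
Hypothesis hu : eps u = 1 :> O.

(** The image of the top generator of the Koszul complex on ws under the
    comparison map to F. *)
Fixpoint zel (ws : seq A) : F (size ws) :=
  if ws is w :: ws' then H w (size ws') (zel ws') else u.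

(** Induction by the homotopy formula d (H w z) = w z - H w (d z). *)
Lemma zel_bd (w : A) (ws : seq A) : {subset w :: ws <= p} -> idm (w :: ws) (d _ (zel (w :: ws))).
Proof.
elim: ws w => [|w' ws IH] w hw.
  by rewrite /= -(hH (hw w (mem_head _ _))).1; exists u; rewrite subrr.
have hp : w \in p by apply: hw; rewrite mem_head.
have hw' : {subset w' :: ws <= p} by move=> y hy; apply: hw; rewrite inE hy orbT.
have e : d _ (zel [:: w, w' & ws]) =
    w *: zel (w' :: ws) - H w _ (d _ (zel (w' :: ws))).
  by rewrite ((hH hp).2 _ (zel (w' :: ws))) addrK.
exists (zel (w' :: ws)); rewrite e addrC addrA addNr add0r.
by apply: subN; [exact: idm_sub|apply/idm_map/IH].
Qed.

Lemma idm_killed (W : lmodType A) (ws : seq A) (v : W) : killed W -> {subset ws <= p} ->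
  idm ws v -> v = 0.
Proof.
move=> kW hw; move: v; apply: idm_ind; first exact: submod_set0.
by move=> w m /hw wp /=; exact: kW.
Qed.

Lemma zel_pbd (ws : seq A) : {subset ws <= p} -> pbd (zel ws).
Proof.
case: ws => // w ws hw W phi kW; apply: (idm_killed kW hw).
by apply: idm_map; apply: zel_bd.
Qed.

(** a z = d (H a z) + H a (d z), where phi kills the first term and d z lies in
    (ws)F. *)
Lemma zel_eval_socle (M : lmodType A) (ws : seq A)
  (phi : {linear F (size ws) -> M}) (a : A) :
  {subset ws <= p} -> cocycle d phi -> a \in p -> idm ws (a *: phi (zel ws)).
Proof.
move=> hw hphi ap; rewrite -lin_Z; case: ws phi hw hphi => [|w ws] phi hw hphi.
  by rewrite (hH ap).1 hphi.
rewrite (hH ap).2 linearD hphi add0r.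
by apply: idm_map; apply: idm_map; apply: zel_bd.
Qed.

(** xi represents an A-linear map p -> O, that is, a class in Ext^1(O, O). *)
Definition plin (xi : A -> O) :=
  (forall a b : A, a \in p -> b \in p -> xi (a + b) = xi a + xi b) /\
  (forall a b : A, b \in p -> xi (a * b) = lambda a * xi b).

(** g is the cup product with the class of xi, as a chain map of degree -1. It
    anticommutes with the contraction h by w up to the scalar xi w, because the
    difference lifts the zero map. *)
Lemma cup_product_ex xi : plin xi -> exists g : forall n, {linear F n.+1 -> F n},
  (forall n x, d n (g n.+1 x) = - g n (d n.+1 x)) /\
  forall (W : lmodType A) (w : A) h, killed W -> w \in p -> null_homotopy d w h ->
    (forall (phi : {linear F 0 -> W}) z, cocycle d phi ->
       phi (g 0%N (h 0%N z)) = eta (xi w) *: phi z) /\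
    (forall n (phi : {linear F n.+1 -> W}) z, cocycle d phi -> pbd z ->
       phi (g n.+1 (h n.+1 z)) = eta (xi w) *: phi z - phi (h n (g n z))).
Proof.
move=> [xiD xiM]; have [rho hrho] := aug_lift.
have rhod x : rho (d 0 x) \in p by apply/pE; rewrite hrho epsd.
have lg : linear (fun x : F 1 => xi (rho (d 0 x)) : N).
  move=> a x y; rewrite !linearP /= xiD //; last by apply: idealMl.
  by rewrite xiM.
have [|g0 hg0] := proj_lift (g := eps) (f := mklin lg) (@projF 1%N).
  by move=> x; case: hF => _ _ /(_ (xi (rho (d 0 x))))[y hy] _ _; exists y.
have [||g [eg hg]] := @lift_complex _ (fun n => F n.+1) (fun n => d n.+1)
   (fun n => @projF n.+1) (fun n x => @dd n.+1 x) F d (-1) g0.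
- move=> n x hx; have [y ->] := exF hx; exists (- y).
  by rewrite scaleN1r linearN.
- move=> x; apply: exeps; rewrite lin_Z -hg0 /= dd linear0.
  have e0 : xi 0 = 0.
    by rewrite -(mul0r (0 : A)) xiM ?rmorph0 ?mul0r //; exact: ideal0.
  by rewrite e0 scaler0.
exists g; split=> [n x|W w h kW wp hh]; first by rewrite hg scaleN1r.
have [h0 h1] := hh.
pose e := eta (xi w).
pose del n : {linear F n -> F n} := match n with
  | 0%N => lsub (lcomp (g 0%N) (h 0%N)) (lscale e (lid (F 0)))
  | m.+1 => lsub (ladd (lcomp (g m.+1) (h m.+1)) (lcomp (h m) (g m)))
                 (lscale e (lid (F m.+1)))
  end.
have [||k [k0 k1]] := @homotopy _ F d projF dd F d 1 del exF.
- move=> x; apply: exeps; rewrite /= linearB lin_Z /= eg -hg0 /= -h0 lin_Z /=.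
  apply/eqP; rewrite subr_eq0; apply/eqP.
  rewrite -[rho x]/(rho x : A) -[w *: rho x]/(w * rho x) mulrC xiM // hrho.
  by rewrite -[RHS]/(lambda e * eps x : O) etaK mulrC.
- move=> n x; rewrite scale1r.
  have gd m y : d m (g m.+1 y) = - g m (d m.+1 y) by rewrite hg scaleN1r.
  have hd m y : d m.+1 (h m.+1 y) = w *: y - h m (d m y) by rewrite h1 addrK.
  case: n x => [|n] x; rewrite /= linearB linearD lin_Z gd.
    by rewrite hd linearB lin_Z opprB -h0 subrK.
  rewrite !hd linearB lin_Z opprB gd linearN opprK addrA.
  by rewrite -[X in X + _ - _]addrA addNr addr0 addrAC.
have kd n (phi : {linear F n -> W}) z : cocycle d phi -> pbd z ->
    phi (del n z) = 0.
  case: n phi z => [|n] phi z hphi hz; first by rewrite k0 hphi.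
  rewrite k1 linearD hphi add0r scale1r.
  exact: (hz W (lcomp phi (k n))).
split=> [phi z hphi|n phi z hphi hz].
  have /= := kd 0%N phi z hphi I.
  by rewrite linearB lin_Z => /eqP; rewrite subr_eq0 => /eqP.
have /= := kd n.+1 phi z hphi hz.
rewrite linearB linearD lin_Z => /eqP; rewrite subr_eq0 => /eqP <-.
by rewrite addrK.
Qed.

(** The functionals attached to the successive entries of ws form a triangular
    matrix of values on ws, and t is the product of its diagonal. *)
Fixpoint dual_family (t : O) (ws : seq A) : Prop :=
  if ws is w :: ws' then exists t1 t2 xi,
    [/\ t = t1 * t2, plin xi /\ xi w = t1, forall w', w' \in ws' -> xi w' = 0 &
        dual_family t2 ws']
  else t = 1.

(** phi is the cup product of the class of v in Ext^0 with the functionals dual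
    to ws. Moving each of them through the contractions that make up z, only
    the product of the diagonal survives, by triangularity. *)
Lemma zel_eval_lower (W : lmodType A) t (ws : seq A) (v : W) : killed W -> {subset ws <= p} ->
  dual_family t ws -> exists2 phi : {linear F (size ws) -> W},
    cocycle d phi & phi (zel ws) = eta t *: v.
Proof.
move=> kW; elim: ws t => [|w ws IH] t hw /=.
  move=> ->; have lf : linear (fun x : F 0 => eta (eps x : O) *: v).
    move=> a x y; rewrite linearP -[_ + _ : N]/(lambda a * eps x + eps y : O).
    by rewrite rmorphD rmorphM scalerDl -scalerA -(killedE a).
  exists (mklin lf) => [x|] /=; last by rewrite hu.
  by rewrite epsd rmorph0 scale0r.
case=> t1 [t2 [xi [-> [hxi e1] e2 hws]]].
have wp : w \in p by apply: hw; rewrite mem_head.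
have wsp : {subset ws <= p} by move=> y hy; apply: hw; rewrite inE hy orbT.
have [phi' hphi' ephi'] := IH t2 wsp hws.
have [g [gd gh]] := cup_product_ex hxi.
exists (lcomp phi' (g _)) => [x|] /=.
  by have := congr1 phi' (gd _ x); rewrite hphi' linearN => /esym/eqP; rewrite oppr_eq0 => /eqP.
rewrite rmorphM -scalerA -ephi'.
have vanish : forall w' ws' (psi : {linear F (size ws') -> W}), cocycle d psi ->
   (forall y, y \in w' :: ws' -> y \in p /\ xi y = 0) -> psi (g _ (zel (w' :: ws'))) = 0.
  move=> w' ws'; elim: ws' w' => [|w2 ws' IH'] w' psi hpsi hy;
    have [w'p xw'] := hy w' (mem_head _ _);
    have [c0 c1] := gh W w' _ kW w'p (hH w'p).
    by rewrite c0 // xw' rmorph0 scale0r.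
  have hz : {subset w2 :: ws' <= p}.
    by move=> y yy; apply: (hy y _).1; rewrite inE yy orbT.
  rewrite c1 //; last exact: (zel_pbd hz).
  rewrite xw' rmorph0 scale0r sub0r.
  have := IH' w2 (lcomp psi (H w' _)) (cocycle_contract kW w'p (hH w'p) hpsi).
  by move=> /= ->; rewrite ?oppr0 // => y yy; apply: hy; rewrite inE yy orbT.
have [c0 c1] := gh W w _ kW wp (hH wp).
case: ws phi' IH hw e2 hws wsp hphi' ephi' => [|w2 ws] phi' IH hw e2 hws wsp hphi' ephi'.
  by rewrite c0 // e1.
rewrite c1 //; last exact: (zel_pbd wsp).
rewrite e1; have := vanish w2 ws (lcomp phi' (H w _)) (cocycle_contract kW wp (hH wp) hphi').
by move=> /= ->; rewrite ?subr0 // => y yy; split; [apply: wsp|apply: e2].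
Qed.
End Augmented.

(** * The Koszul complex inside a resolution *)

Section ProductMaps.
Variables (R : comPzRingType) (U V W : lmodType R).
Lemma lnull_subproof : linear (fun _ : U => 0 : V).
Proof. by move=> a x y; rewrite scaler0 addr0. Qed.
Definition lnull := mklin lnull_subproof.
Lemma lfst_subproof : linear (fun x : (U * V)%type => x.1).
Proof. by []. Qed.
Definition lfst := mklin lfst_subproof.
Lemma lsnd_subproof : linear (fun x : (U * V)%type => x.2).
Proof. by []. Qed.
Definition lsnd := mklin lsnd_subproof.
Lemma lpair_subproof (f : {linear W -> U}) (g : {linear W -> V}) :
  linear (fun x => (f x, g x) : (U * V)%type).
Proof. by move=> a x y; rewrite !linearP. Qed.
Definition lpair f g := mklin (lpair_subproof f g).
End ProductMaps.
Lemma pair_eq (U V : Type) (x y : U * V) : x.1 = y.1 -> x.2 = y.2 -> x = y.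
Proof. by case: x y => [a b] [a' b'] /= -> ->. Qed.
Arguments lnull {R U V}.
Arguments lfst {R U V}.
Arguments lsnd {R U V}.

Section Koszul.
Variable A : comPzRingType.

(** The Koszul complex of w :: ws is the mapping cone of w on that of ws. *)
Fixpoint kos (ws : seq A) : nat -> lmodType A :=
  match ws with
  | [::] => fun n => if n is _.+1 then subm (submod0 A^o) else A^o
  | w :: ws' => fun n =>
      if n is m.+1 then (kos ws' m.+1 * kos ws' m)%type else kos ws' 0
  end.

Fixpoint kosd (ws : seq A) : forall n, {linear kos ws n.+1 -> kos ws n} :=
  match ws with
  | [::] => fun n => lnull
  | w :: ws' => fun n => match n with
    | 0%N => ladd (lcomp (kosd ws' 0%N) lfst) (lscale w lsnd)
    | m.+1 => lpair (ladd (lcomp (kosd ws' m.+1) lfst) (lscale w lsnd))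
                    (lscale (-1) (lcomp (kosd ws' m) lsnd))
    end
  end.

Fixpoint kin (ws : seq A) : {linear A^o -> kos ws 0} :=
  match ws with [::] => lid A^o | _ :: ws' => kin ws' end.
Fixpoint kout (ws : seq A) : {linear kos ws 0 -> A^o} :=
  match ws with [::] => lid A^o | _ :: ws' => kout ws' end.
Lemma koutK ws x : kin ws (kout ws x) = x.
Proof. by elim: ws x => //= w ws IH x; rewrite IH. Qed.

Lemma kos0 ws (x : kos ws 0) : idm ws x <-> exists y, x = kosd ws 0 y.
Proof.
elim: ws x => [|w ws IH] x /=; first by split=> [->|[_ ->]//]; exists 0.
split=> [[b /IH[a e]]|[[a b] ->]] /=.
  by exists (a, b); rewrite /= -e subrK.
by exists b; rewrite addrK; apply/IH; exists a.
Qed.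

Variable p : ideal A.
Hypothesis hp : prime_ideal p.

(** ws is a regular sequence on A localized at p, read from right to left. *)
Fixpoint preg (ws : seq A) : Prop :=
  if ws is w :: ws' then
    (exists2 s : A, s \notin p & forall a : A^o, idm ws' (w *: a) -> idm ws' (s *: a))
    /\ preg ws'
  else True.

(** The exact sequence of the mapping cone, with the denominators collected in
    one s. *)
Lemma kos_exact ws : preg ws -> exists2 s : A, s \notin p &
  forall n x, kosd ws n x = 0 -> exists y, s *: x = kosd ws n.+1 y.
Proof.
elim: ws => [_|w ws IH [[s1 s1p reg] /IH[s0 s0p ex0]]].
  exists 1; first exact: hp.1.
  move=> n x _; exists 0; rewrite /= scale1r; apply: val_inj.
  by have /submod_ofE := valP x.
exists (s0 * s0 * s0 * s1); first by do 3![apply: prime1 => //].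
have reg' (b : kos ws 0) : idm ws (w *: b) -> idm ws (s1 *: b).
  move=> h; rewrite -(koutK b) -lin_Z; apply/idm_map/reg.
  by rewrite -lin_Z; apply: idm_map.
case=> [|n] [a b] /=.
  move=> /eqP; rewrite addr_eq0 => /eqP e.
  have /reg'/kos0[b' eb] : idm ws (w *: b).
    by apply/kos0; exists (- a); rewrite linearN e opprK.
  have [|a' ea] := ex0 0%N (s1 *: a + w *: b').
    by rewrite linearD !lin_Z e -eb scalerN !scalerA mulrC addNr.
  exists (s0 * s0 *: a', - (s0 * s0 * s0) *: b'); apply: pair_eq; rewrite /=; last first.
    by rewrite (lin_Z (kosd ws 0) _ b') -eb scaleN1r scaleNr opprK scalerA.
  rewrite (lin_Z (kosd ws 1) _ a') -ea scaleNr scalerN !scalerDr.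
  rewrite !scalerA; have -> : w * (s0 * s0 * s0) = s0 * s0 * s0 * w by ring.
  by rewrite !mulrA addrK.
move=> [/eqP]; rewrite addr_eq0 => /eqP e1 /eqP; rewrite scaleN1r oppr_eq0 => /eqP e2.
have [b' eb] := ex0 n b e2.
have [|a' ea] := ex0 n.+1 (s0 *: a + w *: b').
  by rewrite linearD !lin_Z e1 -eb scalerN !scalerA mulrC addNr.
exists (s0 * s1 *: a', - (s0 * s0 * s1) *: b'); apply: pair_eq; rewrite /=; last first.
  rewrite (lin_Z (kosd ws n.+1) _ b') -eb scaleN1r scaleNr opprK scalerA.
  by congr (_ *: _); ring.
rewrite (lin_Z (kosd ws n.+2) _ a') -ea scaleNr scalerN !scalerDr.
rewrite !scalerA; have -> : w * (s0 * s0 * s1) = s0 * s1 * s0 * w by ring.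
by rewrite !mulrA addrK; congr (_ *: _); ring.
Qed.

Lemma kos_gt ws n : (size ws < n)%N -> forall x : kos ws n, x = 0.
Proof.
elim: ws n => [|w ws IH] [|n] // lt [] => [x px|a b].
  by apply: val_inj; have /submod_ofE := px.
by rewrite (IH n.+1 _ a) ?(IH n _ b) // ltnW.
Qed.
End Koszul.

Section Comparison.
Variables (O : idomainType) (A : comPzRingType).
Variables (eta : {rmorphism O -> A}) (lambda : {rmorphism A -> O}).
Hypothesis etaK : forall r, lambda (eta r) = r.
Local Notation p := (kerr lambda).
Local Notation N := (restr lambda O^o).
Variables (F : nat -> lmodType A).
Variables (d : forall n, {linear F n.+1 -> F n}) (eps : {linear F 0 -> N}).
Hypothesis hF : is_resolution d eps.
Let projF n : projective (F n). Proof. by case: hF. Qed.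
Let dd n x : d n (d n.+1 x) = 0. Proof. by case: hF => _ []. Qed.
Let exF n x : d n x = 0 -> exists y, x = d n.+1 y.
Proof. by case: hF => _ [_ ex] _ _ _; apply: ex. Qed.
Let epsd x : eps (d 0 x) = 0. Proof. by case: hF. Qed.
Let exeps x : eps x = 0 -> exists y, x = d 0 y. Proof. by case: hF => _ _ _ _; apply. Qed.
Variable H : A -> forall n, {linear F n -> F n.+1}.
Hypothesis hH : forall w : A, w \in p -> null_homotopy d w (H w).
Variable u : F 0.
Hypothesis hu : eps u = 1 :> O.
Local Notation zel := (zel H u).

Lemma to_u_subproof : linear (fun a : A^o => a *: u).
Proof. by move=> a x y; rewrite scalerDl -scalerA. Qed.

(** The comparison map from the Koszul complex to F: a cone is mapped by means
    of the null homotopy of the element coned off. *)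
Fixpoint kappa (ws : seq A) : forall n, {linear kos ws n -> F n} :=
  match ws with
  | [::] => fun n => match n with 0%N => mklin to_u_subproof | _.+1 => lnull end
  | w :: ws' => fun n => match n with
    | 0%N => kappa ws' 0%N
    | m.+1 => ladd (lcomp (kappa ws' m.+1) lfst)
                   (lcomp (H w m) (lcomp (kappa ws' m) lsnd))
    end
  end.

Lemma kappa0 ws x : kappa ws 0%N x = kout ws x *: u.
Proof. by elim: ws x. Qed.

Lemma kappa_chain (ws : seq A) n x : {subset ws <= p} ->
  d n (kappa ws n.+1 x) = kappa ws n (kosd ws n x).
Proof.
elim: ws n x => [|w ws IH] n x hw; first by rewrite /= !linear0.
have wp : w \in p by apply: hw; rewrite mem_head.
have {}IH := IH _ _ (fun y hy => hw y (mem_behead (s := w :: ws) hy)).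
have [h0 h1] := hH wp.
case: n x => [|n] [a b] /=; rewrite linearD IH.
  by rewrite -h0 linearD lin_Z.
have -> : d n.+1 (H w n.+1 (kappa ws n.+1 b)) =
    w *: kappa ws n.+1 b - H w n (d n (kappa ws n.+1 b)) by rewrite h1 addrK.
by rewrite IH linearD !lin_Z scaleN1r addrA.
Qed.

Lemma kappa_top ws (x : kos ws (size ws)) : exists a, kappa ws _ x = a *: zel ws.
Proof.
elim: ws x => [|w ws IH] x; first by exists x.
case: x => a b /=; rewrite (kos_gt (ltnSn _) a) linear0 add0r.
by have [c ->] := IH b; exists c; rewrite lin_Z.
Qed.

Lemma prime_exp (s : A) n : s \notin p -> s ^+ n \notin p.
Proof.
move=> sp; elim: n => [|n IH]; first exact: (aug_prime lambda).1.
by rewrite exprS; apply: prime1 => //; exact: aug_prime.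
Qed.

(** Since the Koszul complex on ws is a resolution of O at p, there is a map mu
    from F to it, up to the denominator s, such that kappa mu is homotopic to
    s^n in degree n. In top degree kappa takes values in the multiples of zel
    ws, so phi vanishes on its image, and a power of s times phi is a
    coboundary. *)
Lemma zel_eval_kernel (W : lmodType A) (ws : seq A) (phi : {linear F (size ws) -> W}) :
  killed lambda W -> {subset ws <= p} -> preg p ws ->
  (exists2 s : A, s \notin p & forall a : A, a \in p -> idm ws (s *: (a : A^o))) ->
  cocycle d phi -> phi (zel ws) = 0 ->
  exists2 s : A, s \notin p & coboundary d (lscale s phi).
Proof.
move=> kW hw hreg [s1 s1p hs1] hphi e0.
have [s0 s0p hs0] := kos_exact (aug_prime lambda) hreg.
have hp := aug_prime lambda.
pose s := s0 * s1; have sp : s \notin p by apply: prime1.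
have [rho hrho] := aug_lift etaK hF.
have [||mu [mu0 hmu]] := @lift_complex _ F d projF dd (kos ws) (kosd ws) s
    (lcomp (kin ws) rho).
- move=> n x hx; have [y hy] := hs0 n x hx; exists (s1 *: y).
  by rewrite lin_Z -hy scalerA mulrC.
- move=> x; have rp : rho (d 0%N x) \in p by apply/pE; rewrite hrho epsd.
  have /(idm_map (kin ws)) := hs1 _ rp.
  rewrite lin_Z => /kos0[y hy]; exists (s0 *: y).
  by rewrite /= lin_Z -hy scalerA.
have [||k [k0 hk]] := @homotopy _ F d projF dd F d s
  (fun n => lsub (lcomp (kappa ws n) (mu n)) (lscale (s ^+ n) (lid (F n)))) exF.
- move=> x; apply: exeps; rewrite /= linearB lin_Z expr0 scale1r mu0 kappa0 lin_Z /=.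
  have -> : kout ws (kin ws (rho x)) = rho x.
    by elim: (ws).
  by rewrite -[_ *: eps u]/(lambda (rho x) * eps u : O) hu mulr1 hrho subrr.
- move=> n x; have e : kappa ws n (kosd ws n (mu n.+1 x)) =
      s *: kappa ws n (mu n (d n x)).
    by rewrite -lin_Z; congr (kappa ws n _); exact: hmu.
  rewrite /= linearB lin_Z kappa_chain // scalerBr exprS -scalerA.
  by congr (_ - _).
(* The homotopy k turns s^n psi into a coboundary when psi vanishes on the
   image of kappa. *)
have main : forall n (psi : {linear F n -> W}), cocycle d psi ->
    (forall x : kos ws n, psi (kappa ws n x) = 0) ->
    coboundary d (lscale (s ^+ n) psi).
  case=> [|n] psi hpsi h0 /=.
    move=> x; have /= := congr1 psi (k0 x).
    by rewrite hpsi linearB h0 sub0r lin_Z => /eqP; rewrite oppr_eq0 => /eqP.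
  exists (lscale (- s) (lcomp psi (k n))) => x /=.
  have /= := congr1 psi (hk n x).
  rewrite linearB h0 sub0r linearD hpsi add0r !(lin_Z psi) => e.
  by rewrite scaleNr -e opprK.
exists (s ^+ size ws); first exact: prime_exp.
apply: main => // x; have [a ->] := kappa_top x.
by rewrite lin_Z e0 scaler0.
Qed.

Section SocleLift.
Variables (M : lmodType A) (m : ideal A).
Hypothesis noeM : noeth_mod M.
Hypothesis hm : prime_ideal m.
Hypothesis um : forall a : A, a \notin m -> exists b, a * b = 1.
Hypothesis pm : {subset p <= m}.

Lemma mreg_catrev ys xs ws : mreg M ys (catrev xs ws) -> mreg M (xs ++ ys) ws.
Proof. by elim: xs ws => //= w xs IH ws /IH[]. Qed.

Lemma divide_mod (P : lmodType A) xs w (phi : {linear P -> M}) :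
  projective P -> (forall x, idm (w :: xs) (phi x)) ->
  exists psi : {linear P -> M}, forall x, idm xs (phi x - w *: psi x).
Proof.
move=> pP h; have [|psi hpsi] := pP _ _ (lscale w (lid M)) phi _ (idm_sub M xs).
  by move=> x; have [y hy] := h x; exists y.
by exists psi.
Qed.

(** The connecting map for multiplication by w, one entry at a time. If phi is
    a cocycle modulo (w :: xs), then phi d = w psi modulo (xs), and psi is a
    cocycle modulo (xs). By the homotopy formula it takes the same value at zel
    (w :: ws) as phi at zel ws, after cancelling w, which is allowed by
    [mreg_rotate]. *)
Lemma socle_lift_step (xs ws : seq A) (phi : {linear F (size ws) -> M}) (v : M) (full : seq A) :
  catrev xs ws = full -> {subset full <= p} -> mreg M [::] full ->
  (forall x, idm xs (phi (d _ x))) -> idm full (phi (zel ws) - v) ->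
  exists2 phi' : {linear F (size full) -> M},
    cocycle d phi' & idm full (phi' (zel full) - v).
Proof.
elim: xs ws phi => [|w xs IH] ws phi /=; first by move=> <- _ _ h1 h2; exists phi.
move=> efull fp reg hd hv.
have sub_full : {subset xs ++ w :: ws <= full}.
  by rewrite -efull => y; rewrite catrevE !(mem_cat, inE, mem_rev).
have regw : mreg M xs (w :: ws).
  by have := @mreg_catrev [::] xs (w :: ws); rewrite cats0; apply; rewrite efull.
have wsp : {subset w :: ws <= p}.
  by move=> y hy; apply: fp; apply: sub_full; rewrite mem_cat hy orbT.
have wp : w \in p by apply: wsp; rewrite mem_head.
have [|rot _] := mreg_rotate noeM hm um _ regw; first by move=> y /wsp/pm.
have [|psi hpsi] := @divide_mod _ xs w (lcomp phi (d _)) (@projF _).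
  by move=> x; exact: hd.
apply: (IH (w :: ws) psi) => //.
  move=> x; apply: (regw.1).
  have := hpsi (d _ x); rewrite /= dd linear0 sub0r => h.
  by rewrite -[_ *: _]opprK; apply: subN h; exact: idm_sub.
have key : idm (xs ++ ws) (psi (zel (w :: ws)) - phi (zel ws)).
  apply: rot; rewrite scalerBr.
  have h1 : idm (xs ++ ws) (phi (d _ (zel (w :: ws))) - w *: psi (zel (w :: ws))).
    apply: (@idm_subset _ M xs) (hpsi (zel (w :: ws))) => y hy.
    by rewrite mem_cat hy.
  have h2 : idm (xs ++ ws) (w *: phi (zel ws) - phi (d _ (zel (w :: ws)))).
    case: (ws) phi {hd hv IH efull fp reg sub_full regw psi hpsi h1} wsp => [|w' ws'] phi wsp.
      rewrite -lin_Z -linearB /= -(hH wp).1 subrr linear0.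
      exact: (idm_sub M _).1.
    rewrite -lin_Z -linearB.
    have e : d _ (zel [:: w, w' & ws']) =
        w *: zel (w' :: ws') - H w _ (d _ (zel (w' :: ws'))).
      by rewrite ((hH wp).2 _ (zel (w' :: ws'))) addrK.
    rewrite e opprB addrC subrK.
    apply: (@idm_subset _ M (w' :: ws')).
      by move=> y hy; rewrite mem_cat hy orbT.
    apply/idm_map/idm_map/(zel_bd hH).
    by move=> y hy; apply: wsp; rewrite inE hy orbT.
  rewrite -opprB; apply: subN; first exact: idm_sub.
  have -> : w *: phi (zel ws) - w *: psi (zel (w :: ws)) =
    (w *: phi (zel ws) - phi (d _ (zel (w :: ws)))) +
    (phi (d _ (zel (w :: ws))) - w *: psi (zel (w :: ws))).
    by rewrite addrA subrK.
  by apply: subD h2 h1; exact: idm_sub.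
have -> : psi (zel (w :: ws)) - v =
   (psi (zel (w :: ws)) - phi (zel ws)) + (phi (zel ws) - v).
  by rewrite addrA subrK.
apply: subD hv; first exact: idm_sub.
apply: (@idm_subset _ M (xs ++ ws)) key => y hy; apply: sub_full.
by move: hy; rewrite !mem_cat inE => /orP[->//|->]; rewrite !orbT.
Qed.

(** v is a homomorphism O -> M/(ws)M, and the connecting maps carry Ext^0(O,
    M/(ws)M) to Ext^c(O, M), where c is the size of ws. *)
Lemma socle_lift (ws : seq A) (v : M) : {subset ws <= p} -> mreg M [::] ws ->
  (forall a : A, a \in p -> idm ws (a *: v)) ->
  exists2 phi : {linear F (size ws) -> M},
    cocycle d phi & idm ws (phi (zel ws) - v).
Proof.
move=> wsp reg hv; have [rho hrho] := aug_lift etaK hF.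
have lf : linear (fun x : F 0 => (rho x : A) *: v).
  move=> a x y; rewrite linearP -[a *: rho x + _]/(a * rho x + rho y).
  by rewrite scalerDl scalerA.
apply: (@socle_lift_step (rev ws) [::] (mklin lf)) => //.
- by rewrite catrevE revK cats0.
- move=> x /=; apply: (@idm_subset _ M ws); first by move=> y; rewrite mem_rev.
  by apply: hv; apply/pE; rewrite hrho epsd.
rewrite /= -{2}[v]scale1r -scalerBl; apply: hv; apply/pE.
by rewrite rmorphB hrho hu rmorph1 subrr.
Qed.
End SocleLift.
End Comparison.

(** * Localization and Krull's height theorem *)

Section Misc.
Variable R : comPzRingType.

Lemma subM (J : set R^o) (c a : R) : submod_set J -> J a -> J (c * a).
Proof. by move=> hJ; apply: (subZ c hJ). Qed.
Lemma sub_add (J : set R^o) (a b : R) : submod_set J -> J a -> J b -> J (a + b).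
Proof. by move=> hJ Ja Jb; apply: (subD hJ Ja Jb). Qed.

Lemma sub_sub (J : set R^o) (a b : R) : submod_set J -> J a -> J b -> J (a - b).
Proof. by move=> hJ Ja Jb; apply: (subB hJ Ja Jb). Qed.

Lemma comb_subset (V : lmodType R) (I : set R^o) (s s' : seq V) :
  submod_set I -> {subset s <= s'} -> comb I [set 0] s `<=` comb I [set 0] s'.
Proof.
move=> hI ss; have hs := comb_sub s' hI (@submod_set0 _ V).
apply: comb_ind => // [x ->|a v Ia vs]; first exact: hs.1.
by apply: comb_mem (ss _ vs) => //; exact: submod_set0.
Qed.

Lemma smulm_comb (V : lmodType R) (I : ideal R) (N : submodClosed V) v :
  v \in smulm I N -> exists s : seq V, (forall x, x \in s -> x \in N) /\
    comb [set a : R^o | a \in I] [set 0] s v.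
Proof.
pose C s := comb_sub s (ideal_setP I) (@submod_set0 _ V).
move: v; apply: smulm_ind.
  split=> [|a x y [s [sN hx]] [s' [s'N hy]]]; first by exists [::].
  exists (s ++ s'); split=> [z|].
    by rewrite mem_cat => /orP[/sN|/s'N].
  apply: (C _).2; [move: hx|move: hy]; apply: comb_subset;
    by [exact: ideal_setP|move=> z hz; rewrite mem_cat hz ?orbT].
move=> a x aI xN; exists [:: x]; split; first by move=> z; rewrite inE => /eqP ->.
by exists a; rewrite //= subrr.
Qed.

Lemma local_criterion (m : ideal R) : 1 \notin m ->
  (forall a : R, a \notin m -> exists b, a * b = 1) -> local_with m.
Proof.
move=> m1 um.
have sub (J : ideal R) : 1 \notin J -> {subset J <= m}.
  move=> J1 a aJ; apply/negPn/negP => /um[b ab].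
  by move/negP: J1; apply; rewrite -ab; apply: idealMr.
split; first by split=> // J _; exact: sub.
move=> J [J1 hJ] a; apply/idP/idP; first exact: sub.
by apply: hJ => //; exact: sub.
Qed.

Lemma mem_powid (Q : ideal R) (q : R) k : q \in Q -> q ^+ k \in powid Q k.
Proof.
move=> qQ; elim: k => [|k IH]; first exact: (proj2 (submod_ofE (full_subproof R^o) _) I).
by rewrite exprS; apply: (@smulm_mem _ R^o Q (powid Q k) q (q ^+ k)).
Qed.

Lemma smulm_subr (V : lmodType R) (I : ideal R) (N : submodClosed V) v :
  v \in smulm I N -> v \in N.
Proof.
move: v; apply: smulm_ind; first exact: submod_closed_set.
by move=> a x _ xN /=; apply: rpredZ.
Qed.
End Misc.

(** Krull's principal ideal theorem for a local domain. *)
Section PrincipalIdeal.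
Variables (S : comPzRingType) (n : ideal S) (x : S).
Hypothesis noeS : noeth_mod S^o.
Hypothesis hn : local_with n.
Hypothesis domS : forall a b : S, a * b = 0 -> a = 0 \/ b = 0.
Hypothesis xn : x \in n.
Hypothesis minx : forall Q : ideal S, prime_ideal Q -> x \in Q -> {subset n <= Q}.

Let un (a : S) : a \notin n -> exists b, a * b = 1.
Proof. exact: local_unit. Qed.

(** The symbolic powers of Q stabilize modulo x, because S/x has finite length.
    By Nakayama's lemma they stabilize, and by Nakayama's lemma at Q their
    stable value vanishes. *)
Lemma principal_ideal_domain (Q : ideal S) : prime_ideal Q -> ~ {subset n <= Q} ->
  forall q : S, q \in Q -> q = 0.
Proof.
move=> hQ nQ q qQ; have hnp := maximal_prime hn.1.
have xQ : x \notin Q by apply/negP => /(minx hQ).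
(* sp k is the symbolic power Q^(k), and I k is Q^(k) + (x). *)
pose sp k : set S^o := [set a | exists2 s : S, s \notin Q & s * a \in powid Q k].
have hsp k : submod_set (sp k).
  split=> [|c a b [s sQ ha] [t tQ hb]].
    by exists 1; [exact: hQ.1|rewrite mulr0; exact: ideal0].
  exists (s * t); first exact: prime1.
  have -> : s * t * (c *: a + b) = t * c * (s * a) + s * (t * b).
    by rewrite /GRing.scale /=; ring.
  by apply: idealD; apply: idealMl.
have sp_dec k : sp k.+1 `<=` sp k.
  by move=> a [s sQ ha]; exists s => //; apply: smulm_subr ha.
pose B : set S^o := [set a | exists c, a = c * x].
have hB : submod_set B by exact: principal_set.
pose I k : set S^o := [set a | exists2 b, sp k b & exists c, a = b + c * x].
have hI k : submod_set (I k).
  split=> [|e a a' [b hb [c ->]] [b' hb' [c' ->]]].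
    by exists 0; [exact: (hsp k).1|exists 0; rewrite mul0r addr0].
  exists (e *: b + b'); first exact: (hsp k).2.
  by exists (e * c + c'); rewrite /GRing.scale /=; ring.
have BI k : B `<=` I k.
  by move=> _ [c ->]; exists 0; [exact: (hsp k).1|exists c; rewrite add0r].
have I_dec k : I k.+1 `<=` I k.
  by move=> a [b /sp_dec hb hc]; exists b.
have [|N hN] := chain_bound noeS noeS hn.1 un hB.
  move=> P hP hann; apply: (minx hP); apply: hann => v.
  by exists v; rewrite mulrC.
have [k hk] := dec_stable hI BI I_dec hN.
have sp_le : sp k `<=` sp k.+1.
  have [|t tn ht] := @nakayama _ _ hnp S^o (sp k.+1) (sp k) (hsp _) (noeS (hsp k)).
    move=> a spa; exists 1; first exact: hnp.1.
    have /hk[b hb [c e]] : I k a by exists a => //; exists 0; rewrite mul0r addr0.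
    exists [:: (c : S^o)]; split.
      move=> z; rewrite inE => /eqP ->.
      have [s sQ hs] : sp k (c * x).
        have -> : c * x = a - b by rewrite e addrAC subrr add0r.
        by apply: subB => //; exact: sp_dec.
      exists (s * x); first exact: prime1.
      by rewrite -mulrA [x * c]mulrC.
    exists x => //; rewrite scale1r /=.
    have -> : a - x *: (c : S^o) = b by rewrite e -[x *: _]/(x * c) mulrC addrK.
    exact: hb.
  move=> a /ht h; have [b tb] := un tn.
  have -> : a = b *: (t *: a) by rewrite scalerA mulrC tb scale1r.
  exact: (subZ b (hsp k.+1) h).
have [|t tQ ht] := @nakayama _ _ hQ S^o [set 0] [set a | a \in powid Q k]
    (@submod_set0 _ _) (noeS (submod_closed_set _)).
  move=> a ha; have [s sQ hs] : sp k.+1 a.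
    by apply: sp_le; exists 1; [exact: hQ.1|rewrite mul1r].
  by exists s => //; apply: smulm_comb.
have tq : t * q ^+ k = 0 by apply: (ht (q ^+ k)); apply: mem_powid.
have t0 : t <> 0 by move=> t0; move: tQ; rewrite t0 (ideal0 Q).
have [//|] := domS tq; elim: k {hk sp_le ht tq} => [|k IH].
  by rewrite expr0 => e; case: t0; rewrite -[t]mulr1 e mulr0.
by rewrite exprS => /domS[].
Qed.
End PrincipalIdeal.

Definition mkrmorph (A S : pzRingType) (f : A -> S) (h1 : zmod_morphism f)
  (h2 : monoid_morphism f) : {rmorphism A -> S} :=
  HB.pack f (GRing.isZmodMorphism.Build A S f h1) (GRing.isMonoidMorphism.Build A S f h2).

(** j presents S as the localization of A/I at the prime p. Working with such a
    presentation expresses statements about A_p, (A/f)_p and the localizations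
    of domains A/P by elements of A. *)
Definition is_loc (A S : comPzRingType) (j : A -> S) (p : ideal A) (I : set A) :=
  [/\ forall z : S, exists a (s : A), s \notin p /\ z * j s = j a,
      forall a : A, j a = 0 <-> exists2 s : A, s \notin p & I (s * a) &
      forall s : A, s \notin p -> exists z, j s * z = 1].

Section Localization.
Variables (A S : comPzRingType) (j : {rmorphism A -> S}) (p : ideal A) (I : set A).
Hypothesis hp : prime_ideal p.
Hypothesis loc : is_loc j p I.
Hypothesis Ip : I `<=` [set a | a \in p].

Let frac z : exists a (s : A), s \notin p /\ z * j s = j a.
Proof. by case: loc. Qed.
Let j0 (a : A) : j a = 0 <-> exists2 s : A, s \notin p & I (s * a).
Proof. by case: loc => _ ->. Qed.
Let junit (s : A) : s \notin p -> exists z, j s * z = 1.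
Proof. by case: loc => _ _ h; apply: h. Qed.

Lemma loc_noeth : noeth_mod A^o -> noeth_mod S^o.
Proof.
move=> noeA J hJ; pose J' : set A^o := [set a | J (j a)].
have hJ' : submod_set J'.
  split=> [|c a b ha hb]; first by rewrite /J' /= rmorph0; exact: hJ.1.
  rewrite /J' /= rmorphD; apply: sub_add => //.
  by rewrite -[j (c *: a)]/(j (c * a)) rmorphM; apply: subM.
have [s hs] := noeA _ hJ'; exists (map j s) => z; split; last first.
  apply: (lc_ind hJ) => y /mapP[a ha ->].
  by have : J' a by apply/hs/lc_mem.
move=> Jz; have [a [t [tp e]]] := frac z.
have [y ty] := junit tp.
have -> : z = y * j a by rewrite -e mulrCA [y * _]mulrC ty mulr1.
apply: subM; first exact: lc_sub.
have /hs : J' a by rewrite /J' /= -e mulrC; apply: subM.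
have hP : submod_set [set b : A^o | @lc _ S^o (map j s) (j b)].
  split=> [|c b b' hb hb']; first by rewrite /= rmorph0; exact: (lc_sub _).1.
  rewrite /= rmorphD; apply: sub_add => //; first exact: lc_sub.
  by rewrite -[j (c *: b)]/(j (c * b)) rmorphM; apply: subM => //; exact: lc_sub.
apply: (lc_ind hP) => b bs /=; exact/lc_mem/map_f.
Qed.

Section Extension.
Variable P : ideal A.
Lemma ext_sub : submod_set
  [set z : S^o | exists a s : A, [/\ a \in P, s \notin p & z * j s = j a]].
Proof.
split=> [|c x y [a [s [aP sp ex]]] [b [t [bP tp ey]]]].
  by exists 0, 1; rewrite ideal0 rmorph0 mul0r; split=> //; exact: hp.1.
have [e [v [vp ec]]] := frac c.
exists (e * a * t + b * s * v), (v * s * t); split.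
- by apply: idealD; [do 1!apply: idealMr; apply: idealMl|do 2!apply: idealMr].
- by do 2![apply: prime1 => //].
rewrite rmorphD !rmorphM -ex -ey -ec /GRing.scale /=; ring.
Qed.
Definition ext_ideal : ideal S := submod_of ext_sub.
Lemma ext_idealP (z : S) : z \in ext_ideal <->
  exists a s : A, [/\ a \in P, s \notin p & z * j s = j a].
Proof. exact: (submod_ofE ext_sub). Qed.
End Extension.

Lemma mem_ext (P : ideal A) (a : A) : prime_ideal P -> I `<=` [set a | a \in P] ->
  {subset P <= p} -> j a \in ext_ideal P <-> a \in P.
Proof.
move=> hP IP Pp; split; last first.
  by move=> aP; apply/ext_idealP; exists a, 1; rewrite rmorph1 mulr1; split=> //; exact: hp.1.
move=> /ext_idealP[b [s [bP sp e]]].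
have /j0[t tp ht] : j (a * s - b) = 0 by rewrite rmorphB rmorphM e subrr.
have h1 : t * (a * s) \in P.
  have -> : t * (a * s) = t * (a * s - b) + t * b by ring.
  by apply: idealD; [exact: IP|exact: idealMl].
have nP (y : A) : y \notin p -> y \notin P by apply: contra => /Pp.
case/hP.2: h1 => [h|]; first by rewrite (negbTE (nP t tp)) in h.
by case/hP.2 => // h; rewrite (negbTE (nP s sp)) in h.
Qed.

Lemma ext_prime (P : ideal A) : prime_ideal P -> I `<=` [set a | a \in P] ->
  {subset P <= p} -> prime_ideal (ext_ideal P).
Proof.
move=> hP IP Pp; split.
  by rewrite -(rmorph1 j); apply/negP => /(mem_ext _ hP IP Pp); apply/negP/hP.1.
move=> x y xy; have [a [s [sp ex]]] := frac x; have [b [t [tp ey]]] := frac y.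
have : j (a * b) \in ext_ideal P.
  rewrite rmorphM -ex -ey (_ : _ * _ = j s * j t * (x * y)); last by ring.
  exact: idealMl.
by move=> /(mem_ext _ hP IP Pp)/hP.2[h|h]; [left|right]; apply/ext_idealP;
  [exists a, s|exists b, t].
Qed.

Lemma loc_local : local_with (ext_ideal p).
Proof.
apply: local_criterion.
  rewrite -(rmorph1 j); apply/negP => h; have := hp.1; apply/negP/negPn.
  exact/(mem_ext _ hp Ip).
move=> z hz; have [a [s [sp ez]]] := frac z.
have /junit[y ay] : a \notin p.
  by apply: contra hz => ap; apply/ext_idealP; exists a, s.
by exists (j s * y); rewrite mulrA ez.
Qed.

Lemma loc_generators (ws : seq A) : {subset ws <= p} ->
  (exists2 s : A, s \notin p & forall a : A, a \in p ->
     exists2 b : A, I b & idm ws (s * a - b : A^o)) ->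
  exists e : 'I_(size ws) -> S, ext_ideal p =i span (range (e : 'I_(size ws) -> S^o)).
Proof.
move=> wsp [s sp hs]; exists (fun i => j (nth 0 ws i)) => z; apply/idP/idP; last first.
  move: z; apply: span_sub; first exact: submod_closed_set.
  move=> _ [i _ <-] /=; apply/(mem_ext _ hp Ip) => //; apply: wsp; exact: mem_nth.
move=> /ext_idealP[a [t [ap tp e]]].
set J := span _; have [y ty] := junit tp.
have -> : z = y * j a by rewrite -e mulrCA [y * _]mulrC ty mulr1.
apply: idealMl; have [b Ib hb] := hs a ap; have [y' sy'] := junit sp.
have jb : j b = 0.
  by apply/j0; exists 1; [exact: hp.1|rewrite mul1r].
have -> : j a = y' * j (s * a - b) by rewrite rmorphB rmorphM jb subr0 mulrA [y' * _]mulrC sy' mul1r.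
apply: idealMl.
have hP : submod_set [set b : A^o | j b \in J].
  split=> [|c u u' hu hu']; first by rewrite /= rmorph0 ideal0.
  rewrite /= rmorphD; apply: idealD => //.
  by rewrite -[j (c *: u)]/(j (c * u)) rmorphM; apply: idealMl.
apply: (idm_ind hP _ hb) => w m ww /=.
rewrite -[j (w *: m)]/(j (w * m)) rmorphM; apply: idealMr; apply: span_gen.
have lt : (index w ws < size ws)%N by rewrite index_mem.
by exists (Ordinal lt); rewrite //= nth_index.
Qed.

Section Contraction.
Variable Q : ideal S.
Lemma contr_sub : submod_set [set a : A^o | j a \in Q].
Proof.
split=> [|c u u' hu hu']; first by rewrite /= rmorph0 ideal0.
rewrite /= rmorphD; apply: idealD => //.
by rewrite -[j (c *: u)]/(j (c * u)) rmorphM; apply: idealMl.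
Qed.
Definition contr_ideal : ideal A := submod_of contr_sub.
Lemma contrP (a : A) : a \in contr_ideal <-> j a \in Q.
Proof. exact: (submod_ofE contr_sub). Qed.
Lemma contr_prime : prime_ideal Q -> prime_ideal contr_ideal.
Proof.
move=> hQ; split; first by apply/negP => /contrP; rewrite rmorph1; apply/negP/hQ.1.
by move=> a b /contrP; rewrite rmorphM => /hQ.2[h|h]; [left|right]; apply/contrP.
Qed.
Lemma contr_base : I `<=` [set a | a \in contr_ideal].
Proof.
move=> a Ia; apply/contrP; have -> : j a = 0; last exact: ideal0.
by apply/j0; exists 1; [exact: hp.1|rewrite mul1r].
Qed.
Lemma contr_le : prime_ideal Q -> {subset contr_ideal <= p}.
Proof.
move=> hQ a /contrP aQ; apply/negPn/negP => /junit[z az].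
by move/negP: hQ.1; apply; rewrite -az; apply: idealMr.
Qed.
End Contraction.

Lemma contr_subset (Q Q' : ideal S) : {subset contr_ideal Q <= contr_ideal Q'} ->
  {subset Q <= Q'}.
Proof.
move=> h z zQ; have [a [s [sp e]]] := frac z.
have /h/contrP : a \in contr_ideal Q by apply/contrP; rewrite -e; apply: idealMr.
have [y sy] := junit sp.
by rewrite -e => /(idealMr y); rewrite -mulrA sy mulr1.
Qed.
End Localization.

Section LocInstance.
Variables (A C : comPzRingType) (h : {rmorphism A -> C}) (P : ideal C).
Hypothesis hP : prime_ideal P.
Hypothesis h_surj : forall c, exists a, h a = c.

Lemma locr_of_zmod : zmod_morphism (locr_of (prime_compl hP)).
Proof.
move=> a b; rewrite /locr_of /GRing.add /GRing.opp /= locm_oppE locm_addE.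
apply/locm_fracP; exists 1; first exact: rpred1.
by rewrite den_mul den_one mul1r !scale1r.
Qed.
Lemma locr_of_monoid : monoid_morphism (locr_of (prime_compl hP)).
Proof.
split=> // a b; rewrite [RHS]/GRing.mul /= /locr_mul /locr_of loc_scaleE.
by apply/locm_fracP; exists 1; [exact: rpred1|rewrite ?den_mul ?den_one !scale1r mul1r scale1r].
Qed.
Definition loc_map : {rmorphism C -> ring_at hP} := mkrmorph locr_of_zmod locr_of_monoid.

Definition pull_ideal := contr_ideal h P.

Lemma loc_instance : is_loc (loc_map \o h) pull_ideal [set a | h a = 0].
Proof.
have nP (s : A) : s \notin pull_ideal <-> h s \notin P.
  by split; apply: contra; [move=> ?; apply/contrP|move/contrP].
have compl (s : C) : s \notin P -> s \in prime_compl hP by [].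
split=> [z|a|s].
- have [c [[t tP] ->]] := locr_repr z.
  have [a ea] := h_surj c; have [s es] := h_surj t.
  exists a, s; split; first by apply/nP; rewrite es.
  rewrite [LHS]/GRing.mul /= /locr_mul /locr_of loc_scaleE.
  apply/locm_fracP; exists 1; first exact: rpred1.
  rewrite !den_mul den_one !scale1r ea es mulr1.
  by rewrite -[c *: (t : C^o)]/(c * t) mulrC.
- split=> [/locm_fracP[u uS]|[s /nP sP hs]].
    rewrite !den_one !scale1r scaler0 => e.
    have [s es] := h_surj u; exists s; first by apply/nP; rewrite es.
    by rewrite /= rmorphM es -e.
  apply/locm_fracP; exists (h s); first exact: compl.
  by rewrite !den_one !scale1r scaler0 -[RHS]hs rmorphM.
- move=> /nP sP; exists (locm_frac (1 : C^o) (exist _ (h s) (compl _ sP))).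
  rewrite [LHS]/GRing.mul /= /locr_mul /locr_of loc_scaleE.
  apply/locm_fracP; exists 1; first exact: rpred1.
  by rewrite !den_mul den_one mul1r !scale1r.
Qed.
End LocInstance.

Section PrimeChains.
Variable A : comPzRingType.
Implicit Types P Q : ideal A.

Definition lt_ideal P Q := {subset P <= Q} /\ ~ {subset Q <= P}.

(** A strictly increasing chain of n + 1 primes from P to Q. *)
Fixpoint pch n P Q : Prop :=
  prime_ideal Q /\
  match n with
  | 0%N => P =i Q
  | m.+1 => exists2 Q', pch m P Q' & lt_ideal Q' Q
  end.

Lemma pch_prime n P Q : pch n P Q -> prime_ideal Q.
Proof. by case: n => [|n] []. Qed.
Lemma pch_le n P Q : pch n P Q -> {subset P <= Q}.
Proof.
elim: n Q => [|n IH] Q [hQ]; first by move=> e a; rewrite e.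
by case=> Q' /IH PQ' [Q'Q _] a /PQ'/Q'Q.
Qed.
Lemma pch_prime_bot n P Q : pch n P Q -> prime_ideal P.
Proof.
elim: n Q => [|n IH] Q [hQ]; last by case=> Q' /IH.
move=> e; split; first by rewrite e; exact: hQ.1.
by move=> a b; rewrite !e; apply: hQ.2.
Qed.
Lemma lt_ideal_trans_le P Q Q' : lt_ideal P Q -> {subset Q <= Q'} -> lt_ideal P Q'.
Proof.
by move=> [PQ nQP] QQ'; split=> [a /PQ/QQ'//|h]; apply: nQP => a /QQ'/h.
Qed.

Lemma prime_chainP n : prime_chain A n <-> exists P Q, pch n P Q.
Proof.
split=> [[P [hP st]]|[P [Q c]]].
  exists (P 0%N), (P n); have h : forall i, (i <= n)%N -> pch i (P 0%N) (P i).
    elim=> [|i IH] le; split; try exact: hP.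
    - by [].
    - by exists (P i); [exact: IH (ltnW le)|exact: st].
  exact: h.
suff [S [hS eS st]] : exists S : nat -> ideal A, [/\ forall i, (i <= n)%N -> prime_ideal (S i),
    S n = Q & forall i, (i < n)%N -> lt_ideal (S i) (S i.+1)].
  by exists S.
elim: n Q c => [|n IH] Q [hQ]; first by exists (fun=> Q); split.
case=> Q' /IH[S [hS eS st]] lt.
exists (fun i => if (i <= n)%N then S i else Q); split=> [i le||i].
- by case: ifP => // /hS.
- by rewrite ltnn.
rewrite ltnS => le; rewrite le; case: ltnP => lti; first exact: st.
have -> : i = n by apply/eqP; rewrite eqn_leq le.
by rewrite eS.
Qed.

Hypothesis noeA : noeth_mod A^o.

(** Otherwise no prime of A/P0 localized at P2 contains x, apart from the
    maximal ideal. The principal ideal theorem then makes the image of P1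
    vanish there. *)
Lemma prime_between P0 P1 P2 x : prime_ideal P0 -> prime_ideal P1 -> prime_ideal P2 ->
  lt_ideal P0 P1 -> lt_ideal P1 P2 -> x \in P2 ->
  exists Q, [/\ prime_ideal Q, lt_ideal P0 Q, lt_ideal Q P2 & x \in Q].
Proof.
move=> h0 h1 h2 l01 l12 xP2; have [xP0|xP0] := boolP (x \in P0).
  by exists P1; split=> //; exact: l01.1.
apply: contrapT => no.
have P02 : {subset P0 <= P2} by move=> a /l01.1/l12.1.
(* The local domain is the localization of A/P0 at the image PP of P2. *)
pose h : {rmorphism A -> rquot P0} := @rquot_pi A P0.
have h_surj c : exists a, h a = c by exists (quom_repr c); exact: rquot_reprK.
have hker (a : A) : h a = 0 <-> a \in P0.
  rewrite -(rmorph0 h); split=> [/quom_piP|aP]; first by rewrite subr0.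
  by apply/quom_piP; rewrite subr0.
have hP2s : submod_set [set c : (rquot P0)^o | exists2 a : A, a \in P2 & c = h a].
  split=> [|c _ _ [a aP ->] [b bP ->]].
    by exists 0; [exact: ideal0|rewrite rmorph0].
  have [d <-] := h_surj c; exists (d * a + b); last by rewrite rmorphD rmorphM.
  by apply: idealD => //; apply: idealMl.
pose PP := submod_of hP2s.
have inPP (a : A) : h a \in PP <-> a \in P2.
  split=> [/(submod_ofE hP2s)[b bP e]|aP]; last by apply/(submod_ofE hP2s); exists a.
  have /hker : h (a - b) = 0 by rewrite rmorphB e subrr.
  by move=> /P02 h'; rewrite -(subrK b a); apply: idealD.
have hPP : prime_ideal PP.
  split; first by apply/negP; rewrite -(rmorph1 h) => /inPP; apply/negP/h2.1.
  move=> c c'; have [a <-] := h_surj c; have [b <-] := h_surj c'.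
  by rewrite -rmorphM => /inPP/h2.2[aP|bP]; [left|right]; apply/inPP.
pose j : {rmorphism A -> ring_at hPP} := loc_map hPP \o h.
pose p := pull_ideal h PP.
have loc : is_loc j p [set a | h a = 0] by exact: loc_instance.
have pP2 (a : A) : a \in p <-> a \in P2.
  by split=> [/contrP/inPP|aP] //; apply/contrP/inPP.
have hp : prime_ideal p by exact: contr_prime.
have Ip : [set a | h a = 0] `<=` [set a | a \in p].
  by move=> a /hker/P02/pP2.
have IP0 : [set a | h a = 0] `<=` [set a | a \in P0] by move=> a /hker.
have IP1 : [set a | h a = 0] `<=` [set a | a \in P1] by move=> a /hker/l01.1.
have P1p : {subset P1 <= p} by move=> a /l12.1/pP2.
have P0p : {subset P0 <= p} by move=> a /P02/pP2.
have j0 (a : A) : j a = 0 <-> a \in P0.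
  case: loc => _ -> _; split=> [[s sp /hker/h0.2[]//]|aP].
    by move=> /P0p; rewrite (negbTE sp).
  by exists 1; [exact: hp.1|apply/hker; rewrite mul1r].
have domS (z y : ring_at hPP) : z * y = 0 -> z = 0 \/ y = 0.
  case: (loc) => fr _ ju zy; have [a [s [sp ea]]] := fr z; have [b [t [tp eb]]] := fr y.
  have cancel (w : ring_at hPP) (v : A) : v \notin p -> w * j v = 0 -> w = 0.
    move=> vp e; have [v' vv] := ju v vp.
    by rewrite -[w]mulr1 -vv mulrA e mul0r.
  have : a * b \in P0.
    apply/j0; rewrite rmorphM -ea -eb (_ : _ * _ = (z * y) * (j s * j t)); last by ring.
    by rewrite zy mul0r.
  case/h0.2 => /j0 e; [left; apply: (cancel z s sp)|right; apply: (cancel y t tp)].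
    by rewrite ea.
  by rewrite eb.
have xn : j x \in ext_ideal hp loc p.
  by apply/(mem_ext hp loc _ hp Ip (fun _ h => h)) => //; apply/pP2.
have minx (Q : ideal (ring_at hPP)) : prime_ideal Q -> j x \in Q ->
    {subset ext_ideal hp loc p <= Q}.
  move=> hQ xQ; set q := contr_ideal j Q.
  have hq : prime_ideal q by exact: contr_prime.
  have qp : {subset q <= p} by exact: (contr_le loc).
  have P0q : {subset P0 <= q} by move=> a /hker ha; apply: (contr_base hp loc).
  have [pq|npq] := pselect {subset p <= q}.
    move=> z /ext_idealP[a [s [/pq/contrP aQ sp e]]].
    case: (loc) => _ _ /(_ s sp)[y sy].
    by rewrite -[z]mulr1 -sy mulrA e; apply: idealMr.
  case: no; exists q; split=> //.
  + by split=> // /(_ x) h'; move/negP: xP0; apply; apply/h'/contrP.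
  + by split=> [a /qp/pP2//|h']; apply: npq => a /pP2/h'.
  + exact/contrP.
have nQ : ~ {subset ext_ideal hp loc p <= ext_ideal hp loc P1}.
  move=> h'; case: l12 => _; apply=> a /pP2 ap.
  by apply/(mem_ext hp loc _ h1 IP1 P1p)/h'/(mem_ext hp loc _ hp Ip (fun _ h => h)).
have H := principal_ideal_domain (loc_noeth loc noeA) (loc_local hp loc Ip) domS
  xn minx (ext_prime hp loc h1 IP1 P1p) nQ.
case: l01 => _; apply=> a aP1; apply/j0/H.
exact/(mem_ext hp loc _ h1 IP1 P1p).
Qed.

(** The chain is rerouted from the top downwards. *)
Lemma pch_through n P Q x : pch n.+1 P Q -> prime_ideal P -> x \in Q ->
  exists P', [/\ pch n P' Q, prime_ideal P', lt_ideal P P' & x \in P'].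
Proof.
elim: n P Q => [|n IH] P Q [hQ [Q' c l]] hP xQ.
  exists Q; split=> //; case: c => _ e; split=> [a|h]; first by rewrite e; apply: l.1.
  by apply: l.2 => a /h; rewrite e.
have [hQ' [Q'' c' l']] := c.
have [R [hR l1 l2 xR]] := prime_between (pch_prime c') hQ' hQ l' l xQ.
have [|P' [c2 hP' l3 xP']] := IH P R _ hP xR.
  by split=> //; exists Q''.
by exists P'; split=> //; split=> //; exists R.
Qed.

(** Krull's height theorem, by induction on ws. The chain is extended to p and
    rerouted so that its second member contains w, which then joins xs. *)
Lemma height_le (p : ideal A) (s : A) ws xs d P Q : prime_ideal p -> s \notin p ->
  (forall a : A, a \in p -> idm (xs ++ ws) (s * a : A^o)) -> {subset ws <= p} ->
  {subset xs <= P} -> prime_ideal P -> pch d P Q -> {subset Q <= p} -> (d <= size ws)%N.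
Proof.
move=> hp sp; elim: ws xs d P Q => [|w ws IH] xs d P Q hs wsp xsP hP c Qp.
  case: d c => // d [hQ [Q' c [Q'Q []]]] a aQ; apply: (pch_le c).
  have : s * a \in P.
    have := hs a (Qp a aQ); rewrite cats0.
    by apply: (idm_ind (submod_closed_set P)) => x m /xsP xP; apply: (idealMr m xP).
  by case/hP.2 => // /(pch_le c)/Q'Q/Qp; rewrite (negbTE sp).
case: d c => // d c; have wp : w \in p by apply: wsp; rewrite mem_head.
have {}c : pch d.+1 P p.
  by case: c => hQ [Q' c l]; split=> //; exists Q' => //; exact: lt_ideal_trans_le Qp.
have [P' [c' hP' [PP' _] wP']] := pch_through c hP wp.
apply: (IH (w :: xs) d P' p) => //.
- move=> a /hs; apply: idm_subset => y.
  by rewrite !(inE, mem_cat) orbCA orbA.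
- by move=> y yw; apply: wsp; rewrite inE yw orbT.
- by move=> y; rewrite inE => /orP[/eqP->//|/xsP/PP'].
Qed.
End PrimeChains.

(** * Localized modules and their rank *)

Lemma field_rank_le (K : fieldType) n r (P : 'I_n -> 'I_r -> K) (Q : 'I_r -> 'I_n -> K) :
  (forall i k, \sum_j P i j * Q j k = (i == k)%:R) -> (n <= r)%N.
Proof.
move=> h; pose MP := \matrix_(i, j) P i j; pose MQ := \matrix_(i, j) Q i j.
have e : MP *m MQ = 1%:M.
  apply/matrixP => i k; rewrite !mxE -h; apply: eq_bigr => j _.
  by rewrite !mxE.
by have := mulmx_max_rank MP MQ; rewrite e mxrank1.
Qed.

Lemma idomain_rank_le (O : idomainType) n r (s : 'I_n -> O) (P : 'I_n -> 'I_r -> O)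
    (Q : 'I_r -> 'I_n -> O) : (forall i, s i != 0) ->
  (forall i k, \sum_j P i j * Q j k = s i * (i == k)%:R) -> (n <= r)%N.
Proof.
move=> s0 h.
apply: (@field_rank_le {fraction O} n r (fun i j => (FracField.tofrac (s i))^-1 * FracField.tofrac (P i j))
   (fun j k => FracField.tofrac (Q j k))) => i k.
have s0' : FracField.tofrac (s i) != 0 by rewrite tofrac_eq0.
under eq_bigr => j _ do rewrite -mulrA -rmorphM.
rewrite -mulr_sumr -rmorph_sum h rmorphM mulrA mulVf // mul1r.
by case: (i == k); rewrite ?rmorph1 ?rmorph0.
Qed.

Lemma basis_size_uniq (S : comPzRingType) (K : fieldType) (chi : {rmorphism S -> K})
    (V : lmodType S) n r (e : 'I_n -> V) (b : 'I_r -> V) :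
  is_basis e -> is_basis b -> n = r.
Proof.
have le n' r' (e' : 'I_n' -> V) (b' : 'I_r' -> V) : is_basis e' -> is_basis b' -> (n' <= r')%N.
  move=> he hb.
  have /choice[P hP] : forall i, exists a, e' i = \sum_j a j *: b' j.
    by move=> i; have [a [? _]] := hb (e' i); exists a.
  have /choice[Q hQ] : forall j, exists a, b' j = \sum_k a k *: e' k.
    by move=> j; have [a [? _]] := he (b' j); exists a.
  apply: (@field_rank_le K n' r' (fun i j => chi (P i j)) (fun j k => chi (Q j k))) => i k.
  under eq_bigr => j _ do rewrite -rmorphM.
  rewrite -rmorph_sum; have [a [_ ua]] := he (e' i).
  have e1 : a = (fun k => \sum_j P i j * Q j k).
    apply: ua; rewrite {1}hP; under eq_bigr => j _ do rewrite hQ scaler_sumr.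
    rewrite exchange_big; apply: eq_bigr => l _; rewrite scaler_suml.
    by apply: eq_bigr => j _; rewrite scalerA.
  have e2 : a = (fun k => (i == k)%:R).
    apply: ua; rewrite (bigD1 i) //= eqxx scale1r big1 ?addr0 // => l.
    by rewrite eq_sym => /negbTE ->; rewrite scale0r.
  have /(congr1 (fun f => f k)) /= -> : (fun k => \sum_j P i j * Q j k) = (fun k => (i == k)%:R).
    by rewrite -e1 e2.
  by case: (i == k); rewrite ?rmorph1 ?rmorph0.
by move=> he hb; apply/eqP; rewrite eqn_leq !(le _ _ _ _ he hb, le _ _ _ _ hb he).
Qed.

(** A ring morphism to a field makes the size of a basis unique. *)
Lemma free_rankE (S : comPzRingType) (K : fieldType) (chi : {rmorphism S -> K})
  (V : lmodType S) r (b : 'I_r -> V) : is_basis b -> free_rank V = r.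
Proof.
move=> hb; rewrite /free_rank; case: xgetP => [n _ [e he]|/(_ r)]; last first.
  by case; exists b.
exact: (basis_size_uniq chi he hb).
Qed.

Section ResidueField.
Variables (O : idomainType) (A : comPzRingType) (lambda : {rmorphism A -> O}).
Local Notation p := (kerr lambda).
Local Notation hp := (aug_prime lambda).
Local Notation frac := (@FracField.tofrac O).

(** The residue map of A_p, with values in the fraction field of O. *)
Definition chi_fun (z : ring_at hp) : {fraction O} :=
  frac (lambda (repr (z : locm (prime_compl hp) A^o)).1)
  / frac (lambda (den (repr (z : locm (prime_compl hp) A^o)).2)).

Lemma lambda_den (s : denom (prime_compl hp)) : frac (lambda (den s)) != 0.
Proof.
rewrite tofrac_eq0; apply/eqP => /(kerrE lambda) h.
by have := denP s; rewrite /in_mem /= /prime_compl_pred h.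
Qed.

Lemma chi_frac (a : A) s : chi_fun (locm_frac (a : A^o) s) = frac (lambda a) / frac (lambda (den s)).
Proof.
rewrite /chi_fun; have [v Sv e] := locm_reprP (a : A^o) s.
set b := (repr _).1 in e *; set t := (repr _).2 in e *.
have v0 := lambda_den (exist _ v Sv); rewrite /den /= in v0.
have s0 := lambda_den s; have t0 := lambda_den t.
apply/eqP; rewrite eqr_div // -!rmorphM; apply/eqP; congr (frac _).
have v1 : lambda v != 0 by rewrite -tofrac_eq0.
apply: (mulfI v1); rewrite -!rmorphM [b * _]mulrC [a * _]mulrC.
exact: (congr1 lambda e).
Qed.

Lemma chi_zmod : zmod_morphism chi_fun.
Proof.
move=> x y; have [a [s ->]] := locr_repr x; have [b [t ->]] := locr_repr y.
have s0 := lambda_den s; have t0 := lambda_den t.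
have -> : (locm_frac (a : A^o) s : ring_at hp) - locm_frac (b : A^o) t =
    locm_frac (den t *: (a : A^o) + den s *: - (b : A^o)) (loc_mul s t).
  by rewrite [LHS]/GRing.add /= [X in locm_add _ X]/GRing.opp /= locm_oppE locm_addE.
rewrite !chi_frac den_mul.
rewrite -mulNr addf_div // -!rmorphN -!rmorphM -!rmorphD; congr (frac _ / frac _).
  rewrite -[den t *: (a : A^o)]/(den t * a) -[den s *: (- b : A^o)]/(den s * - b).
  by congr (lambda _); ring.
Qed.
Lemma chi_monoid : monoid_morphism chi_fun.
Proof.
split=> [|x y].
  by rewrite [1]/(locm_frac (1 : A^o) (loc_one _)) chi_frac den_one rmorph1 divff // rmorph1 oner_neq0.
have [a [s ->]] := locr_repr x; have [b [t ->]] := locr_repr y.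
have -> : (locm_frac (a : A^o) s : ring_at hp) * locm_frac (b : A^o) t =
    locm_frac (a *: (b : A^o)) (loc_mul s t).
  by rewrite [LHS]/GRing.mul /= /locr_mul loc_scaleE.
rewrite !chi_frac den_mul.
by rewrite -[a *: (b : A^o)]/(a * b) !rmorphM invfM mulrACA.
Qed.
Definition chi : {rmorphism ring_at hp -> {fraction O}} := mkrmorph chi_zmod chi_monoid.
End ResidueField.

Section LocalizedBasis.
Variables (A S : comPzRingType) (j : {rmorphism A -> S}) (p : ideal A).
Hypothesis hp : prime_ideal p.
Hypothesis loc : is_loc j p [set 0].
Variables (M : lmodType A) (M' : lmodType S) (iota : M -> M').
Hypothesis iotaD : forall x y, iota (x + y) = iota x + iota y.
Hypothesis iotaZ : forall a x, iota (a *: x) = j a *: iota x.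
Hypothesis iota_frac : forall z, exists x (t : A), t \notin p /\ j t *: z = iota x.
Hypothesis iota0 : forall x, iota x = 0 -> exists2 s : A, s \notin p & s *: x = 0.

Let iota_0 : iota 0 = 0.
Proof. by rewrite -(scale0r (0 : M)) iotaZ rmorph0 scale0r. Qed.
Let iota_sum r (x : 'I_r -> M) : iota (\sum_k x k) = \sum_k iota (x k).
Proof. exact: (big_morph iota iotaD iota_0). Qed.

Lemma prod_notin r (s : 'I_r -> A) (P : pred 'I_r) : (forall k, s k \notin p) ->
  \prod_(k | P k) s k \notin p.
Proof.
move=> h; elim/big_ind: _ => //; first exact: hp.1.
by move=> x y; apply: prime1.
Qed.

Lemma common_frac r (g : 'I_r -> S) : exists (s : A) (c : 'I_r -> A), s \notin p /\
  forall k, g k * j s = j (c k).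
Proof.
case: loc => fr _ _.
have /choice[c /choice[s hs]] : forall k, exists c (s : A), s \notin p /\ g k * j s = j c.
  by move=> k; apply: fr.
exists (\prod_k s k), (fun k => c k * \prod_(l | l != k) s l); split.
  by apply: prod_notin => k; case: (hs k).
move=> k; rewrite (bigD1 k) //= !rmorphM mulrA.
by have [_ ->] := hs k.
Qed.

Lemma localized_basis r (mm : 'I_r -> M) :
  (exists2 s : A, s \notin p & forall x, exists a : 'I_r -> A, s *: x = \sum_k a k *: mm k) ->
  (forall a : 'I_r -> A, \sum_k a k *: mm k = 0 ->
     exists2 s : A, s \notin p & forall k, s * a k = 0) ->
  is_basis (fun k => iota (mm k)).
Proof.
move=> [s sp hs] ind z; case: (loc) => _ j0 ju.
have [x [t [tp ez]]] := iota_frac z; have [a ea] := hs x.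
have [y sy] := ju _ (prime1 hp sp tp).
exists (fun k => y * j (a k)); split.
  under eq_bigr => k _ do rewrite -scalerA -iotaZ.
  rewrite -scaler_sumr -iota_sum -ea iotaZ -ez scalerA -rmorphM scalerA.
  by rewrite mulrC sy scale1r.
move=> b eb; apply/funext => k0.
pose g k := y * j (a k) - b k.
have [v [c [vp hc]]] := common_frac g.
have : iota (\sum_k c k *: mm k) = 0.
  rewrite iota_sum; under eq_bigr => k _ do rewrite iotaZ -hc mulrC -scalerA.
  rewrite -scaler_sumr; under eq_bigr => k _ do rewrite scalerBl.
  rewrite sumrB -eb; under eq_bigr => k _ do rewrite -scalerA -iotaZ.
  rewrite -scaler_sumr -iota_sum -ea iotaZ -ez scalerA -rmorphM scalerA.
  by rewrite [y * _]mulrC sy scale1r subrr scaler0.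
move=> /iota0[w wp]; rewrite scaler_sumr.
under eq_bigr => k _ do rewrite scalerA.
move=> /ind[w' w'p /(_ k0) e].
have jc : j (c k0) = 0.
  apply/j0; exists (w' * w); first exact: prime1.
  by rewrite /= -mulrA.
have [v' vv] := ju v vp.
apply/eqP; rewrite -subr_eq0 -/(g k0); apply/eqP.
by rewrite -[g k0]mulr1 -vv mulrA hc jc mul0r.
Qed.
End LocalizedBasis.

Section ModuleAt.
Variables (A : comPzRingType) (p : ideal A) (hp : prime_ideal p) (M : lmodType A).

Lemma loc_ring_at : is_loc (loc_map hp) p [set 0].
Proof.
have [h1 h2 h3] := @loc_instance A A idfun p hp (fun c => ex_intro _ c erefl).
have pe (a : A) : a \in pull_ideal (idfun : {rmorphism A -> A}) p <-> a \in p.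
  exact: contrP.
have pn (a : A) : a \notin pull_ideal (idfun : {rmorphism A -> A}) p <-> a \notin p.
  by split; apply: contra => /pe.
split=> [z|a|s sp].
- by have [a [s [/pn sp e]]] := h1 z; exists a, s.
- by rewrite [X in X <-> _](h2 a); split=> -[s sp e]; exists s => //; apply/pn.
- by apply: h3; apply/pn.
Qed.

Definition iota_at (x : M) : module_at hp M := locm_frac x (loc_one (prime_compl hp)).

Lemma iota_atD x y : iota_at (x + y) = iota_at x + iota_at y.
Proof.
rewrite [RHS]/GRing.add /= /iota_at locm_addE; apply/locm_fracP.
by exists 1; [exact: rpred1|rewrite den_mul !den_one mul1r !scale1r].
Qed.
Lemma iota_atZ (a : A) x : iota_at (a *: x) = loc_map hp a *: iota_at x.
Proof.
rewrite [RHS]/GRing.scale /= /iota_at /locr_of loc_scaleE; apply/locm_fracP.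
by exists 1; [exact: rpred1|rewrite den_mul !den_one mul1r !scale1r].
Qed.
Lemma iota_at_frac z : exists x (t : A), t \notin p /\ loc_map hp t *: z = iota_at x.
Proof.
rewrite -(locm_repr z); set x := (repr z).1; set t := (repr z).2.
exists x, (den t); split; first exact: (denP t).
rewrite [LHS]/GRing.scale /= /iota_at /locr_of loc_scaleE; apply/locm_fracP.
by exists 1; [exact: rpred1|rewrite den_mul !den_one mul1r !scale1r].
Qed.
Lemma iota_at0 x : iota_at x = 0 -> exists2 s : A, s \notin p & s *: x = 0.
Proof.
move=> /locm_fracP[u uS]; rewrite !den_one !scale1r scaler0 => e.
by exists u.
Qed.
End ModuleAt.

(** * Freeness at the augmentation prime, and representatives of Ext classes *)

Lemma quom_pi0 (R : pzRingType) (V : lmodType R) (S : submodClosed V) (x : V) :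
  quom_pi S x = 0 <-> x \in S.
Proof.
have -> : (0 : quom S) = quom_pi S 0 by rewrite linear0.
by rewrite quom_piP subr0.
Qed.

Lemma fg_setT (R : comPzRingType) (V : lmodType R) : fg_module V -> fgs [set: V].
Proof. by case=> s hs; exists s => x; split=> // _; apply/span_lc/hs. Qed.

Lemma fg_fun (R : comPzRingType) r : fg_module ('I_r -> R^o).
Proof.
exists [seq (fun k => (k == i)%:R : R^o) | i <- enum 'I_r] => a.
have -> : a = \sum_i a i *: (fun k => (k == i)%:R : R^o).
  apply/funext => k.
  have -> : (\sum_i a i *: (fun k => (k == i)%:R : R^o)) k = \sum_i a i * (k == i)%:R.
    by elim/big_ind2 : _ => //= u1 u2 w1 w2 e1 e2; rewrite /GRing.add /= e1 e2.
  rewrite (bigD1 k) //= eqxx mulr1 big1 ?addr0 // => i /negbTE ik.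
  by rewrite eq_sym ik mulr0.
elim/big_ind: _ => [|x y hx hy|i _]; [exact: rpred0|exact: rpredD|].
by apply: rpredZ; apply: span_gen; apply: map_f; rewrite mem_enum.
Qed.

Section FreeAtAugmentation.
Variables (O : idomainType) (A : comPzRingType).
Variables (eta : {rmorphism O -> A}) (lambda : {rmorphism A -> O}).
Hypothesis etaK : forall r, lambda (eta r) = r.
Local Notation p := (kerr lambda).
Local Notation hp := (aug_prime lambda).
Hypothesis noeA : noeth_mod A^o.
Variable m : ideal A.
Hypothesis hm : prime_ideal m.
Hypothesis um : forall a : A, a \notin m -> exists b, a * b = 1.
Hypothesis pm : {subset p <= m}.
Variables (M : lmodType A) (T : lmodType O) (Q : M -> T).
Hypothesis fgM : fg_module M.
Hypothesis QD : forall x y, Q (x + y) = Q x + Q y.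
Hypothesis QZ : forall (a : A) x, Q (a *: x) = lambda a *: Q x.
Hypothesis Qker : forall x, Q x = 0 <->
  exists2 s : A, s \notin p & s *: x \in smulm p (submodT M).
Variable ws : seq A.
Hypothesis wsp : {subset ws <= p}.
Hypothesis reg : mreg M [::] ws.
Hypothesis gen : exists2 s : A, s \notin p & forall a : A, a \in p -> idm ws (s * a : A^o).
Variables (r : nat) (e : 'I_r -> T) (mm : 'I_r -> M).
Hypothesis he : is_basis e.
Hypothesis emm : forall k, Q (mm k) = e k.

Let noeM : noeth_mod M. Proof. exact: noeth_fg noeA fgM. Qed.

Lemma Q0 : Q 0 = 0.
Proof. by rewrite -(scale0r (0 : M)) QZ rmorph0 scale0r. Qed.
Lemma QB x y : Q (x - y) = Q x - Q y.
Proof. by rewrite QD -scaleN1r QZ rmorphN rmorph1 scaleN1r. Qed.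
Lemma Q_sum (f : 'I_r -> M) : Q (\sum_k f k) = \sum_k Q (f k).
Proof. exact: (big_morph Q QD Q0). Qed.

Lemma Q_p (a : A) x : a \in p -> Q (a *: x) = 0.
Proof. by move=> /pE ap; rewrite QZ ap scale0r. Qed.
Lemma Q_idm (ys : seq A) x : {subset ys <= p} -> idm ys x -> Q x = 0.
Proof.
move=> yp; have hP : submod_set [set x | Q x = 0].
  split=> [|a y z hy hz]; first exact: Q0.
  by rewrite /= QD QZ hy hz scaler0 addr0.
by apply: (idm_ind hP) => w z /yp wp /=; apply: Q_p.
Qed.

Lemma span_sub_set : submod_set [set x : M | exists a : 'I_r -> A, x = \sum_k a k *: mm k].
Proof.
split=> [|c x y [a ->] [b ->]].
  by exists (fun=> 0); rewrite big1 // => k _; rewrite scale0r.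
exists (fun k => c * a k + b k); rewrite scaler_sumr -big_split /=.
by apply: eq_bigr => k _; rewrite scalerDl scalerA.
Qed.

(** At p, T is the fibre M/pM, so Nakayama's lemma applies. *)
Lemma span_basis : exists2 s : A, s \notin p &
  forall x, exists a : 'I_r -> A, s *: x = \sum_k a k *: mm k.
Proof.
set N := [set x : M | exists a : 'I_r -> A, x = \sum_k a k *: mm k].
have hN : submod_set N by exact: span_sub_set.
have [|s sp hs] := @nakayama _ _ hp M N setT hN (fg_setT fgM); last first.
  by exists s => // x; apply: hs.
move=> x _; have [a [ea _]] := he (Q x).
pose y := \sum_k eta (a k) *: mm k.
have /Qker[t tp /smulm_comb[S [_ hS]]] : Q (x - y) = 0.
  rewrite QB Q_sum ea; apply/eqP; rewrite subr_eq0; apply/eqP; apply: eq_bigr => k _.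
  by rewrite QZ etaK emm.
exists t => //; exists S; split=> //.
have cN := comb_sub S (ideal_setP p) hN.
have -> : t *: x = t *: (x - y) + t *: y by rewrite -scalerDr subrK.
apply: subD => //.
  by apply: combN hS => z ->; exact: hN.1.
by apply: (@comb_base _ _ _ N S (ideal_setP p)); apply: (subZ t hN); exists (fun k => eta (a k)).
Qed.

(** A relation whose coefficients lie in (w :: xs) can be divided by w, as w is
    regular on M/(xs)M. So the module of relations modulo (xs) is contained in
    (xs) plus w times itself, and Nakayama's lemma applies. *)
Lemma free_step (xs : seq A) (w : A) : w \in p -> (forall v : M, idm xs (w *: v) -> idm xs v) ->
  (forall a : 'I_r -> A, idm (w :: xs) (\sum_k a k *: mm k) ->
     exists2 s : A, s \notin p & forall k, idm (w :: xs) (s * a k : A^o)) ->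
  (forall a : 'I_r -> A, idm xs (\sum_k a k *: mm k) ->
     exists2 s : A, s \notin p & forall k, idm xs (s * a k : A^o)).
Proof.
move=> wp rw hP.
pose K : set ('I_r -> A^o) := [set a | idm xs (\sum_k (a k : A) *: mm k)].
pose N : set ('I_r -> A^o) := [set a | forall k, idm xs (a k)].
have hK : submod_set K.
  split=> [|c a b ha hb].
    rewrite /K /= big1; first exact: (idm_sub M xs).1.
    by move=> k _; rewrite scale0r.
  rewrite /K /=; have -> : \sum_k ((c *: a + b) k : A) *: mm k =
      c *: (\sum_k (a k : A) *: mm k) + \sum_k (b k : A) *: mm k.
    rewrite scaler_sumr -big_split /=; apply: eq_bigr => k _.
    by rewrite scalerA -scalerDl.
  exact: (idm_sub M xs).2.
have hN : submod_set N.
  split=> [|c a b ha hb] k; first exact: (idm_sub _ xs).1.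
  exact: (idm_sub _ xs).2.
have [|s sp hs] := @nakayama _ _ hp _ N K hN (noeth_fg noeA (@fg_fun A r) hK).
  move=> a Ka; have [|t tp ht] := hP a; first by exists 0; rewrite scaler0 subr0.
  have /choice[b hb] : forall k, exists b : A^o, idm xs (t * a k - w *: b : A^o).
    by move=> k; have [b hb] := ht k; exists b.
  exists t => //; exists [:: b]; split.
    move=> z; rewrite inE => /eqP ->; rewrite /K /=; apply: rw.
    have -> : w *: (\sum_k (b k : A) *: mm k) = t *: (\sum_k (a k : A) *: mm k) -
        \sum_k (t * a k - w * b k) *: mm k.
      rewrite !scaler_sumr -sumrB; apply: eq_bigr => k _.
      by rewrite !scalerA scalerBl opprB addrC subrK.
    apply: subB; [exact: idm_sub|by apply: subZ => //; exact: idm_sub|].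
    elim/big_ind: _ => [|x y hx hy|k _]; first exact: (idm_sub M xs).1.
      by apply: subD => //; exact: idm_sub.
    have lf : linear (fun c : A^o => (c : A) *: mm k).
      by move=> c x y; rewrite scalerDl -scalerA.
    exact: (idm_map (mklin lf) (hb k)).
  by exists w => // k; apply: hb.
by move=> a Ka; exists s => // k; apply: hs.
Qed.

(** Descent along the regular sequence from (ws) to 0. Modulo (ws), which is p
    up to a denominator, the coefficients vanish because the e k are a
    basis. *)
Lemma free_general (ws' xs : seq A) : mreg M xs ws' -> {subset ws' <= p} ->
  catrev ws' xs =i ws ->
  (forall a : 'I_r -> A, idm xs (\sum_k a k *: mm k) ->
     exists2 s : A, s \notin p & forall k, idm xs (s * a k : A^o)).
Proof.
elim: ws' xs => [|w ws' IH] xs /=.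
  move=> _ _ e1 a ha; have [s sp hs] := gen; exists s => // k.
  apply: (@idm_subset _ _ ws); first by move=> y; rewrite -e1.
  apply: hs; apply/pE.
  have z : \sum_k lambda (a k) *: e k = 0.
    have <- : Q (\sum_k a k *: mm k) = \sum_k lambda (a k) *: e k.
      by rewrite Q_sum; apply: eq_bigr => i _; rewrite QZ emm.
    by apply: (Q_idm (ys := xs)) => // y; rewrite e1; apply: wsp.
  have [b [_ ub]] := he 0.
  have b0 : b = (fun=> 0) by apply: ub; rewrite big1 // => i _; rewrite scale0r.
  by have /(congr1 (fun f => f k)) := ub _ (esym z); rewrite b0.
move=> [rw regs] hw e1; have wp : w \in p by apply: hw; rewrite mem_head.
apply: (free_step wp rw); apply: IH => // y yw; apply: hw; by rewrite inE yw orbT.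
Qed.

Lemma free_basis (a : 'I_r -> A) : \sum_k a k *: mm k = 0 ->
  exists2 s : A, s \notin p & forall k, s * a k = 0.
Proof.
move=> ha; have [|s sp hs] := @free_general ws [::] reg wsp _ a ha.
  by move=> y; rewrite catrevE cats0 mem_rev.
by exists s.
Qed.

Lemma free_rank_at_aug_prime : free_rank (module_at hp M) = r.
Proof.
apply: (free_rankE (chi lambda) (b := fun k => iota_at hp (mm k))).
apply: (localized_basis hp (loc_ring_at hp) (@iota_atD _ _ hp M) (@iota_atZ _ _ hp M)
  (@iota_at_frac _ _ hp M) (@iota_at0 _ _ hp M) span_basis free_basis).
Qed.

Lemma idm_coord (ys : seq A) (x : M) : idm ys x ->
  exists2 s : A, s \notin p & exists2 c : 'I_r -> A,
    s *: x = \sum_k c k *: mm k & forall k, idm ys (c k : A^o).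
Proof.
have [s sp hs] := span_basis => hx; exists s => //; move: x hx.
apply: idm_ind.
  split=> [|b x y [c ex hc] [c' ey hc']].
    exists (fun=> 0); last by move=> k; exact: (idm_sub _ ys).1.
    by rewrite scaler0 big1 // => k _; rewrite scale0r.
  exists (fun k => b * c k + c' k); last by move=> k; exact: (idm_sub _ ys).2.
  rewrite scalerDr scalerA mulrC -scalerA ex ey scaler_sumr -big_split /=.
  by apply: eq_bigr => k _; rewrite scalerDl scalerA.
move=> w x wy /=; have [a ea] := hs x; exists (fun k => w * a k).
  by rewrite scalerA mulrC -scalerA ea scaler_sumr; apply: eq_bigr => k _; rewrite scalerA.
by move=> k; apply: (@idm_mem _ A^o ys w (a k)).
Qed.

(** M is free and nonzero at p, so regularity on M gives regularity on A at p,
    read off the coordinate k0. The right-to-left order asks for the first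
    entry to be regular modulo the others, whence the rotation. *)
Lemma preg_of_mreg (k0 : 'I_r) : preg p ws.
Proof.
have gen_ (ys : seq A) : {subset ys <= p} -> mreg M [::] ys -> preg p ys.
  elim: ys => // w ys IH hys hreg.
  have ysm : {subset w :: ys <= m} by move=> y /hys/pm.
  have [hw hreg'] := mreg_rotate noeM hm um ysm hreg.
  split; last by apply: IH => // y yy; apply: hys; rewrite inE yy orbT.
  pose K : set A^o := [set a | idm ys (w *: a)].
  have hK : submod_set K.
    split=> [|c a b ha hb]; first by rewrite /K /= scaler0; exact: (idm_sub _ ys).1.
    by rewrite /K /= scalerDr scalerA mulrC -scalerA; exact: (idm_sub _ ys).2.
  have [|s sp hs] := common_den hp (noeA hK) (idm_sub A^o ys); last first.
    by exists s => // a ha; apply: hs.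
  move=> a Ka.
  have lf : linear (fun c : A^o => (c : A) *: mm k0).
    by move=> c x y; rewrite scalerDl -scalerA.
  have /hw : idm ([::] ++ ys) (w *: ((a : A) *: mm k0)).
    by rewrite scalerA; apply: (idm_map (mklin lf) Ka).
  move=> /idm_coord[s sp [c ec hc]].
  have [|s' s'p hs'] := @free_basis (fun k => s * a * (k == k0)%:R - c k).
    under eq_bigr => k _ do rewrite scalerBl.
    rewrite sumrB -ec (bigD1 k0) //= eqxx mulr1 big1 ?addr0 ?scalerA ?subrr //.
    by move=> k /negbTE ->; rewrite mulr0 scale0r.
  exists (s' * s); first exact: (prime1 hp).
  have := hs' k0; rewrite eqxx mulr1 mulrBr => /eqP; rewrite subr_eq0 => /eqP e1.
  have -> : (s' * s) *: a = s' *: (c k0 : A^o).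
    by rewrite -[LHS]/(s' * s * a) -[RHS]/(s' * c k0) -e1 mulrA.
  by apply: subZ (hc k0); exact: idm_sub.
exact: gen_.
Qed.
End FreeAtAugmentation.

Section SubHom.
Variables (A : comPzRingType) (U V : lmodType A) (S : submodClosed (hom U V)).

Lemma hom_valP (a : A) (f g : hom U V) x :
  (val (a *: f + g) : U -> V) x = a *: (val f : U -> V) x + (val g : U -> V) x.
Proof.
have -> : val (a *: f + g) = a *: val f + val g.
  exact: (linearP (\val : hom U V -> (U -> V))).
by [].
Qed.

Lemma sub_hom_lin a (h h' : subm S) x : (val (val (a *: h + h')) : U -> V) x =
  a *: (val (val h) : U -> V) x + (val (val h') : U -> V) x.
Proof.
have -> : val (a *: h + h') = a *: val h + val h'.
  exact: (linearP (\val : subm S -> hom U V)).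
exact: hom_valP.
Qed.

Lemma sub_hom_scale a (h : subm S) x :
  (val (val (a *: h)) : U -> V) x = a *: (val (val h) : U -> V) x.
Proof.
have -> : a *: h = a *: h + 0 *: h by rewrite scale0r addr0.
by rewrite sub_hom_lin -[val (val (0 *: h))]/(val (val (0 *: h))) scale0r addrC
  -[X in X + _]/((val (0 : hom U V) : U -> V) x) add0r.
Qed.
End SubHom.

Section ExtClasses.
Variables (A : comPzRingType) (N : lmodType A).

(** Ext classes are handled through the linear maps that represent them. *)
Definition ext_rep (V : lmodType A) c (xi : Ext N V c) (phi : {linear res N c -> V}) :=
  exists h : subm (cocycles N V c), (forall x, (val (val h) : res N c -> V) x = phi x) /\
    xi = quom_pi _ h.

Local Notation d := (fun n => @res_d A N n : {linear res N n.+1 -> res N n}).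

Lemma ext_rep_total (V : lmodType A) c (xi : Ext N V c) : exists phi, ext_rep xi phi.
Proof.
exists (mklin (hom_linear (val (quom_repr xi)))), (quom_repr xi).
by split=> //; rewrite quom_reprK.
Qed.

Lemma ext_rep_cocycle (V : lmodType A) c (xi : Ext N V c) phi : ext_rep xi phi ->
  cocycle d phi.
Proof.
move=> [h [hphi _]] x; rewrite -hphi.
have /submod_ofE/(congr1 val)/(congr1 (fun f => f x)) := valP h.
by [].
Qed.

Lemma ext_rep_ex (V : lmodType A) c (phi : {linear res N c -> V}) : cocycle d phi ->
  exists xi : Ext N V c, ext_rep xi phi.
Proof.
move=> co; have lf : linear phi by exact: linearP.
have hc : hom_of lf \in cocycles N V c.
  by apply/submod_ofE; apply: val_inj; apply/funext => x; exact: co.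
pose h : subm (cocycles N V c) := exist (fun x => x \in cocycles N V c) (hom_of lf) hc.
by exists (quom_pi _ h), h.
Qed.

Lemma ext_rep_lin (V : lmodType A) c a (xi xi' : Ext N V c) phi phi' :
  ext_rep xi phi -> ext_rep xi' phi' ->
  ext_rep (a *: xi + xi') (ladd (lscale a phi) phi').
Proof.
move=> [h [hphi ->]] [h' [hphi' ->]]; exists (a *: h + h'); split.
  by move=> x; rewrite -[RHS]/(a *: phi x + phi' x) -hphi -hphi'; exact: sub_hom_lin.
by rewrite linearP.
Qed.

Lemma ext_rep_scale_sub (V : lmodType A) c a (xi xi' : Ext N V c) phi phi' :
  ext_rep xi phi -> ext_rep xi' phi' ->
  ext_rep (a *: (xi - xi')) (lscale a (lsub phi phi')).
Proof.
move=> [h [hphi ->]] [h' [hphi' ->]]; exists (a *: (-1 *: h' + h)); split.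
  move=> x; rewrite sub_hom_scale sub_hom_lin hphi hphi' scaleN1r addrC.
  by [].
by rewrite linearZ linearP scaleN1r addrC.
Qed.

Lemma ext_rep0 (V : lmodType A) c (xi : Ext N V c) phi : ext_rep xi phi ->
  xi = 0 <-> coboundary d phi.
Proof.
move=> [h [hphi ->]]; split.
  move=> /quom_pi0 /(submod_ofE (preim_subproof _ _)) h0.
  have {h0} : val h \in coboundaries N V c by [].
  case: c xi phi h hphi => [|c] xi phi h hphi.
    by move=> /(submod_ofE (zero_subproof _)) h0 x; rewrite -hphi h0.
  move=> /(submod_ofE (range_subproof _))[chi _ echi].
  by exists (mklin (hom_linear chi)) => x; rewrite -hphi -echi.
move=> co; apply/quom_pi0/(submod_ofE (preim_subproof _ _)).
suff h0 : val h \in coboundaries N V c by exact: h0.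
case: c xi phi h hphi co => [|c] xi phi h hphi.
  move=> co; apply/(submod_ofE (zero_subproof _)); apply: val_inj.
  by apply/funext => x; rewrite hphi co.
case=> chi hchi; have lf : linear chi by exact: linearP.
apply/(submod_ofE (range_subproof _)); exists (hom_of lf) => //.
by apply: val_inj; apply/funext => x; rewrite hphi hchi.
Qed.

Lemma ext_rep_map (V V' : lmodType A) (g : {linear V -> V'}) c (xi : Ext N V c) phi :
  ext_rep xi phi -> ext_rep (Ext_map N g c xi) (lcomp g phi).
Proof.
move=> [h [hphi ->]]; exists (cocycles_map g h); split.
  by move=> x /=; rewrite hphi.
exact: quom_mapE.
Qed.

Lemma res_resolution : is_resolution (d : forall n, {linear res N n.+1 -> res N n})
  (@free_aug A N : {linear res N 0 -> N}).
Proof.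
split; first exact: res_proj.
- by split; [exact: res_dd|exact: res_exact].
- exact: res_aug_surj.
- exact: res_augd.
- exact: res_aug_exact.
Qed.
End ExtClasses.

(** * The length of the congruence module *)

Section CongruenceLength.
Variables (O : idomainType) (A : comPzRingType).
Hypothesis hO : is_dvr O.
Variables (eta : {rmorphism O -> A}) (lambda : {rmorphism A -> O}).
Hypothesis etaK : forall r, lambda (eta r) = r.
Local Notation p := (kerr lambda).
Local Notation hp := (aug_prime lambda).
Hypothesis noeA : noeth_mod A^o.
Variable m : ideal A.
Hypothesis hm : prime_ideal m.
Hypothesis um : forall a : A, a \notin m -> exists b, a * b = 1.
Hypothesis pm : {subset p <= m}.
Variables (M : lmodType A) (T : lmodType O) (Q : M -> T).
Hypothesis fgM : fg_module M.
Hypothesis QD : forall x y, Q (x + y) = Q x + Q y.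
Hypothesis QZ : forall (a : A) x, Q (a *: x) = lambda a *: Q x.
Hypothesis Qsurj : forall y, exists x, Q x = y.
Hypothesis Qker : forall x, Q x = 0 <->
  exists2 s : A, s \notin p & s *: x \in smulm p (submodT M).
Variable ws : seq A.
Hypothesis wsp : {subset ws <= p}.
Hypothesis reg : mreg M [::] ws.
Hypothesis gen : exists2 s : A, s \notin p & forall a : A, a \in p -> idm ws (s * a : A^o).
Variables (r : nat) (e : 'I_r -> T).
Hypothesis he : is_basis e.
Variable t : O.
Hypothesis dual : dual_family lambda t ws.
Hypothesis slot : match ws with
  | [::] => True
  | w :: _ => exists x s : A, [/\ x \in p, s \notin p & s * (w - eta t * x) \in smulm p p]
  end.
Variable I1 : set T.
Hypothesis hI1 : submod_set I1.
Hypothesis I1P : forall y, I1 y <->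
  exists2 x, y = Q x & forall a : A, a \in p -> idm ws (a *: x).

Let noeM : noeth_mod M. Proof. exact: noeth_fg noeA fgM. Qed.
Let lp (s : A) : s \notin p -> lambda s != 0.
Proof. by apply: contra => /eqP sp; apply/pE. Qed.

Lemma tfT (a : O) (y : T) : a *: y = 0 -> a = 0 \/ y = 0.
Proof.
have [->|a0] := eqVneq a 0; first by left.
move=> h; right; have [co [hco _]] := basis_coord he.
rewrite (hco y) big1 // => i _.
have /eqP : a * co i y = 0 by rewrite -[LHS]/(a *: co i y) -lin_Z h linear0.
by rewrite mulf_eq0 (negbTE a0) => /eqP ->; rewrite scale0r.
Qed.
Let tf_cancel (s : A) (y y' : T) : s \notin p -> lambda s *: y = lambda s *: y' -> y = y'.
Proof.
move=> /lp s0 /eqP; rewrite -subr_eq0 -scalerBr => /eqP/tfT[z|/eqP].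
  by rewrite z eqxx in s0.
by rewrite subr_eq0 => /eqP.
Qed.

Local Notation W := (quom (smulm p (submodT M))).
Let piW : {linear M -> W} := quom_pi (smulm p (submodT M)).
Let QW (w : W) : T := Q (quom_repr w).

Let QWpi x : QW (piW x) = Q x.
Proof.
apply/esym/eqP; rewrite -subr_eq0 -(QB QD QZ); apply/eqP/Qker.
by exists 1; [exact: hp.1|rewrite scale1r; exact: quom_repr_pi].
Qed.
Let pi_surj (w : W) : exists x, w = piW x.
Proof. by exists (quom_repr w); exact/esym/quom_reprK. Qed.
Let QWD w w' : QW (w + w') = QW w + QW w'.
Proof.
have [x ->] := pi_surj w; have [x' ->] := pi_surj w'.
by rewrite -linearD !QWpi QD.
Qed.
Let QWZ (a : A) w : QW (a *: w) = lambda a *: QW w.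
Proof. by have [x ->] := pi_surj w; rewrite -lin_Z !QWpi QZ. Qed.
Let kW : killed lambda W.
Proof.
move=> a w ap; have [x ->] := pi_surj w; rewrite -lin_Z; apply/quom_pi0.
by apply: smulm_mem ap _; apply/submod_ofE.
Qed.
Let QW0 w : QW w = 0 -> exists2 s : A, s \notin p & s *: w = 0.
Proof.
have [x ->] := pi_surj w; rewrite QWpi => /Qker[s sp h]; exists s => //.
by rewrite -lin_Z; apply/quom_pi0.
Qed.
Let QWB w w' : QW (w - w') = QW w - QW w'.
Proof.
have -> : - w' = (-1 : A) *: w' by rewrite scaleN1r.
by rewrite QWD QWZ rmorphN rmorph1 scaleN1r.
Qed.

Local Notation N := (restr lambda O^o).
Let F : nat -> lmodType A := res N.
Let d n : {linear F n.+1 -> F n} := @res_d A N n.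
Let eps : {linear F 0 -> N} := @free_aug A N.
Let hF : is_resolution d eps. Proof. exact: res_resolution. Qed.

Variable H : A -> forall n, {linear F n -> F n.+1}.
Hypothesis hH : forall w : A, w \in p -> null_homotopy d w (H w).
Variable u : F 0.
Hypothesis hu : eps u = 1 :> O.
Let z := zel H u ws.

(** Contraction by the first entry of ws is t times contraction by x. *)
Let upper (phi : {linear F (size ws) -> W}) : cocycle d phi ->
  exists y, QW (phi z) = t *: y.
Proof.
rewrite /z; case: ws dual slot wsp phi => [|w ws'] /=.
  by move=> -> _ _ phi _; exists (QW (phi u)); rewrite scale1r.
move=> _ [x [s [xp sp hs]]] wp phi co.
have fp : w \in p by apply: wp; rewrite mem_head.
have wsp' : {subset ws' <= p} by move=> y yw; apply: wp; rewrite inE yw orbT.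
have hz := zel_pbd hH u wsp'.
have := slot_congr hF kW hH co hz fp xp hs.
move=> /(congr1 QW); rewrite !QWZ rmorphM etaK -scalerA => /(tf_cancel sp) ->.
by exists (QW (phi (H x _ (zel H u ws')))).
Qed.

Let lower y : exists2 phi : {linear F (size ws) -> W}, cocycle d phi & QW (phi z) = t *: y.
Proof.
have [x <-] := Qsurj y.
have [phi co ephi] := zel_eval_lower etaK hF hH hu (piW x) kW wsp dual.
by exists phi; rewrite // /z ephi QWZ etaK QWpi.
Qed.

Let from_M (phi : {linear F (size ws) -> M}) : cocycle d phi -> I1 (Q (phi z)).
Proof.
move=> co; apply/I1P; exists (phi z) => // a ap.
exact: (zel_eval_socle hH u wsp co ap).
Qed.

Let to_M y : I1 y -> exists2 phi : {linear F (size ws) -> M}, cocycle d phi & Q (phi z) = y.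
Proof.
move=> /I1P[x -> hx].
have [phi co h] := socle_lift etaK hF hH hu noeM hm um pm wsp reg hx.
exists phi => //; apply/eqP; rewrite -subr_eq0 -(QB QD QZ); apply/eqP.
exact: (Q_idm QD QZ wsp h).
Qed.

(** If r = 0 then M/pM is torsion. Otherwise ws is regular on A at p, and
    [zel_eval_kernel] applies. *)
Let kernel (phi : {linear F (size ws) -> W}) : cocycle d phi -> QW (phi z) = 0 ->
  exists2 s : A, s \notin p & coboundary d (lscale s phi).
Proof.
move=> co /QW0[s1 s1p e0].
have [r0|rpos] := posnP r.
  have hT (y : T) : y = 0.
    have [a [-> _]] := he y; rewrite big1 // => i _.
    by have := ltn_ord i; rewrite {2}r0.
  have [|s sp hs] := common_den hp (fg_setT fgM) (submod_closed_set (smulm p (submodT M))).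
    by move=> x _; apply/Qker; exact: hT.
  exists s => //; have ew w : s *: w = 0 :> W.
    by have [x ->] := pi_surj w; rewrite -lin_Z; apply/quom_pi0; exact: hs.
  case: (size ws) phi {co e0} => [|n] phi /=; first by move=> x; exact: ew.
  by exists lnull => x /=; exact: ew.
have /choice[mm hmm] : forall k, exists x, Q x = e k by move=> k; exact: Qsurj.
have prg := preg_of_mreg etaK noeA hm um pm fgM QD QZ Qker wsp reg gen he hmm (Ordinal rpos).
have co1 : cocycle d (lscale s1 phi) by move=> x; rewrite /= co scaler0.
have [s sp cob] := zel_eval_kernel etaK hF hH hu kW wsp prg gen co1 e0.
exists (s * s1); first exact: (prime1 hp).
move: cob; case: (size ws) phi {co e0 co1} => [|n] phi /=.
  by move=> h x; rewrite -scalerA.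
by case=> chi hchi; exists chi => x; rewrite -hchi /= -scalerA.
Qed.

Local Notation Psi := (congruence_module eta lambda M (size ws)).
Local Notation Y1 := (quom (submod_of hI1)).

Let psi_of (xi : Ext N W (size ws)) : Psi :=
  quom_pi (rangem (ExtO_map eta lambda M (size ws)))
    (quom_pi (tors (ExtO eta lambda (size ws) W)) xi).

Let psi_ofP (psi : Psi) : exists xi, psi = psi_of xi.
Proof.
exists (quom_repr (quom_repr psi)); rewrite /psi_of.
by rewrite (quom_reprK (quom_repr psi : quom _)) (quom_reprK psi).
Qed.

Let map_tf (zeta : Ext N M (size ws)) :
  ExtO_map eta lambda M (size ws) (quom_pi (tors (ExtO eta lambda (size ws) M)) zeta) =
  quom_pi (tors (ExtO eta lambda (size ws) W)) (Ext_map N piW (size ws) zeta).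
Proof. exact: quom_mapE. Qed.

(** Unfolds the quotients in the definition of the congruence module. *)
Let psi0 (xi : Ext N W (size ws)) phi : ext_rep xi phi ->
  psi_of xi = 0 <-> exists2 phiM : {linear F (size ws) -> M}, cocycle d phiM &
    exists2 a : O, a != 0 & coboundary d (lscale (eta a) (lsub phi (lcomp piW phiM))).
Proof.
move=> rep.
have diff a phiM (zeta : Ext N M (size ws)) : ext_rep zeta phiM ->
    eta a *: (xi - Ext_map N piW (size ws) zeta) = 0 <->
    coboundary d (lscale (eta a) (lsub phi (lcomp piW phiM))).
  move=> repM.
  exact: (ext_rep0 (ext_rep_scale_sub (eta a) rep (ext_rep_map piW repM))).
split.
  move=> /quom_pi0/submod_ofE[y _ ey].
  set zeta := quom_repr y.
  have ez : y = quom_pi (tors (ExtO eta lambda (size ws) M)) zeta by exact/esym/quom_reprK.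
  have [phiM repM] := ext_rep_total (zeta : Ext N M (size ws)).
  exists phiM; first exact: ext_rep_cocycle repM.
  move: ey; rewrite ez map_tf => /esym/quom_piP/submod_ofE[a a0 ha].
  by exists a => //; apply/(diff _ _ _ repM).
case=> phiM coM [a a0 cob]; have [zeta repM] := ext_rep_ex coM.
have hr : quom_pi (tors (ExtO eta lambda (size ws) W)) xi
    \in rangem (ExtO_map eta lambda M (size ws)).
  apply/(submod_ofE (range_subproof _)).
  exists (quom_pi (tors (ExtO eta lambda (size ws) M)) zeta); first exact: I.
  rewrite map_tf; apply/esym/quom_piP/(submod_ofE (tors_subproof _)).
  exists a; first exact: a0.
  exact/(diff _ _ _ repM).
exact: (proj2 (quom_pi0 _ _) hr).
Qed.

Let cob_eval n (phi : {linear F n -> W}) (x : F n) : pbd lambda d x ->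
  coboundary d phi -> phi x = 0.
Proof.
by case: n phi x => [|n] phi x hx //= [chi ->]; exact: hx.
Qed.

Let zpbd : pbd lambda d z. Proof. exact: zel_pbd. Qed.

(** The classes coming from M evaluate into I1. Conversely, an element of I1 is
    the value of such a class, and the difference evaluates to 0, hence is
    torsion. *)
Let psi_I1 (xi : Ext N W (size ws)) phi : ext_rep xi phi ->
  psi_of xi = 0 <-> I1 (QW (phi z)).
Proof.
move=> rep; have co := ext_rep_cocycle rep; rewrite (psi0 rep); split.
  case=> phiM coM [a a0 cob]; have := cob_eval zpbd cob.
  move=> /(congr1 QW); rewrite /= QWZ etaK QWB QWpi.
  have -> : QW 0 = 0 by rewrite -(linear0 piW) QWpi (Q0 QZ).
  move=> /tfT[e0|/eqP]; first by rewrite e0 eqxx in a0.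
  by rewrite subr_eq0 => /eqP ->; apply: from_M.
move=> /to_M[phiM coM ephi]; exists phiM => //.
have [||s sp cob] := @kernel (lsub phi (lcomp piW phiM)).
- by move=> x; rewrite /= co coM linear0 subr0.
- by rewrite /= QWB QWpi ephi subrr.
exists (lambda s); first exact: lp.
move: cob; case: (size ws) phi phiM {rep co coM ephi} => [|n] phi phiM /=.
  by move=> h x; rewrite -(killedE etaK s _ kW).
by case=> chi hchi; exists chi => x; rewrite -hchi /= -(killedE etaK s _ kW).
Qed.

Let psi_lin a (xi xi' : Ext N W (size ws)) :
  a *: psi_of xi + psi_of xi' = psi_of (eta a *: xi + xi').
Proof.
rewrite /psi_of -linearP; congr (quom_pi _ _).
by rewrite -linearP.
Qed.

(** Evaluation at z identifies the congruence module with tT/I1, and T/tT is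
    (O/t)^r. *)
Lemma congruence_module_length l : has_length (quom (span [set t : O^o])) l ->
  exists2 n, has_length Psi n & has_length Y1 (n + r * l).
Proof.
move=> hl.
have [|||f hf] := @lin_of_rel O Psi Y1 (fun psi y => exists xi phi,
    [/\ ext_rep xi phi, psi = psi_of xi & y = quom_pi (submod_of hI1) (QW (phi z))]).
- move=> psi; have [xi ->] := psi_ofP psi; have [phi rep] := ext_rep_total xi.
  by exists (quom_pi (submod_of hI1) (QW (phi z))), xi, phi.
- move=> y [xi [phi [rep e0 ->]]]; apply/quom_pi0/submod_ofE.
  exact/(psi_I1 rep)/esym.
- move=> a _ _ _ _ [xi [phi [rep -> ->]]] [xi' [phi' [rep' -> ->]]].
  exists (eta a *: xi + xi'), (ladd (lscale (eta a) phi) phi'); split.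
  + exact: ext_rep_lin.
  + exact: psi_lin.
  + by rewrite /= QWD QWZ etaK linearP.
have f_inj psi : f psi = 0 -> psi = 0.
  have [xi ->] := psi_ofP psi; have [phi rep] := ext_rep_total xi.
  have -> : f (psi_of xi) = quom_pi (submod_of hI1) (QW (phi z)).
    by apply/hf; exists xi, phi.
  by move=> /quom_pi0/submod_ofE/(psi_I1 rep).
have htT : submod_set [set y : T | exists y', y = t *: y'].
  split=> [|a _ _ [x ->] [y ->]]; first by exists 0; rewrite scaler0.
  by exists (a *: x + y); rewrite scalerDr !scalerA mulrC.
have I1t y : I1 y -> exists y', y = t *: y'.
  move=> /to_M[phiM coM <-].
  have [|y' ey] := @upper (lcomp piW phiM); first by move=> x; rewrite /= coM linear0.
  by exists y'; rewrite -ey /= QWpi.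
have [|||q hq] := @lin_of_rel O Y1 (quom (submod_of htT)) (fun y y' =>
    exists2 v, y = quom_pi _ v & y' = quom_pi _ v).
- by move=> y; exists (quom_pi _ (quom_repr y)), (quom_repr y); rewrite ?quom_reprK.
- move=> y [v /esym/quom_pi0/submod_ofE hv ->].
  by apply/quom_pi0/submod_ofE/I1t.
- move=> a _ _ _ _ [v -> ->] [v' -> ->]; exists (a *: v + v'); by rewrite linearP.
have qE v : q (quom_pi _ v) = quom_pi _ v by apply/hq; exists v.
have fgY1 : fg_module Y1.
  exists [seq quom_pi (submod_of hI1) (e i) | i <- enum 'I_r] => y.
  rewrite -(quom_reprK y); have [a [-> _]] := he (quom_repr y).
  rewrite linear_sum; elim/big_ind: _ => [|x x' hx hx'|i _]; [exact: rpred0|exact: rpredD|].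
  rewrite lin_Z; apply: rpredZ; apply: span_gen.
  by apply: map_f; rewrite mem_enum.
have finY1 : fin_length Y1.
  have [s sp hs] := gen; apply: (dvr_torsion_length hO fgY1 (lp sp)) => y.
  rewrite -(quom_reprK y) -lin_Z; apply/quom_pi0/submod_ofE/I1P.
  have [x <-] := Qsurj (quom_repr y); exists (s *: x); first by rewrite QZ.
  move=> a ap; rewrite scalerA mulrC.
  have lf : linear (fun c : A^o => (c : A) *: x).
    by move=> c x1 x2; rewrite scalerDl -scalerA.
  exact: (idm_map (mklin lf) (hs a ap)).
have [n hn] := fin_has_length (fin_length_inj f_inj finY1).
exists n => //; apply: (length_add (i := f) (q := q)) hn _ => //.
- by move=> y; exists (quom_pi _ (quom_repr y)); rewrite qE quom_reprK.
- move=> v; rewrite -(quom_reprK v) qE; set y := quom_repr v; split.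
    move=> /quom_pi0/submod_ofE[y' ey].
    have [phi co ephi] := lower y'; have [xi rep] := ext_rep_ex co.
    exists (psi_of xi); apply/esym/hf; exists xi, phi; split=> //.
    by rewrite ephi -ey.
  case=> psi epsi; have [xi exi] := psi_ofP psi; have [phi rep] := ext_rep_total xi.
  have ef : f (psi_of xi) = quom_pi (submod_of hI1) (QW (phi z)).
    by apply/hf; exists xi, phi.
  move: epsi; rewrite exi ef => /quom_piP/submod_ofE/I1t[y1 e1].
  have [y2 e2] := upper (ext_rep_cocycle rep).
  apply/quom_pi0/submod_ofE; exists (y1 + y2).
  by rewrite scalerDr -e1 -e2 subrK.
apply: (free_quot_length (q := quom_pi (submod_of htT))
  (pi := quom_pi (span [set t : O^o])) (t := t) he) hl.
- by move=> y; exists (quom_repr y); exact: quom_reprK.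
- by move=> v; rewrite quom_pi0; exact: submod_ofE.
- by move=> y; exists (quom_repr y); exact: quom_reprK.
- move=> a; rewrite quom_pi0 span1E.
  by split=> -[c ->]; exists c; rewrite mulrC.
Qed.
End CongruenceLength.

(** * Quotients of complete local rings *)

Section KrullIntersection.
Variables (R : comPzRingType) (m : ideal R).
Hypothesis noeR : noeth_mod R^o.
Hypothesis hm : local_with m.

Lemma powid_dec k (a : R) : a \in powid m k.+1 -> a \in powid m k.
Proof. exact: smulm_subr. Qed.

(** Let N be the intersection of the powers of m, and Z a maximal submodule
    whose intersection with N lies in mN. Every element of m has a power in Z,
    so R/Z has finite length, and Z contains a power of m, hence N. So N =
    mN. *)
Lemma krull_intersection (a : R) : (forall n, a \in powid m n) -> a = 0.
Proof.
have hmp := maximal_prime hm.1; have um (b : R) := @local_unit _ noeR m b hm.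
pose N : set R^o := [set a | forall n, a \in powid m n].
have hN : submod_set N.
  split=> [n|c x y hx hy n]; first exact: ideal0.
  by apply: (submod_closed_set (powid m n)).2; [exact: hx|exact: hy].
pose mN : set R^o := [set a | (a : R^o) \in smulm m (submod_of hN)].
have hmN : submod_set mN by exact: submod_closed_set.
have [||Z [[hZ ZN] mNZ hmax]] := @noeth_max _ _ noeR
    [set Z : set R^o | submod_set Z /\ forall x, Z x -> N x -> mN x] mN.
- by move=> Z [].
- by split.
(* Enlarging Z by a stable power of x does not enlarge its intersection with N
   beyond m N. *)
have nil (x : R) : x \in m -> exists k, Z (x ^+ k).
  move=> xm; have [||k hk] := @noeth_chain _ _ noeR (fun k => [set b : R^o | Z (x ^+ k * b)]).
  - move=> k; split=> [|c y z hy hz]; first by rewrite /= mulr0; exact: hZ.1.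
    rewrite /= mulrDr -[c *: y]/(c * y) mulrCA; exact: (hZ.2 c).
  - by move=> k b hb; rewrite /= exprS -mulrA; apply: subM.
  exists k; pose Z' : set R^o := [set y | exists2 z, Z z & exists b, y = z + x ^+ k * b].
  have hZ' : submod_set Z'.
    split=> [|c _ _ [y Zy [b ->]] [y' Zy' [b' ->]]].
      by exists 0; [exact: hZ.1|exists 0; rewrite mulr0 addr0].
    exists (c *: y + y'); first exact: hZ.2.
    by exists (c * b + b'); rewrite /GRing.scale /=; ring.
  have ZZ' : Z `<=` Z' by move=> y Zy; exists y => //; exists 0; rewrite mulr0 addr0.
  have s : Z' `<=` Z.
    apply: hmax => //; split=> // _ [z Zz [b ->]] Ny.
    apply: ZN => //; apply: sub_add => //; apply: hk => /=.
    have -> : x ^+ k.+1 * b = x * (z + x ^+ k * b) - x * z by rewrite exprS; ring.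
    apply: sub_sub => //; last exact: subM.
    by apply: mNZ; apply: (smulm_mem (V := R^o) xm); apply/submod_ofE.
  by apply: s; exists 0; [exact: hZ.1|exists 1; rewrite mulr1 add0r].
have [|n0 hn0] := chain_bound noeR noeR hm.1 um hZ.
  move=> P hP hann x xm; have [k hk] := nil x xm.
  have : x ^+ k \in P by apply: hann => v; rewrite -[_ *: v]/(x ^+ k * v) mulrC; apply: subM.
  elim: k {hk} => [|k IH]; first by rewrite expr0 (negbTE hP.1).
  by rewrite exprS => /hP.2[].
have [||||k hk] := @dec_stable _ R^o Z
   (fun k => [set y | exists2 b, b \in powid m k & Z (y - b)]) n0.
- move=> k; split=> [|c x y [b hb hx] [b' hb' hy]].
    by exists 0; [exact: ideal0|rewrite subr0; exact: hZ.1].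
  exists (c * b + b'); first by apply: idealD => //; apply: idealMl.
  have -> : c *: x + y - (c * b + b') = c *: (x - b) + (y - b').
    by rewrite /GRing.scale /=; ring.
  exact: hZ.2.
- by move=> k x Zx; exists 0; [exact: ideal0|rewrite subr0].
- by move=> k x [b /powid_dec hb hx]; exists b.
- exact: hn0.
have powZ (y : R) : y \in powid m k -> Z y.
  have [|t tm ht] := @nakayama _ _ hmp R^o Z [set b | b \in powid m k] hZ
     (noeR (submod_closed_set _)).
    move=> v vk; have [b hb hv] : exists2 b, b \in powid m k.+1 & Z (v - b).
      by apply: hk; exists v => //; rewrite subrr; exact: hZ.1.
    have [S [hS cS]] := smulm_comb hb; exists 1; first exact: hmp.1.
    exists S; split=> //; rewrite scale1r -(subrK b v).
    have cZ := comb_sub S (ideal_setP m) hZ.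
    apply: (subD cZ); first exact: (@comb_base _ _ _ Z S (ideal_setP m)).
    by apply: combN cS => x ->; exact: hZ.1.
  move=> hy; have [c tc] := um t tm.
  have -> : y = c * (t * y) by rewrite mulrA [c * t]mulrC tc mul1r.
  by apply: subM => //; apply: (ht y).
have [|t tm ht] := @nakayama _ _ hmp R^o [set 0] N (@submod_set0 _ _) (noeR hN).
  move=> v Nv; exists 1; first exact: hmp.1.
  have : mN v by apply: ZN => //; apply: powZ.
  move=> /smulm_comb[S [hS cS]]; exists S; split; last by rewrite scale1r.
  by move=> x /hS/submod_ofE.
move=> ha; have [c tc] := um t tm.
have ta : t * a = 0 by apply: (ht a).
by rewrite -[a]mul1r -tc [t * c]mulrC -mulrA ta mulr0.
Qed.
End KrullIntersection.

Section SurjectiveMap.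
Variables (A B : comPzRingType) (h : {rmorphism A -> B}).
Hypothesis h_surj : forall b, exists a, h a = b.

Lemma surj_noeth : noeth_mod A^o -> noeth_mod B^o.
Proof.
move=> noeA J hJ; pose J' : set A^o := [set a | J (h a)].
have hJ' : submod_set J'.
  split=> [|c a b ha hb]; first by rewrite /J' /= rmorph0; exact: hJ.1.
  rewrite /J' /= rmorphD; apply: sub_add => //.
  by rewrite -[h (c *: a)]/(h (c * a)) rmorphM; apply: subM.
have [s hs] := noeA _ hJ'; exists (map h s) => z; split; last first.
  apply: (lc_ind hJ) => y /mapP[a ha ->].
  by have : J' a by apply/hs/lc_mem.
have [a <-] := h_surj z => Jz; have /hs : J' a by [].
have hP : submod_set [set b : A^o | @lc _ B^o (map h s) (h b)].
  split=> [|c b b' hb hb']; first by rewrite /= rmorph0; exact: (lc_sub _).1.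
  rewrite /= rmorphD; apply: sub_add => //; first exact: lc_sub.
  by rewrite -[h (c *: b)]/(h (c * b)) rmorphM; apply: subM => //; exact: lc_sub.
apply: (lc_ind hP) => b bs /=; exact/lc_mem/map_f.
Qed.

Section Image.
Variable I : ideal A.
Hypothesis kerI : forall a : A, h a = 0 -> a \in I.

Lemma image_ideal_sub : submod_set [set b : B^o | exists2 a : A, a \in I & b = h a].
Proof.
split=> [|c _ _ [a aI ->] [b bI ->]]; first by exists 0; [exact: ideal0|rewrite rmorph0].
have [d <-] := h_surj c; exists (d * a + b); last by rewrite rmorphD rmorphM.
by apply: idealD => //; apply: idealMl.
Qed.
Definition image_ideal : ideal B := submod_of image_ideal_sub.

Lemma image_idealP (b : B) : b \in image_ideal <-> exists2 a : A, a \in I & b = h a.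
Proof. exact: (submod_ofE image_ideal_sub). Qed.
Lemma mem_image_ideal (a : A) : h a \in image_ideal <-> a \in I.
Proof.
split=> [/image_idealP[b bI e]|aI]; last by apply/image_idealP; exists a.
rewrite -(subrK b a); apply: idealD => //; apply: kerI.
by rewrite rmorphB e subrr.
Qed.
End Image.

Section Local.
Variable m : ideal A.
Hypothesis noeA : noeth_mod A^o.
Hypothesis hm : local_with m.
Hypothesis kerm : forall a : A, h a = 0 -> a \in m.

Lemma image_local : local_with (image_ideal m).
Proof.
apply: local_criterion.
  by rewrite -(rmorph1 h); apply/negP => /(mem_image_ideal kerm); apply/negP/(hm.1).1.
move=> b; have [a <-] := h_surj b => am.
have [|c ac] := @local_unit _ noeA m a hm.
  by apply: contra am => /(mem_image_ideal kerm).
by exists (h c); rewrite -rmorphM ac rmorph1.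
Qed.

Lemma image_powid n (b : B) : b \in powid (image_ideal m) n <->
  exists2 a : A, a \in powid m n & b = h a.
Proof.
elim: n b => [|n IH] b.
  split=> _; last exact: (proj2 (submod_ofE (full_subproof B^o) _) I).
  have [a <-] := h_surj b; exists a => //.
  exact: (proj2 (submod_ofE (full_subproof A^o) _) I).
split.
  move: b; apply: (@smulm_ind _ B^o); first exact: image_ideal_sub.
  move=> c x /image_idealP[a am ->] /IH[b bm ->]; exists (a * b); last by rewrite rmorphM.
  exact: (smulm_mem (V := A^o) am bm).
case=> a am ->; move: a am.
have hP : submod_set [set a : A^o | h a \in powid (image_ideal m) n.+1].
  split=> [|c u u' hu hu']; first by rewrite /= rmorph0 ideal0.
  rewrite /= rmorphD; apply: idealD => //.
  by rewrite -[h (c *: u)]/(h (c * u)) rmorphM; apply: idealMl.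
apply: (smulm_ind hP) => a x am xm /=.
rewrite -[h (a *: x)]/(h (a * x)) rmorphM.
apply: (smulm_mem (V := B^o)); first by apply/image_idealP; exists a.
by apply/IH; exists x.
Qed.

(** Cauchy sequences are lifted term by term; uniqueness of the limit is
    Krull's intersection theorem. *)
Lemma image_complete : adic_complete m -> adic_complete (image_ideal m).
Proof.
move=> comp y hy.
have step n (a : A) : h a = y n -> exists2 a', h a' = y n.+1 & a' - a \in powid m n.
  move=> ea; have /image_powid[c cm ec] := hy n.
  by exists (a + c); [rewrite rmorphD ea -ec addrC subrK|rewrite addrC addKr].
have [a0 ea0] := h_surj (y 0%N).
have [//|n a ea|x [_ hx]] := @dep_choice (fun=> A) a0 (fun n a => h a = y n)
   (fun n a a' => a' - a \in powid m n /\ h a = y n).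
  by have [a' e1 e2] := step n a ea; exists a'.
have [z [hz _]] := comp x (fun n => (hx n).1).
exists (h z); split=> [n|z' hz'].
  apply/image_powid; exists (z - x n) => //.
  by rewrite rmorphB (hx n).2.
apply/eqP; rewrite -subr_eq0; apply/eqP.
apply: (krull_intersection (surj_noeth noeA) image_local) => n.
have -> : h z - z' = (h z - y n) - (z' - y n) by rewrite opprB addrA subrK.
apply: idealB; last exact: hz'.
apply/image_powid; exists (z - x n) => //.
by rewrite rmorphB (hx n).2.
Qed.
End Local.
End SurjectiveMap.

Section RegularLocalization.
Variables (A S : comPzRingType) (j : {rmorphism A -> S}) (p : ideal A) (I : set A).
Hypothesis noeA : noeth_mod A^o.
Hypothesis hp : prime_ideal p.
Hypothesis loc : is_loc j p I.
Hypothesis Ip : I `<=` [set a | a \in p].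

Lemma pch_contr n (P Q : ideal S) : pch n P Q -> prime_ideal P ->
  pch n (contr_ideal j P) (contr_ideal j Q).
Proof.
elim: n Q => [|n IH] Q [hQ].
  move=> e hP; split; first exact: contr_prime.
  by move=> a; apply/idP/idP => /contrP h; apply/contrP; rewrite ?e // -e.
case=> Q' c [l1 l2] hP; split; first exact: contr_prime.
exists (contr_ideal j Q'); first exact: IH.
split; first by move=> a /contrP/l1 h; apply/contrP.
by move=> h; apply: l2; apply: (contr_subset loc h).
Qed.

Lemma pch_ext n (P Q : ideal A) : pch n P Q -> prime_ideal P ->
  I `<=` [set a | a \in P] -> {subset Q <= p} ->
  pch n (ext_ideal hp loc P) (ext_ideal hp loc Q).
Proof.
move=> c hP IP; elim: n Q c => [|n IH] Q [hQ].
  move=> e Qp; have IQ : I `<=` [set a | a \in Q] by move=> a /IP; rewrite /= e.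
  split; first exact: ext_prime.
  move=> z; apply/idP/idP.
    move=> /(ext_idealP hp loc P z)[a [s [aP sp ez]]].
    by apply/(ext_idealP hp loc Q z); exists a, s; rewrite -e.
  move=> /(ext_idealP hp loc Q z)[a [s [aP sp ez]]].
  by apply/(ext_idealP hp loc P z); exists a, s; rewrite e.
case=> Q' c [l1 l2] Qp.
have IQ' : I `<=` [set a | a \in Q'] by move=> a /IP; apply: (pch_le c).
have IQ : I `<=` [set a | a \in Q] by move=> a /IQ'/l1.
have Q'p : {subset Q' <= p} by move=> a /l1/Qp.
split; first exact: ext_prime.
exists (ext_ideal hp loc Q'); first exact: IH.
split.
  move=> z /(ext_idealP hp loc Q' z)[a [s [aP sp ez]]].
  by apply/(ext_idealP hp loc Q z); exists a, s; split=> //; apply: l1.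
move=> h; apply: l2 => a aQ.
by apply/(mem_ext hp loc a (pch_prime c) IQ' Q'p)/h/(mem_ext hp loc a hQ IQ Qp).
Qed.

(** Chains of primes of S are chains of primes of A between I and p, so
    [height_le] bounds the dimension by the number of generators of the maximal
    ideal. *)
Lemma regular_loc (xs ws : seq A) (s : A) (P Q : ideal A) : s \notin p ->
  (forall x, x \in xs -> I x) -> {subset ws <= p} ->
  (forall a : A, a \in p -> exists2 b : A, I b & idm ws (s * a - b : A^o)) ->
  (forall a : A, a \in p -> idm (xs ++ ws) (s * a : A^o)) ->
  pch (size ws) P Q -> prime_ideal P -> I `<=` [set a | a \in P] -> {subset Q <= p} ->
  regular_local S (size ws).
Proof.
move=> sp xsI wsp hs1 hs2 c hP IP Qp; split.
- exact/noetherianI/(loc_noeth loc).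
- split.
    apply/prime_chainP; exists (ext_ideal hp loc P), (ext_ideal hp loc Q).
    exact: pch_ext.
  move=> n /prime_chainP[P' [Q' c']].
  have hQ' := pch_prime c'.
  have hP' := pch_prime_bot c'.
  apply: (height_le noeA hp sp hs2 wsp _ (contr_prime j hP') (pch_contr c' hP')).
    by move=> x /xsI Ix; apply: (contr_base hp loc).
  exact: (contr_le loc hQ').
- exists (ext_ideal hp loc p); first exact: loc_local.
  apply: loc_generators => //.
  by exists s.
Qed.
End RegularLocalization.

(** * Depth and the choice of a regular sequence *)

Lemma lc_map (R : comPzRingType) (U V : lmodType R) (f : {linear U -> V}) s x :
  lc s x -> lc (map f s) (f x).
Proof.
move: x; apply: lc_ind; first exact/preim_sub/lc_sub.
by move=> v vs /=; apply/lc_mem/map_f.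
Qed.

Lemma fg_surj (R : comPzRingType) (U V : lmodType R) (f : {linear U -> V}) :
  (forall v, exists u, f u = v) -> fg_module U -> fg_module V.
Proof.
move=> fs [s hs]; exists (map f s) => v; apply/span_lc.
by have [x <-] := fs v; apply: lc_map; apply/span_lc.
Qed.

Section ModList.
Variables (A : comPzRingType) (M : lmodType A).

Definition modl (xs : seq A) : lmodType A := quom (submod_of (idm_sub M xs)).
Definition modl_pi (xs : seq A) : {linear M -> modl xs} := quom_pi (submod_of (idm_sub M xs)).

Lemma modl_pi0 xs x : modl_pi xs x = 0 <-> idm xs x.
Proof. by rewrite quom_pi0; exact: submod_ofE. Qed.
Lemma modl_surj xs (y : modl xs) : exists x, modl_pi xs x = y.
Proof. by exists (quom_repr y); exact: quom_reprK. Qed.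

Lemma modl_map xs w : exists q : {linear modl xs -> modl (w :: xs)},
  forall x, q (modl_pi xs x) = modl_pi (w :: xs) x.
Proof.
have [|||q hq] := @lin_of_rel A (modl xs) (modl (w :: xs))
  (fun y y' => exists2 x, y = modl_pi xs x & y' = modl_pi (w :: xs) x).
- by move=> y; have [x <-] := modl_surj y; exists (modl_pi (w :: xs) x), x.
- move=> y [x /esym/modl_pi0 hx ->]; apply/modl_pi0; exists 0.
  by rewrite scaler0 subr0.
- by move=> a _ _ _ _ [x -> ->] [x' -> ->]; exists (a *: x + x'); rewrite linearP.
by exists q => x; apply/hq; exists x.
Qed.

Section Vanishing.
Variables (N : lmodType A) (F : nat -> lmodType A).
Variables (d : forall n, {linear F n.+1 -> F n}) (eps : {linear F 0 -> N}).
Hypothesis hF : is_resolution d eps.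
Variables (xs : seq A) (w : A).
Hypothesis wN : forall v : N, w *: v = 0.
Hypothesis regw : forall x : M, idm xs (w *: x) -> idm xs x.

Let nz : nzdiv w (modl xs).
Proof.
move=> y; have [x <-] := modl_surj y.
by rewrite -lin_Z => /modl_pi0/regw hx; apply/modl_pi0.
Qed.
Let ker (q : {linear modl xs -> modl (w :: xs)}) :
  (forall x, q (modl_pi xs x) = modl_pi (w :: xs) x) ->
  forall v, q v = 0 <-> exists v', v = w *: v'.
Proof.
move=> hq v; have [x <-] := modl_surj v; rewrite hq; split.
  move=> /modl_pi0[x' hx']; exists (modl_pi xs x').
  by apply/eqP; rewrite -subr_eq0 -lin_Z -linearB; apply/eqP/modl_pi0.
case=> v'; have [x' <-] := modl_surj v' => e; apply/modl_pi0; exists x'.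
by apply/modl_pi0; rewrite linearB lin_Z e subrr.
Qed.
Let qsurj (q : {linear modl xs -> modl (w :: xs)}) :
  (forall x, q (modl_pi xs x) = modl_pi (w :: xs) x) ->
  forall v', exists v, q v = v'.
Proof.
by move=> hq v'; have [x <-] := modl_surj v'; exists (modl_pi xs x).
Qed.

Lemma modl_vanish0 : ext_vanish d (modl xs) 0.
Proof. exact: (ext_vanish0 hF wN nz). Qed.
Lemma modl_vanish_up n : ext_vanish d (modl (w :: xs)) n -> ext_vanish d (modl xs) n.+1.
Proof.
have [q hq] := modl_map xs w.
exact: (ext_vanish_up hF wN nz (qsurj hq) (ker hq)).
Qed.
Lemma modl_vanish_down n : ext_vanish d (modl xs) n -> ext_vanish d (modl xs) n.+1 ->
  ext_vanish d (modl (w :: xs)) n.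
Proof.
have [q hq] := modl_map xs w.
exact: (ext_vanish_down hF nz (qsurj hq) (ker hq)).
Qed.
End Vanishing.

Section Depth.
Variables (N : lmodType A) (F : nat -> lmodType A).
Variables (d : forall n, {linear F n.+1 -> F n}) (eps : {linear F 0 -> N}).
Hypothesis hF : is_resolution d eps.
Variable m : ideal A.
Hypothesis hm : local_with m.
Hypothesis mN : forall a (v : N), a \in m -> a *: v = 0.

Fixpoint prefix (x : nat -> A) i : seq A := if i is i'.+1 then x i' :: prefix x i' else [::].

Lemma mem_prefix x i y : y \in prefix x i <-> exists2 j, (j < i)%N & y = x j.
Proof.
elim: i => [|i IH] /=; first by split=> [|[]].
rewrite inE; split=> [/orP[/eqP->|/(proj1 IH)[j lt ->]]|[j]].
- by exists i.
- by exists j => //; exact: ltnW.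
rewrite ltnS leq_eqVlt => /orP[/eqP-> ->|lt ey]; first by rewrite eqxx.
by apply/orP; right; apply/IH; exists j.
Qed.

(** For a regular sequence x of length c + 1 in m, the shift [modl_vanish_up]
    shows by induction on i that Ext^i(N, M/(x_0, ..., x_(k-1))M) vanishes as
    long as i + k <= c. *)
Lemma depth_vanish c : depth_ge M c.+1 -> forall i, (i <= c)%N -> ext_vanish d (modl [::]) i.
Proof.
case=> m' hm' [M0|[x xm [xreg _]]].
  have V0 (v : modl [::]) : v = 0.
    by have [y <-] := modl_surj v; rewrite (M0 y) linear0.
  move=> [|i] _ phi _ /=; first by move=> y; exact: V0.
  by exists lnull => y; rewrite [LHS]V0.
have reg i : (i < c.+1)%N -> forall v : M, idm (prefix x i) (x i *: v) -> idm (prefix x i) v.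
  move=> lt v hv; have hI : span [set (x j : A^o) | j in [set j | (j < i)%N]]
      =i span [set y : A^o | y \in prefix x i].
    move=> a; congr (_ \in span _); apply/seteqP; split=> y /=.
      by case=> j lt' <-; apply/mem_prefix; exists j.
    by move=> /mem_prefix[j lt' ->]; exists j.
  have := xreg i lt (quom_pi _ v); rewrite -lin_Z => h.
  have /h/quom_pi0/(smulm_idm v hI) // : quom_pi (smulm (span [set (x j : A^o) |
     j in [set j | (j < i)%N]]) (submodT M)) (x i *: v) = 0.
  by apply/quom_pi0/(smulm_idm _ hI).
have xmm i : (i < c.+1)%N -> x i \in m by move=> /xm; rewrite (hm.2 m' hm'.1).
have key i : forall k, (i + k <= c)%N -> ext_vanish d (modl (prefix x k)) i.
  elim: i => [|i IH] k le.
    have lt : (k < c.+1)%N by [].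
    apply: (modl_vanish0 hF (w := x k)); last exact: reg.
    by move=> v; apply/mN/xmm.
  have lt : (k < c.+1)%N.
    by rewrite ltnS; apply: leq_trans le; rewrite addSn leqW // leq_addl.
  apply: (modl_vanish_up hF (w := x k)); [by move=> v; apply/mN/xmm|exact: reg|].
  by apply: (IH k.+1); rewrite addnS -addSn.
by move=> i le; apply: (key i 0%N); rewrite addn0.
Qed.
End Depth.
End ModList.

Section Choice.
Variables (O : idomainType) (A : comPzRingType).
Hypothesis hO : is_dvr O.
Variables (eta : {rmorphism O -> A}) (lambda : {rmorphism A -> O}).
Hypothesis etaK : forall r, lambda (eta r) = r.
Local Notation p := (kerr lambda).
Local Notation hp := (aug_prime lambda).
Hypothesis noeA : noeth_mod A^o.
Variable m : ideal A.
Hypothesis hm : local_with m.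
Let hmp : prime_ideal m. Proof. exact: maximal_prime hm.1. Qed.
Let um (a : A) : a \notin m -> exists b, a * b = 1.
Proof. exact: local_unit. Qed.

Lemma p_sub_m : {subset p <= m}.
Proof.
have [Q hQ pQ] : exists2 Q, maximal_ideal Q & forall a : A, a \in p -> a \in Q.
  apply: (max_ideal_ex noeA (submod_closed_set p)).
  by move=> h; have := hp.1; rewrite /= in h; rewrite h.
by move=> a /pQ; rewrite (hm.2 Q hQ).
Qed.

Local Notation kk := (quom m).
Variables (F : nat -> lmodType A).
Variables (d : forall n, {linear F n.+1 -> F n}) (eps : {linear F 0 -> kk}).
Hypothesis hF : is_resolution d eps.

(** If v is killed by p, then a |-> (lambda a / w) v is a map m -> V, where w
    is a uniformizer of O. As Ext^1(k, V) = 0 it extends to A, so the p-torsion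
    of V is divisible by w, and vanishes by Nakayama's lemma. *)
Lemma vanish_socle (V : lmodType A) : noeth_mod V -> ext_vanish d V 1 ->
  forall v : V, (forall a : A, a \in p -> a *: v = 0) -> v = 0.
Proof.
move=> noeV hV; have [mO [w [hmO uO w0 mOw _]]] := dvr_uniformizer hO.
have [projF [dd _] epss epsd epsx] := hF.
have lm (a : A) : a \in m -> exists c, lambda a = c * w.
  move=> am; apply/mOw/negPn/negP => /uO[b ab].
  have : 1 \in m.
    rewrite -(subrK (a * eta b) 1); apply: idealD; last exact: idealMr.
    by apply/p_sub_m/pE; rewrite rmorphB rmorphM etaK ab rmorph1 subrr.
  by rewrite (negbTE hmp.1).
have eO (a : O) : a \notin mO -> eta a \notin m.
  move=> /uO[b ab]; apply/negP => am; move/negP: hmp.1; apply.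
  by rewrite -(rmorph1 eta) -ab rmorphM; apply: idealMr.
have wm : eta w \in m.
  apply/negPn/negP => /um[b wb].
  have : 1 \in mO by apply/mOw; exists (lambda b); rewrite -(rmorph1 lambda) -wb rmorphM etaK mulrC.
  by rewrite (negbTE hmO.1).
have [|rho hrho] := proj_lift (g := quom_pi m) (f := eps) (@projF 0%N).
  by move=> x; exists (quom_repr (eps x)); rewrite [RHS](quom_reprK (eps x)).
(* rho, a lift of eps, takes values in m on boundaries; dividing lambda by w
   there gives q, and q v is the cocycle. *)
have [u hu] := epss (quom_pi m (1 : A^o)).
have rm (x : F 1) : rho (d 0%N x) \in m by apply/quom_pi0; rewrite -hrho epsd.
have /choice[q hq] : forall x : F 1, exists c, lambda (rho (d 0%N x)) = c * w.
  by move=> x; apply: lm.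
have q_uni (x : F 1) c : lambda (rho (d 0%N x)) = c * w -> q x = c.
  by move=> e; apply: (mulIf w0); rewrite -hq.
have rhou : lambda (rho u) \notin mO.
  have /lm[c ec] : rho u - 1 \in m.
    by apply/quom_pi0; rewrite linearB -hrho hu subrr.
  apply/negP => /mOw[c' ec']; have : 1 \in mO.
    apply/mOw; exists (c' - c); rewrite mulrBl -ec' -ec rmorphB rmorph1.
    by rewrite opprB addrC subrK.
  by rewrite (negbTE hmO.1).
pose K : set V := [set v | forall a : A, a \in p -> a *: v = 0].
have hK : submod_set K.
  split=> [a _|b x y hx hy a ap]; first by rewrite scaler0.
  by rewrite scalerDr scalerA mulrC -scalerA hx // hy // scaler0 addr0.
have [|t tm ht] := @nakayama _ _ hmp V [set 0] K (@submod_set0 _ _) (noeV _ hK).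
  move=> v Kv; exists (eta (lambda (rho u))); first exact: eO.
  have Kl a : a *: v = eta (lambda a) *: v.
    by apply/eqP; rewrite -subr_eq0 -scalerBl Kv //; exact: p_sub.
  have lphi : linear (fun x : F 1 => eta (q x) *: v).
    move=> a x y; rewrite (q_uni (a *: x + y) (lambda a * q x + q y)).
      by rewrite rmorphD rmorphM scalerDl !scalerA [a * _]mulrC -!scalerA (Kl a) !scalerA mulrC.
    rewrite !linearP /= -[a *: rho _ + _]/(a * rho (d 0%N x) + rho (d 0%N y)).
    by rewrite rmorphD rmorphM !hq mulrDl mulrA.
  have [|chi hchi] := hV (mklin lphi).
    move=> x /=; rewrite (q_uni _ 0) ?rmorph0 ?scale0r //.
    by rewrite dd linear0 rmorph0 mul0r.
  have chiu (a : A) c : a \in m -> lambda a * lambda (rho u) = c * w ->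
      a *: chi u = eta c *: v.
    move=> am ec; have [x ex] : exists x, a *: u = d 0%N x.
      apply: epsx; rewrite lin_Z hu -lin_Z; apply/quom_pi0.
      by rewrite -[a *: _]/(a * 1) mulr1.
    rewrite -lin_Z ex -hchi /= (q_uni _ c) // -ex lin_Z.
    by rewrite -[a *: rho u]/(a * rho u) rmorphM.
  exists [:: chi u]; split.
    move=> y; rewrite inE => /eqP -> a ap.
    rewrite (chiu a 0) ?rmorph0 ?scale0r //; first exact: p_sub_m.
    by rewrite (proj1 (pE lambda a) ap) !mul0r.
  exists (eta w); first exact: wm.
  by rewrite /= (chiu (eta w) (lambda (rho u))) ?subrr // etaK mulrC.
move=> v Kv; have [b tb] := um tm.
by rewrite -[v]scale1r -tb mulrC -scalerA (ht v Kv) scaler0.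
Qed.

Variable M : lmodType A.
Hypothesis fgM : fg_module M.

(** Each entry of vs is corrected by an element of p^2 to become regular on the
    current quotient of M, none of whose nonzero elements is killed by p
    ([vanish_socle]). The vanishing of Ext is then inherited by the next
    quotient. *)
Lemma choose_sequence (vs xs : seq A) : {subset vs <= p} ->
  (forall k, (k <= size vs)%N -> ext_vanish d (modl M xs) k) ->
  exists ys : seq A, [/\ size ys = size vs, {subset ys <= p}, mreg M xs ys &
    forall i, nth 0 ys i - nth 0 vs i \in smulm p p].
Proof.
elim: vs xs => [|v vs IH] xs hvs hV.
  by exists [::]; split=> // i; rewrite !nth_nil subrr ideal0.
have noeV : noeth_mod (modl M xs).
  by apply: (noeth_fg noeA); apply: (fg_surj (f := modl_pi M xs)) => // y; exact: modl_surj.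
have soc := vanish_socle noeV (hV 1%N isT).
have [|u uJ nz] := @regular_coset A noeA (modl M xs) p [set a | (a : A^o) \in smulm p p] v
    noeV (submod_closed_set _) _ soc.
  by move=> a ap; apply: (smulm_mem (V := A^o) ap).
set y := v + u in nz.
have up : u \in p by apply: smulm_subr uJ.
have yp : y \in p by apply: idealD => //; apply: hvs; rewrite mem_head.
have regy (x : M) : idm xs (y *: x) -> idm xs x.
  by move=> /modl_pi0; rewrite lin_Z => /nz/modl_pi0.
have yk (z : kk) : y *: z = 0.
  rewrite -[z]quom_reprK -lin_Z; apply/quom_pi0.
  by apply: (idealMr (quom_repr z)); apply: p_sub_m.
have [||ys [s1 s2 s3 s4]] := IH (y :: xs).
- by move=> z zv; apply: hvs; rewrite inE zv orbT.
- move=> k le; apply: (modl_vanish_down hF regy); apply: hV => //=.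
  exact: leqW.
exists (y :: ys); split=> /=.
- by rewrite s1.
- by move=> z; rewrite inE => /orP[/eqP ->|/s2].
- by split.
- by case=> [|i] //=; rewrite /y addrC addKr.
Qed.
End Choice.

(** * The torsion-free quotient of the cotangent module *)

Lemma tors_pi0 (O : idomainType) (U : lmodType O) (x : U) :
  quom_pi (tors U) x = 0 <-> exists2 r : O, r != 0 & r *: x = 0.
Proof. by rewrite quom_pi0; exact: (submod_ofE (tors_subproof U)). Qed.

Lemma tf_torsion_free (O : idomainType) (U : lmodType O) (r : O) (y : tf U) :
  r *: y = 0 -> r = 0 \/ y = 0.
Proof.
have [->|r0] := eqVneq r 0; first by left.
rewrite -[y]quom_reprK -lin_Z => /tors_pi0[s s0 h]; right; apply/tors_pi0.
by exists (s * r); [exact: mulf_neq0|rewrite -scalerA].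
Qed.

Lemma local_unique (A : comPzRingType) (m m' : ideal A) : local_with m -> local_with m' -> m =i m'.
Proof. by move=> [h _] [_ h']; exact: h'. Qed.

Lemma span_range (R : comPzRingType) (V : lmodType R) n (e : 'I_n -> V) x :
  x \in span (range e) -> exists g : 'I_n -> R, x = \sum_k g k *: e k.
Proof.
move=> h; apply: (span_sub (P := [set x | exists g : 'I_n -> R, x = \sum_k g k *: e k]) _ _ h).
  split=> [|a y z [g ->] [g' ->]]; first by exists (fun=> 0); rewrite big1 // => k _; rewrite scale0r.
  exists (fun k => a * g k + g' k); rewrite scaler_sumr -big_split; apply: eq_bigr => k _.
  by rewrite scalerDl scalerA.
move=> _ [k _ <-]; exists (fun k' => (k' == k)%:R); rewrite (bigD1 k) //= eqxx scale1r big1 ?addr0 // => l.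
by move=> /negbTE ->; rewrite scale0r.
Qed.

Section Cotangent.
Variables (O : idomainType) (A : comPzRingType).
Hypothesis hO : is_dvr O.
Variables (eta : {rmorphism O -> A}) (lambda : {rmorphism A -> O}).
Hypothesis etaK : forall r, lambda (eta r) = r.
Local Notation p := (kerr lambda).
Local Notation hp := (aug_prime lambda).
Local Notation Lam := (cotangent eta lambda).

Lemma eta_notin (r : O) : r != 0 -> eta r \notin p.
Proof. by apply: contra => /pE; rewrite etaK => ->. Qed.
Lemma lambda_neq0 (s : A) : s \notin p -> lambda s != 0.
Proof. by apply: contra => /eqP sp; apply/pE. Qed.

(** The class of a in p/p^2, extended by 0 outside p so that it is a function
    on A. *)
Definition cot (a : A) : Lam :=
  quom_pi (preimm (\val : subm p -> A^o) (smulm p p)) (insubd (0 : subm p) (a : A^o)).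

Lemma val_insub (a : A) : a \in p -> val (insubd (0 : subm p) (a : A^o)) = a.
Proof. by move=> ap; apply: (insubdK (0 : subm p)). Qed.

Lemma cot0 (a : A) : a \in p -> cot a = 0 <-> (a : A^o) \in smulm p p.
Proof.
move=> ap; rewrite quom_pi0 -{2}(val_insub ap).
exact: (submod_ofE (preim_subproof _ _)).
Qed.

Lemma cotD (a b : A) : a \in p -> b \in p -> cot (a + b) = cot a + cot b.
Proof.
move=> ap bp; rewrite /cot -[RHS](raddfD (quom_pi _)); congr (quom_pi _ _).
by apply: val_inj; rewrite [RHS]/= !val_insub //; exact: idealD.
Qed.

(** a - eta (lambda a) lies in p, so a b and eta (lambda a) b have the same
    class. *)
Lemma cotZ (a b : A) : b \in p -> cot (a * b) = lambda a *: cot b.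
Proof.
move=> bp; have -> : lambda a *: cot b = cot (eta (lambda a) * b).
  rewrite /cot -[LHS]/(eta (lambda a) *: quom_pi _ _) -lin_Z; congr (quom_pi _ _).
  by apply: val_inj; rewrite [LHS]/= !val_insub //; exact: idealMl.
have ap (x : A) : x * b \in p by exact: idealMl.
apply/eqP; rewrite -subr_eq0; apply/eqP.
have -> : cot (a * b) - cot (eta (lambda a) * b) = cot ((a - eta (lambda a)) * b).
  rewrite mulrBl; apply/eqP; rewrite subr_eq -cotD ?subrK //.
  by rewrite -mulrBl.
by apply/cot0 => //; apply: (smulm_mem (V := A^o) (p_sub etaK a) bp).
Qed.

Lemma cot_surj (y : Lam) : exists2 a : A, a \in p & cot a = y.
Proof.
exists (val (quom_repr y)); first exact: valP.
by rewrite /cot -[RHS](quom_reprK y) valKd.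
Qed.

Definition cotf (a : A) : tf Lam := quom_pi (tors Lam) (cot a).

Lemma cotfD (a b : A) : a \in p -> b \in p -> cotf (a + b) = cotf a + cotf b.
Proof. by move=> ap bp; rewrite /cotf cotD // raddfD. Qed.
Lemma cotfZ (a b : A) : b \in p -> cotf (a * b) = lambda a *: cotf b.
Proof. by move=> bp; rewrite /cotf cotZ // lin_Z. Qed.

(** A nonzero r in O acts through eta r, which is outside p; an s outside p
    acts through lambda s, which is nonzero. *)
Lemma cot_tors (a : A) : a \in p -> (exists2 r : O, r != 0 & r *: cot a = 0) <->
  exists2 s : A, s \notin p & (s * a : A^o) \in smulm p p.
Proof.
move=> ap; split=> [[r r0 h]|[s sp h]].
  exists (eta r); first exact: eta_notin.
  apply/cot0; first exact: idealMl.
  by rewrite cotZ // etaK.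
exists (lambda s); first exact: lambda_neq0.
by rewrite -cotZ //; apply/cot0 => //; exact: idealMl.
Qed.

Lemma cotf0 (a : A) : a \in p -> cotf a = 0 <->
  exists2 s : A, s \notin p & (s * a : A^o) \in smulm p p.
Proof. by move=> ap; rewrite -cot_tors //; exact: tors_pi0. Qed.

Hypothesis noeA : noeth_mod A^o.

Lemma cot_fg : fg_module Lam.
Proof.
have [s hs] := noeA (submod_closed_set p).
exists [seq cot a | a <- s] => y; apply/span_lc.
have [a ap <-] := cot_surj y.
suff h : a \in p /\ lc [seq cot a | a <- s] (cot a) by exact: h.2.
have sp (x : A) : x \in s -> x \in p by move=> xs; apply: (proj2 (hs x)); exact: lc_mem.
have := proj1 (hs a) ap; move: {ap} a.
apply: (lc_ind (s := s) (P := [set a : A^o | a \in p /\ lc [seq cot a | a <- s] (cot a)])).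
  split=> [|b x y' [xp hx] [yp hy]].
    by split; [exact: ideal0|rewrite (proj2 (cot0 (ideal0 _))) ?rpred0 //; exact: (lc_sub _).1].
  split; first by apply: idealD => //; exact: idealMl.
  by rewrite cotD ?cotZ //; [exact: (lc_sub _).2|exact: idealMl].
by move=> x xs /=; split; [exact: sp|exact: (lc_mem (map_f cot xs))].
Qed.

Lemma tf_fg : fg_module (tf Lam).
Proof.
apply: (fg_surj (f := quom_pi (tors Lam))) cot_fg => y.
by exists (quom_repr y); exact: quom_reprK.
Qed.

Lemma symb_squareP (f : A) : (exists2 s : A, s \notin p & (s * f : A^o) \in smulm p p) ->
  symb_square hp f.
Proof.
case=> s sp h; have [_ _ /(_ s sp)[z hz]] := loc_ring_at hp.
rewrite /symb_square /=.
have -> : (locr_of (prime_compl hp) f : (ring_at hp)^o) =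
    z *: (loc_map hp (s * f) : (ring_at hp)^o).
  rewrite -[RHS]/(z * loc_map hp (s * f)) rmorphM mulrA [z * _]mulrC hz mul1r.
  by [].
apply: rpredZ; apply/submod_ofE => S; apply.
by exists (s * f).
Qed.

(** The v i lift a basis of the torsion-free quotient of p/p^2, and the xi i
    are its coordinates. *)
Definition cotangent_basis n (v : 'I_n -> A) (xi : 'I_n -> A -> O) :=
  [/\ forall i, v i \in p, forall i, plin lambda (xi i),
      forall i j, xi i (v j) = (i == j)%:R &
      forall a : A, a \in p -> (forall i, xi i a = 0) ->
        exists2 s : A, s \notin p & (s * a : A^o) \in smulm p p].

Lemma cotangent_basis_ex (f : A) : f \in p -> ~ symb_square hp f ->
  exists n (v : 'I_n.+1 -> A) xi (t : O), [/\ cotangent_basis v xi, t != 0,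
    xi ord0 f = t & exists2 s : A, s \notin p & s * (f - eta t * v ord0) \in smulm p p].
Proof.
move=> fp f2; have f0 : cotf f <> 0 by move=> /(cotf0 fp)/symb_squareP.
have [n [e [t [he ef]]]] := tf_basis_adapted hO (@tf_torsion_free O Lam) tf_fg f0.
have [co [hco hce]] := basis_coord he.
have /choice[v hv] : forall i, exists a : A, a \in p /\ cotf a = e i.
  move=> i; have [a ap ea] := cot_surj (quom_repr (e i)).
  by exists a; split=> //; rewrite /cotf ea quom_reprK.
have t0 : t != 0 by apply/eqP => t0; apply: f0; rewrite ef t0 scale0r.
exists n, v, (fun i a => co i (cotf a)), t; split=> //; first split.
- by move=> i; exact: (hv i).1.
- move=> i; split=> [a b ap bp|a b bp]; first by rewrite cotfD // linearD.
  by rewrite cotfZ // lin_Z.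
- by move=> i j; rewrite (hv j).2 hce.
- move=> a ap h; apply/(cotf0 ap); rewrite (hco (cotf a)) big1 // => i _.
  by rewrite h scale0r.
- by rewrite ef lin_Z hce eqxx -[LHS]/(t * 1) mulr1.
have vp : - (eta t * v ord0) \in p by rewrite -mulNr; apply: idealMl; exact: (hv _).1.
apply/cotf0; first exact: idealD.
rewrite cotfD // -mulNr cotfZ; last exact: (hv _).1.
by rewrite (hv _).2 rmorphN etaK ef scaleNr subrr.
Qed.

Lemma plinB (z : A -> O) : plin lambda z -> forall a b : A, a \in p -> b \in p ->
  z (a - b) = z a - z b.
Proof.
move=> [zD zM] a b ap bp; rewrite -mulN1r zD //; last exact: idealMl.
by rewrite zM // rmorphN1 mulN1r.
Qed.

Lemma plin_sum (z : A -> O) (I : finType) (b c : I -> A) : plin lambda z ->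
  (forall i, b i \in p) -> z (\sum_i c i * b i) = \sum_i lambda (c i) * z (b i).
Proof.
move=> [zD zM] bp.
have z0 : z 0 = 0 by rewrite -(mul0r (0 : A)) zM ?rmorph0 ?mul0r //; exact: ideal0.
suff h : \sum_i c i * b i \in p /\ z (\sum_i c i * b i) = \sum_i lambda (c i) * z (b i).
  exact: h.2.
elim/big_ind2: _ => [|x x' y y' [xp <-] [yp <-]|i _]; first by split=> //; exact: ideal0.
  by split; [exact: idealD|exact: zD].
by split; [exact: idealMl|exact: zM].
Qed.

(** By Nakayama's lemma at p, lifts of generators of the torsion-free quotient
    of p/p^2 generate p after localization. *)
Lemma cotangent_gen (ws : seq A) : (forall a : A, a \in p -> exists2 s : A, s \notin p &
    exists2 b : A, idm ws (b : A^o) & s * a - b \in smulm p p) ->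
  exists2 s : A, s \notin p & forall a : A, a \in p -> idm ws (s * a : A^o).
Proof.
move=> h; have [||s sp hs] := nakayama hp (V := A^o) (N := idm ws) (K := [set a | a \in p]) (idm_sub _ ws).
- exact: noeA (submod_closed_set p).
- move=> a /h[s sp [b hb /smulm_comb[S [Sp hS]]]]; exists s => //; exists S; split=> //.
  have cs := comb_sub S (ideal_setP p) (idm_sub A^o ws).
  have -> : s *: a = (s * a - b) + b :> A^o by rewrite subrK.
  apply: (subD cs); last exact: (comb_base _ (ideal_setP p)).
  by apply: combN hS => x ->; exact: (idm_sub _ ws).1.
- by exists s.
Qed.

(** The coordinates of the entries of ws form a diagonal matrix with entries
    dividing t. So t times any class is a combination of ws. *)
Lemma adapted_gen n (v : 'I_n -> A) xi (ws : seq A) (d d' : 'I_n -> O) t :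
  cotangent_basis v xi -> t != 0 -> {subset ws <= p} -> size ws = n ->
  (forall i j : 'I_n, xi i (nth 0 ws j) = d j * (i == j)%:R) ->
  (forall j, d' j * d j = t) ->
  exists2 s : A, s \notin p & forall a : A, a \in p -> idm ws (s * a : A^o).
Proof.
move=> [vp xip _ hxi] t0 wsp sz hws hd.
have wp (i : 'I_n) : nth 0 ws i \in p by apply/wsp/mem_nth; rewrite sz.
(* b has the same coordinates as t a. *)
apply: cotangent_gen => a ap; pose b := \sum_i eta (d' i * xi i a) * nth 0 ws i.
have bp : b \in p.
  by rewrite /b; elim/big_ind: _ => [|x y|i _]; [exact: ideal0|exact: idealD|exact: idealMl].
have [||s sp hs] := hxi (eta t * a - b).
- by apply: idealB => //; exact: idealMl.
- move=> i; rewrite (plinB (xip i)) ?(xip i).2 ?etaK //; last exact: idealMl.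
  rewrite (plin_sum _ (xip i)) // (bigD1 i) //= big1 => [|j ji].
    by rewrite hws eqxx mulr1 etaK addr0 mulrAC hd subrr.
  by rewrite hws eq_sym (negbTE ji) !mulr0.
exists (s * eta t).
  by apply/negP => /hp.2[|]; apply/negP => //; exact: eta_notin.
exists (s * b); last by rewrite -mulrA -mulrBr.
rewrite mulr_sumr; elim/big_ind: _ => [|x y hx hy|i _].
- exact: (idm_sub _ _).1.
- exact: (subD (idm_sub _ _)).
by rewrite mulrA mulrC; apply: (idm_mem (V := A^o)); apply: mem_nth; rewrite sz.
Qed.

Section Dimension.
Variables (n : nat) (v : 'I_n -> A) (xi : 'I_n -> A -> O).
Hypothesis cb : cotangent_basis v xi.

(** c <= n by Krull's height theorem, since the v i generate p at p. Conversely
    c elements generate the maximal ideal of A_p; expressing the v i by them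
    and applying the coordinates factors an invertible n by n matrix through c
    dimensions, up to denominators. *)
Lemma cotangent_dim c : regular_local (ring_at hp) c -> n = c.
Proof.
case=> _ [ch _] [m hm [e he]]; have loc := loc_ring_at hp.
have [vp xip xiv _] := cb.
have I0 : [set 0] `<=` [set a : A | a \in p] by move=> _ ->; exact: ideal0.
have ws_p : {subset [seq v i | i <- enum 'I_n] <= p} by move=> _ /mapP[i _ ->]; exact: vp.
have [||i k|_|s sp gs] := adapted_gen (t := 1) (d := fun=> 1) (d' := fun=> 1) cb _ ws_p.
- exact: oner_neq0.
- by rewrite size_map size_enum_ord.
- by rewrite (nth_map k) ?size_enum_ord // nth_ord_enum xiv mul1r.
- exact: mulr1.
apply/eqP; rewrite eqn_leq; apply/andP; split; last first.
  have /prime_chainP[P [Q cPQ]] := ch.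
  have := height_le noeA hp sp (ws := [seq v i | i <- enum 'I_n]) (xs := [::]) gs _ _
    (contr_prime (loc_map hp) (pch_prime_bot cPQ)) (pch_contr loc cPQ (pch_prime_bot cPQ))
    (contr_le loc (pch_prime cPQ)).
  by rewrite size_map size_enum_ord; apply.
have me : m =i ext_ideal hp loc p by apply: local_unique; [exact: hm|exact: loc_local].
have [t [b [tp hb]]] := common_frac hp loc e.
have bp k : b k \in p.
  apply/(mem_ext hp loc (b k) hp I0 (fun x h => h)); rewrite -hb -me he mulrC.
  by apply: rpredZ; apply: span_gen; exists k.
have /choice[g hg] : forall i, exists g : 'I_c -> ring_at hp, loc_map hp (v i) = \sum_k g k * e k.
  move=> i; have : loc_map hp (v i) \in span (range (e : 'I_c -> (ring_at hp)^o)).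
    by rewrite -he me; apply/(mem_ext hp loc (v i) hp I0 (fun x h => h)); exact: vp.
  by move=> /span_range[g ->]; exists g.
have /choice[s' hs'] : forall i, exists q : A * ('I_c -> A), q.1 \notin p /\
    forall k, g i k * loc_map hp q.1 = loc_map hp (q.2 k).
  by move=> i; have [s' [q [h1 h2]]] := common_frac hp loc (g i); exists (s', q).
have [_ j0 _] := loc.
(* v i = sum of g i k e k, cleared of its denominators in A. *)
have /choice[u hu] : forall i, exists u : A, u \notin p /\
    u * (v i * ((s' i).1 * t)) = \sum_k (u * (s' i).2 k) * b k.
  move=> i; have /j0[u up hu] : loc_map hp (v i * ((s' i).1 * t) - \sum_k (s' i).2 k * b k) = 0.
    rewrite rmorphB !rmorphM hg rmorph_sum mulr_suml -sumrB big1 // => k _.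
    by rewrite rmorphM -(hs' i).2 -hb; ring.
  exists u; split=> //; under eq_bigr => k _ do rewrite -mulrA.
  by apply/eqP; rewrite -subr_eq0 -mulr_sumr -mulrBr hu.
apply: (@idomain_rank_le O n c (fun i => lambda (u i * ((s' i).1 * t)))
  (fun i k => lambda (u i * (s' i).2 k)) (fun k l => xi l (b k))) => [i|i l].
  apply: lambda_neq0; apply/negP => /hp.2[|/hp.2[|]]; apply/negP => //.
  - exact: (hu i).1.
  - exact: (hs' i).1.
rewrite -plin_sum // -(hu i).2 [v i * _]mulrC [u i * (_ * v i)]mulrA (xip l).2; last exact: vp.
by rewrite xiv eq_sym.
Qed.
End Dimension.
End Cotangent.

(** * The Wiles defect in terms of a regular sequence *)

Section Formula.
Variables (O : idomainType) (A : comPzRingType).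
Hypothesis hO : is_dvr O.
Variables (eta : {rmorphism O -> A}) (lambda : {rmorphism A -> O}).
Hypothesis etaK : forall r, lambda (eta r) = r.
Local Notation p := (kerr lambda).

Lemma null_choice (N : lmodType A) (F : nat -> lmodType A)
    (d : forall n, {linear F n.+1 -> F n}) (eps : {linear F 0 -> N}) :
  is_resolution d eps -> (forall (a : A) (x : N), a \in p -> a *: x = 0) ->
  exists H : A -> forall n, {linear F n -> F n.+1},
    forall w : A, w \in p -> null_homotopy d w (H w).
Proof.
move=> hF kN.
have /choice[H hH] : forall w : A, exists h : forall n, {linear F n -> F n.+1},
    w \in p -> null_homotopy d w h.
  move=> w; have [wp|wp] := boolP (w \in p).
    by have [h hh] := null_homotopy_ex hF (fun x => kN w x wp); exists h.
  have [h _] := null_homotopy_ex hF (fun x => kN 0 x (ideal0 _)).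
  by exists h.
by exists H.
Qed.

Hypothesis noeA : noeth_mod A^o.
Variable m : ideal A.
Hypothesis hm : local_with m.
Variables (M : lmodType A) (T : lmodType O) (Q : M -> T).
Hypothesis fgM : fg_module M.
Hypothesis QD : forall x y, Q (x + y) = Q x + Q y.
Hypothesis QZ : forall (a : A) x, Q (a *: x) = lambda a *: Q x.
Hypothesis Qsurj : forall y, exists x, Q x = y.
Hypothesis Qker : forall x, Q x = 0 <->
  exists2 s : A, s \notin p & s *: x \in smulm p (submodT M).
Variable ws : seq A.
Hypothesis wsp : {subset ws <= p}.
Hypothesis reg : mreg M [::] ws.
Hypothesis gen : exists2 s : A, s \notin p & forall a : A, a \in p -> idm ws (s * a : A^o).
Variables (r : nat) (e : 'I_r -> T).
Hypothesis he : is_basis e.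
Variable t : O.
Hypothesis dual : dual_family lambda t ws.
Hypothesis slot : match ws with
  | [::] => True
  | w :: _ => exists x s : A, [/\ x \in p, s \notin p & s * (w - eta t * x) \in smulm p p]
  end.
Variable I1 : set T.
Hypothesis hI1 : submod_set I1.
Hypothesis I1P : forall y, I1 y <->
  exists2 x, y = Q x & forall a : A, a \in p -> idm ws (a *: x).

(** In this form the defect depends on M only through r, T and I1. *)
Lemma wiles_defect_eval a l b : has_length (Phi eta lambda) a ->
  has_length (quom (span [set t : O^o])) l -> has_length (quom (submod_of hI1)) b ->
  wiles_defect eta lambda M (size ws) = (r * (a + l))%:Z - b%:Z.
Proof.
move=> ha hl hb; have hmp := maximal_prime hm.1.
have um : forall a : A, a \notin m -> exists b, a * b = 1 by move=> x; exact: local_unit.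
have /choice[mm emm] : forall k, exists x, Q x = e k by move=> k; exact: Qsurj.
have [H hH] := null_choice (res_resolution (restr lambda O^o))
  (fun (a : A) (x : restr lambda O^o) (ap : a \in p) =>
     etrans (congr1 (fun c : O => c * x) (proj1 (pE lambda a) ap)) (mul0r (x : O))).
have [u hu] := res_aug_surj ((1 : O) : restr lambda O^o).
have [n hn hb'] := congruence_module_length hO etaK noeA hmp um (p_sub_m noeA hm) fgM QD QZ
  Qsurj Qker wsp reg gen he dual slot hI1 I1P hH hu hl.
rewrite /wiles_defect (free_rank_at_aug_prime etaK noeA fgM QD QZ Qker wsp reg gen he emm).
rewrite (mod_lengthE ha) (mod_lengthE hn) -(mod_lengthE hb) (mod_lengthE hb').
by rewrite mulnDr !PoszD opprD addrACA subrr addr0.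
Qed.
End Formula.

Section Descent.
Variables (A B : comPzRingType) (h : {rmorphism A -> B}).
Variables (M : lmodType A) (N : lmodType B) (g : M -> N).
Hypothesis gB : forall x y, g (x - y) = g x - g y.
Hypothesis gZ : forall (a : A) x, g (a *: x) = h a *: g x.
Hypothesis gs : forall y, exists x, g x = y.
Variable xs : seq A.
Hypothesis g0 : forall x, g x = 0 <-> idm xs x.

Lemma idm_descent (ws : seq A) x : idm (map h ws) (g x) <-> idm (ws ++ xs) x.
Proof.
elim: ws x => [|w ws IH] x /=; first exact: g0.
split=> [[y]|[y hy]].
  by have [x' <-] := gs y; rewrite -gZ -gB => /IH hx; exists x'.
by exists (g y); rewrite -gZ -gB; apply/IH.
Qed.

Lemma mreg_descent (zs ys : seq A) : mreg M (zs ++ xs) ys ->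
  mreg N (map h zs) (map h ys).
Proof.
elim: ys zs => //= y ys IH zs [h1 h2]; split; last exact: (IH (y :: zs)).
by move=> n; have [x <-] := gs n; rewrite -gZ => /idm_descent/h1 hx; apply/idm_descent.
Qed.
End Descent.

Section Reduction.
Variables (O : idomainType) (A : comPzRingType).
Variables (eta : {rmorphism O -> A}) (lambda : {rmorphism A -> O}).
Hypothesis etaK : forall r, lambda (eta r) = r.
Local Notation p := (kerr lambda).
Variable M : lmodType A.

Definition redm : lmodType O := tf (restr eta (quom (smulm p (submodT M)))).
Definition red (x : M) : redm :=
  quom_pi (tors _) (quom_pi (smulm p (submodT M)) x : restr eta (quom (smulm p (submodT M)))).

Lemma redD x y : red (x + y) = red x + red y.
Proof. by rewrite /red !raddfD. Qed.
Lemma red_surj y : exists x, red x = y.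
Proof. by exists (quom_repr (quom_repr y)); rewrite /red !quom_reprK. Qed.
Lemma pM_mem (a : A) (x : M) : a \in p -> a *: x \in smulm p (submodT M).
Proof. by move=> ap; apply: smulm_mem => //; apply/submod_ofE. Qed.

Lemma redZ (a : A) x : red (a *: x) = lambda a *: red x.
Proof.
rewrite /red -lin_Z; congr (quom_pi _ _).
rewrite -[RHS]/(eta (lambda a) *: quom_pi (smulm p (submodT M)) x) -lin_Z.
by apply/quom_piP; rewrite -scalerBl; apply: pM_mem; exact: p_sub.
Qed.

Lemma red_ker x : red x = 0 <->
  exists2 s : A, s \notin p & s *: x \in smulm p (submodT M).
Proof.
split=> [/tors_pi0[r r0 hr]|[s sp /quom_pi0 hs]].
  exists (eta r); first exact: eta_notin.
  by apply/quom_pi0; rewrite lin_Z.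
have [|/eqP e|//] := @tf_torsion_free O _ (lambda s) (red x).
  by rewrite -redZ /red hs linear0.
by rewrite (negbTE (lambda_neq0 sp)) in e.
Qed.

Lemma redm_fg : fg_module M -> fg_module redm.
Proof.
case=> s hs; exists [seq red x | x <- s] => y; have [x <-] := red_surj y.
apply/span_lc; have /span_lc := hs x; move: {y} x.
apply: (lc_ind (s := s) (P := [set x | lc [seq red x | x <- s] (red x)])).
  split=> [|a x y hx hy] /=.
    have -> : red 0 = 0 by rewrite /red !linear0.
    exact: (lc_sub _).1.
  by rewrite redD redZ; exact: (lc_sub _).2.
by move=> x xs; exact: (lc_mem (map_f red xs)).
Qed.
End Reduction.

Lemma dual_family_intro (O : idomainType) (A : comPzRingType) (lambda : {rmorphism A -> O})
    (ys : seq A) (xi : nat -> A -> O) :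
  (forall i, (i < size ys)%N -> plin lambda (xi i)) ->
  (forall i j, (i < size ys)%N -> (j < size ys)%N -> xi i (nth 0 ys j) = (i == j)%:R) ->
  dual_family lambda 1 ys.
Proof.
elim: ys xi => //= y ys IH xi hxi hy; exists 1, 1, (xi 0%N).
split; first by rewrite mulr1.
- by split; [exact: hxi|exact: (hy 0%N 0%N)].
- move=> w /(nthP 0)[j lt <-]; exact: (hy 0%N j.+1).
- apply: (IH (fun i => xi i.+1)) => [i lt|i j lti ltj]; first exact: hxi.
  exact: (hy i.+1 j.+1).
Qed.

(** * The torsion of the cotangent module of a hypersurface *)

Lemma fg_subm (R : comPzRingType) (V : lmodType R) (S : submodClosed V) :
  noeth_mod V -> fg_module (subm S).
Proof.
move=> noeV; have [s hs] := noeV _ (submod_closed_set S).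
have sS x : x \in s -> x \in S by move=> xs; apply: (proj2 (hs x)); exact: lc_mem.
exists [seq insubd (0 : subm S) x | x <- s] => y.
have := proj1 (hs (val y)) (valP y).
suff sub : lc s `<=` [set x | exists2 y : subm S,
    y \in span [set y | y \in [seq insubd (0 : subm S) x | x <- s]] & val y = x].
  by move=> /sub[y' hy' /val_inj <-].
apply: lc_ind => [|x xs].
  split=> [|a _ _ [x hx <-] [x' hx' <-]]; first by exists 0; [exact: rpred0|].
  by exists (a *: x + x') => //; apply: rpredD => //; exact: rpredZ.
exists (insubd (0 : subm S) x); last by apply: insubdK; exact: sS.
by apply: span_gen; exact: map_f.
Qed.

(** Finitely many torsion elements have a common annihilator, which is a common
    denominator at the zero prime. *)
Lemma tors_fin_length (O : idomainType) (U : lmodType O) : is_dvr O -> fg_module U ->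
  fin_length (subm (tors U)).
Proof.
move=> hO fgU; have noeU := noeth_fg (dvr_noeth hO) fgU.
have z0 (a : O) : a \in submod0 O^o <-> a = 0 by exact: (submod_ofE (@zero_subproof _ O^o)).
have hz : prime_ideal (submod0 O^o).
  split=> [|a b /z0/eqP]; first by apply/negP => /z0/eqP; rewrite oner_eq0.
  by rewrite mulf_eq0 => /orP[]/eqP ->; [left|right]; exact/z0.
have [|t t0 ht] := common_den hz (noeU _ (submod_closed_set (tors U))) (@submod_set0 _ U).
  move=> x /(submod_ofE (tors_subproof U))[r r0 hr]; exists r => //.
  by apply: contra r0 => /z0 ->.
apply: (dvr_torsion_length hO (fg_subm _ noeU) (t := t)).
  by apply: contra t0 => /eqP ->; exact/z0.
by move=> x; apply: val_inj; exact: (ht (val x) (valP x)).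
Qed.

Lemma subm_valP (R : pzRingType) (V : lmodType R) (S : submodClosed V) a (x y : subm S) :
  val (a *: x + y) = a *: val x + val y.
Proof. exact: linearP. Qed.

Section Hypersurface.
Variables (O : idomainType) (A : comPzRingType).
Variables (eta : {rmorphism O -> A}) (lambda : {rmorphism A -> O}).
Hypothesis etaK : forall r, lambda (eta r) = r.
Local Notation p := (kerr lambda).
Variables (B : comPzRingType) (h : {rmorphism A -> B}).
Hypothesis h_surj : forall b, exists a, h a = b.
Variables (etaB : {rmorphism O -> B}) (lambdaB : {rmorphism B -> O}).
Hypothesis hetaB : forall r, etaB r = h (eta r).
Hypothesis hlambdaB : forall a, lambdaB (h a) = lambda a.
Local Notation q := (kerr lambdaB).
Variable f : A.
Hypothesis fp : f \in p.
Hypothesis kerh : forall a, h a = 0 <-> exists c, a = c * f.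

Lemma etaBK r : lambdaB (etaB r) = r.
Proof. by rewrite hetaB hlambdaB etaK. Qed.
Lemma mem_q (a : A) : h a \in q <-> a \in p.
Proof. by rewrite !pE hlambdaB. Qed.
Lemma h_eqf (a c : A) : h (a - c * f) = h a.
Proof. by rewrite rmorphB (proj2 (kerh (c * f))) ?subr0 //; exists c. Qed.

Lemma h_sq (a : A) : (a : A^o) \in smulm p p -> (h a : B^o) \in smulm q q.
Proof.
move: a; apply: (@smulm_ind A A^o p p [set a : A^o | (h a : B^o) \in smulm q q]).
  split=> [|a x y hx hy] /=; first by rewrite rmorph0; exact: rpred0.
  by rewrite rmorphD rmorphM; apply: rpredD => //; apply: rpredZ.
move=> a x ap xp /=; rewrite rmorphM.
by apply: (smulm_mem (V := B^o)); apply/mem_q.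
Qed.

(** q^2 is the image of p^2. *)
Lemma mem_sq (a : A) : (h a : B^o) \in smulm q q <-> exists c, (a - c * f : A^o) \in smulm p p.
Proof.
split=> [|[c /h_sq]]; last by rewrite h_eqf.
have sub : forall b, b \in smulm q q -> exists2 x : A, h x = b & (x : A^o) \in smulm p p.
  apply: (@smulm_ind B B^o q q [set b : B^o | exists2 x : A, h x = b & (x : A^o) \in smulm p p]).
    split=> [|b _ _ [x <- hx] [y <- hy]] /=; first by exists 0; [rewrite rmorph0|exact: ideal0].
    have [c <-] := h_surj b; exists (c * x + y); first by rewrite rmorphD rmorphM.
    by apply: idealD => //; exact: idealMl.
  move=> b1 b2 /=; have [a1 <-] := h_surj b1; have [a2 <-] := h_surj b2.
  move=> /mem_q h1 /mem_q h2; exists (a1 * a2); first exact: rmorphM.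
  exact: (smulm_mem (V := A^o)).
move=> /sub[x ex hx]; have /kerh[c ec] : h (a - x) = 0 by rewrite rmorphB ex subrr.
by exists c; rewrite -ec opprB addrC subrK.
Qed.

Variables (n : nat) (v : 'I_n.+1 -> A) (xi : 'I_n.+1 -> A -> O) (t : O).
Hypothesis cb : cotangent_basis lambda v xi.
Hypothesis t0 : t != 0.
Hypothesis xif : xi ord0 f = t.
Hypothesis fv : exists2 s : A, s \notin p & s * (f - eta t * v ord0) \in smulm p p.

Lemma plin_sq (z : A -> O) : plin lambda z -> forall a : A, (a : A^o) \in smulm p p -> z a = 0.
Proof.
move=> [zD zM] a ha; suff [] : a \in p /\ z a = 0 by [].
move: a ha; apply: (@smulm_ind A A^o p p [set a : A^o | (a : A) \in p /\ z a = 0]).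
  split=> [|c x y [xp hx] [yp hy]]; split=> /=.
  - exact: ideal0.
  - by rewrite -(mul0r (0 : A)) zM ?mulr0 ?rmorph0 ?mul0r //; exact: ideal0.
  - by apply: idealD => //; exact: idealMl.
  - by rewrite zD ?zM ?hx ?hy ?mulr0 ?addr0 //; exact: idealMl.
move=> a x ap xp; split=> /=; first exact: idealMl.
by rewrite zM // (proj1 (pE lambda a) ap) mul0r.
Qed.

Lemma plin_loc (z : A -> O) : plin lambda z -> forall s a : A, s \notin p -> a \in p ->
  (s * a : A^o) \in smulm p p -> z a = 0.
Proof.
move=> hz s a sp ap /(plin_sq hz)/eqP; rewrite hz.2 // mulf_eq0.
by rewrite (negbTE (lambda_neq0 sp)) => /eqP.
Qed.

Lemma xi_f i : i != ord0 -> xi i f = 0.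
Proof.
move=> i0; have [vp xip xiv _] := cb; have [s sp hs] := fv.
have tv : eta t * v ord0 \in p by exact: idealMl.
have := plin_loc (xip i) sp (idealB fp tv) hs.
by rewrite (plinB (xip i)) // (xip i).2 // xiv (negbTE i0) mulr0 subr0.
Qed.

Lemma torsA (a : A) : a \in p ->
  (cot eta lambda a \in tors (cotangent eta lambda)) <-> forall i, xi i a = 0.
Proof.
move=> ap; have [_ xip _ hxi] := cb; split.
  move=> /(submod_ofE (tors_subproof _))/(cot_tors etaK ap)[s sp hs] i.
  exact: (plin_loc (xip i) sp ap hs).
by move=> /(hxi a ap)/(cot_tors etaK ap) h'; apply/(submod_ofE (tors_subproof _)).
Qed.

(** Up to torsion t v_0 is f, so v_0 becomes torsion in the quotient. The other
    coordinates vanish on f and descend to the quotient. *)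
Lemma torsB (a : A) : a \in p ->
  (cot etaB lambdaB (h a) \in tors (cotangent etaB lambdaB)) <->
  forall i, i != ord0 -> xi i a = 0.
Proof.
move=> ap; have [_ xip _ hxi] := cb; have haq : h a \in q by apply/mem_q.
split.
  move=> /(submod_ofE (tors_subproof _))/(cot_tors etaBK haq)[s' ].
  have [s <-] := h_surj s'; rewrite -rmorphM => sq /mem_sq[c hc] i i0.
  have sp : s \notin p by apply: contra sq => /mem_q.
  have := plin_sq (xip i) hc; rewrite (plinB (xip i)) ?(xip i).2 ?xi_f ?mulr0 ?subr0 //; try exact: idealMl.
  by move=> /eqP; rewrite mulf_eq0 (negbTE (lambda_neq0 sp)) => /eqP.
(* All coordinates of t a - xi_0(a) f vanish. *)
move=> xia; have [||s sp hs] := hxi (eta t * a - eta (xi ord0 a) * f).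
- by apply: idealB; exact: idealMl.
- move=> i; rewrite (plinB (xip i)) ?(xip i).2 ?etaK //; try exact: idealMl.
  have [->|i0] := eqVneq i ord0; first by rewrite xif mulrC subrr.
  by rewrite xia ?xi_f ?mulr0 ?subrr.
apply/(submod_ofE (tors_subproof _))/(cot_tors etaBK haq); exists (h (s * eta t)).
  apply/negP => /mem_q/(aug_prime lambda).2[|]; apply/negP => //; exact: eta_notin.
rewrite -rmorphM; apply/mem_sq; exists (s * eta (xi ord0 a)).
by rewrite -!mulrA -mulrBr.
Qed.

Lemma cotB_lin (c : O) (a b : A) : a \in p -> b \in p ->
  cot etaB lambdaB (h (eta c * a + b)) = c *: cot etaB lambdaB (h a) + cot etaB lambdaB (h b).
Proof.
move=> /mem_q aq /mem_q bq; rewrite rmorphD rmorphM -hetaB cotD //; last exact: idealMl.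
by rewrite (cotZ etaBK (etaB c) aq) etaBK.
Qed.

Local Notation Ot := (quom (span [set t : O^o])).

(** Injectivity: if a is in p^2 + c f and its first coordinate vanishes, then c
    is in p, since t is nonzero; so c f is in p^2. *)
Lemma Phi_incl : exists2 i : {linear Phi eta lambda -> Phi etaB lambdaB},
  (forall x, i x = 0 -> x = 0) &
  forall x y, i x = y <-> exists2 a : A, a \in p &
    val x = cot eta lambda a /\ val y = cot etaB lambdaB (h a).
Proof.
have [_ xip _ _] := cb.
have [|||i hi] := @lin_of_rel O (Phi eta lambda) (Phi etaB lambdaB) (fun x y =>
  exists2 a : A, a \in p & val x = cot eta lambda a /\ val y = cot etaB lambdaB (h a)).
- move=> x; have [a ap ea] := cot_surj (val x).
  have : cot etaB lambdaB (h a) \in tors (cotangent etaB lambdaB).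
    by apply/torsB => // i _; move: i; apply/torsA => //; rewrite ea; exact: valP.
  by move=> hy; exists (exist (fun z => z \in tors _) _ hy), a.
- move=> y [a ap [/esym/(cot0 _ ap)/h_sq e1 e2]]; apply: val_inj; rewrite e2.
  by apply/cot0 => //; exact/mem_q.
- move=> c x x' y y' [a ap [e1 e2]] [b bp [e3 e4]].
  have cap : eta c * a \in p by exact: idealMl.
  exists (eta c * a + b); first exact: idealD.
  split; apply: (etrans (subm_valP _ _ _)); first by rewrite e1 e3 (cotD eta cap bp) (cotZ etaK (eta c) ap) etaK.
  by rewrite e2 e4 (cotB_lin c ap bp).
exists i; last by move=> x y; split=> /hi.
move=> x /hi[a ap [e1 e2]]; apply: val_inj; rewrite e1.
have /mem_sq[c hc] := proj1 (cot0 etaB (proj2 (mem_q a) ap)) (esym e2).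
have at0 : forall i, xi i a = 0 by apply/torsA => //; rewrite -e1; exact: valP.
have := plin_sq (xip ord0) hc; rewrite (plinB (xip ord0)) ?(xip ord0).2 //; last exact: idealMl.
rewrite at0 xif sub0r => /eqP; rewrite oppr_eq0 mulf_eq0 (negbTE t0) orbF => /eqP/pE cp.
apply/cot0 => //; rewrite -(subrK (c * f) a); apply: idealD => //.
exact: (smulm_mem (V := A^o) cp fp).
Qed.

(** The additional torsion is generated by the class of v_0, and its coordinate
    xi_0 takes values in O/t, as t v_0 = f up to torsion. *)
Lemma Phi_length a l : has_length (Phi eta lambda) a -> has_length Ot l ->
  has_length (Phi etaB lambdaB) (a + l).
Proof.
move=> ha hl; have [vp xip xiv _] := cb; have [i i_inj hi] := Phi_incl.
have [|||g hg] := @lin_of_rel O (Phi etaB lambdaB) Ot (fun y z =>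
  exists2 b : A, b \in p & val y = cot etaB lambdaB (h b) /\ z = quom_pi _ (xi ord0 b : O^o)).
- move=> y; have [b' bq eb] := cot_surj (val y).
  move: bq eb; have [b <-] := h_surj b'; move=> /mem_q bp eb.
  by exists (quom_pi _ (xi ord0 b : O^o)), b.
- move=> z [b bp [e1 ->]].
  have /mem_sq[c hc] := proj1 (cot0 etaB (proj2 (mem_q b) bp)) (esym e1).
  have := plin_sq (xip ord0) hc; rewrite (plinB (xip ord0)) ?(xip ord0).2 //; last exact: idealMl.
  move=> /eqP; rewrite subr_eq0 xif => /eqP ->.
  by apply/quom_pi0/span1E; exists (lambda c).
- move=> c x x' y y' [b bp [e1 ->]] [b' bp' [e3 ->]].
  have cbp : eta c * b \in p by exact: idealMl.
  exists (eta c * b + b'); first exact: idealD.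
  split; first by apply: (etrans (subm_valP _ _ _)); rewrite e1 e3 (cotB_lin c bp bp').
  by rewrite (xip ord0).1 // (xip ord0).2 // etaK -lin_Z -linearD.
have gP (y : Phi etaB lambdaB) : exists2 b : A, b \in p & val y = cot etaB lambdaB (h b).
  have [b' bq eb] := cot_surj (val y); move: bq eb; have [b <-] := h_surj b'.
  by move=> /mem_q bp eb; exists b.
apply: (length_add (i := i) (q := g)) ha hl => // y.
  have rv : eta (quom_repr y) * v ord0 \in p by exact: idealMl.
  have hy : cot etaB lambdaB (h (eta (quom_repr y) * v ord0)) \in tors (cotangent etaB lambdaB).
    by apply/torsB => // k k0; rewrite (xip k).2 // xiv (negbTE k0) mulr0.
  exists (exist (fun z => z \in tors _) _ hy); apply/hg; exists (eta (quom_repr y) * v ord0) => //; split=> //.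
  by rewrite (xip ord0).2 // xiv eqxx etaK mulr1 quom_reprK.
split.
  move=> /hg[b bp [e1 /esym/quom_pi0/span1E[c ec]]].
  have ebc : b - eta c * f \in p by apply: idealB => //; exact: idealMl.
  have hb : forall k, k != ord0 -> xi k b = 0 by apply/torsB => //; rewrite -e1; exact: valP.
  have hx : cot eta lambda (b - eta c * f) \in tors (cotangent eta lambda).
    apply/torsA => // k; rewrite (plinB (xip k)) ?(xip k).2 ?etaK //; last exact: idealMl.
    have [->|k0] := eqVneq k ord0; first by rewrite ec xif subrr.
    by rewrite hb // xi_f // mulr0 subrr.
  exists (exist (fun z => z \in tors _) _ hx); apply/esym/hi; exists (b - eta c * f) => //.
  by rewrite h_eqf.
case=> x ex; have /hi[b bp [e1 e2]] := esym ex; apply/hg; exists b => //.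
split=> //; have -> : xi ord0 b = 0 by apply: (proj1 (torsA bp)); rewrite -e1; exact: valP.
by rewrite linear0.
Qed.
End Hypersurface.

(** * The comparison of A with A/f *)

Lemma fg_regular (R : comPzRingType) : fg_module R^o.
Proof.
exists [:: (1 : R^o)] => x; rewrite -[x](mulr1 (x : R)).
by apply: (rpredZ (x : R)); apply: span_gen; exact: mem_head.
Qed.

Section Final.
Variables (O : idomainType) (A : comPzRingType).
Hypothesis hO : is_dvr O.
Variables (eta : {rmorphism O -> A}) (lambda : {rmorphism A -> O}).
Hypothesis etaK : forall r, lambda (eta r) = r.
Local Notation p := (kerr lambda).
Local Notation hp := (aug_prime lambda).
Hypothesis noeA : noeth_mod A^o.

Variable m : ideal A.
Hypothesis hm : local_with m.
Variable f : A.
Hypothesis fp : f \in p.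
Variables (n : nat) (v : 'I_n.+1 -> A) (xi : 'I_n.+1 -> A -> O) (t : O).
Hypothesis cb : cotangent_basis lambda v xi.
Hypothesis t0 : t != 0.
Hypothesis xif : xi ord0 f = t.
Hypothesis fv : exists2 s : A, s \notin p & s * (f - eta t * v ord0) \in smulm p p.

(** The coordinates xi do not see corrections in p^2, so ys lifts the same
    basis vectors as the v i with i > 0. *)
Lemma sequence_ex (M : lmodType A) : fg_module M -> depth_ge M n.+2 -> nzdiv f M ->
  exists ys : seq A, [/\ size ys = n, {subset ys <= p}, mreg M [:: f] ys &
    forall (i : 'I_n.+1) (j : 'I_n), xi i (nth 0 ys j) = (i == lift ord0 j)%:R].
Proof.
move=> fgM dM fM; have [vp xip xiv _] := cb.
have hF := res_resolution (quom m).
have mk (a : A^o) (z : quom m) : a \in m -> a *: z = 0.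
  move=> am; rewrite -[z]quom_reprK -lin_Z; apply/quom_pi0.
  exact: (idealMr (quom_repr z)).
have van := depth_vanish hF hm mk dM.
pose vs := [seq v (lift ord0 j) | j <- enum 'I_n].
have szv : size vs = n by rewrite size_map size_enum_ord.
have regf (x : M) : idm [::] (f *: x) -> idm [::] x by exact: fM.
have [||ys [s1 s2 s3 s4]] := choose_sequence hO etaK noeA hm hF fgM (vs := vs) (xs := [:: f]).
- by move=> _ /mapP[j _ ->]; exact: vp.
- rewrite szv => k le; apply: (modl_vanish_down hF regf); apply: van; first exact: leqW.
  exact: le.
exists ys; split=> //; first by rewrite s1.
move=> i j; have vj : nth 0 vs j = v (lift ord0 j).
  by rewrite (nth_map j) ?size_enum_ord // nth_ord_enum.
have yp : nth 0 ys j \in p by apply/s2/mem_nth; rewrite s1 szv.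
have := plin_sq (xip i) (s4 j); rewrite vj (plinB (xip i)) // xiv.
by move=> /eqP; rewrite subr_eq0 => /eqP.
Qed.

Variable ys : seq A.
Hypothesis sz : size ys = n.
Hypothesis ysp : {subset ys <= p}.
Hypothesis xiy : forall (i : 'I_n.+1) (j : 'I_n), xi i (nth 0 ys j) = (i == lift ord0 j)%:R.

Let wsp : {subset f :: ys <= p}.
Proof. by move=> x; rewrite inE => /orP[/eqP ->|/ysp]. Qed.

Lemma gen_A : exists2 s : A, s \notin p & forall a : A, a \in p -> idm (f :: ys) (s * a : A^o).
Proof.
apply: (adapted_gen etaK noeA (d := fun j => if j == ord0 then t else 1)
  (d' := fun j => if j == ord0 then 1 else t) cb t0 wsp) => [|i j|j].
- by rewrite /= sz.
- have [j' ->|->] := unliftP ord0 j.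
    by rewrite xiy mul1r.
  rewrite eqxx; have [->|i0] := eqVneq i ord0; first by rewrite mulr1 xif.
  by rewrite mulr0; exact: (xi_f fp cb fv i0).
- by case: ifP; rewrite ?mulr1 ?mul1r.
Qed.

Lemma dual_ys : dual_family lambda 1 ys.
Proof.
have [_ xip _ _] := cb.
apply: (dual_family_intro (xi := fun i => xi (inord i.+1))) => [i _|i j]; first exact: xip.
rewrite sz => lti ltj; rewrite (xiy _ (Ordinal ltj)); congr (nat_of_bool _)%:R.
by rewrite -(inj_eq val_inj) /= inordK ?ltnS // /bump /= add1n eqSS.
Qed.

Lemma dual_A : dual_family lambda t (f :: ys).
Proof.
have [_ xip _ _] := cb; exists t, 1, (xi ord0); split.
- by rewrite mulr1.
- by split; [exact: xip|exact: xif].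
- move=> w /(nthP 0)[j]; rewrite sz => lt <-.
  by rewrite (xiy ord0 (Ordinal lt)) -[_ == _]/false.
- exact: dual_ys.
Qed.

Section Quotient.
Variables (B : comPzRingType) (h : {rmorphism A -> B}).
Hypothesis h_surj : forall b, exists a, h a = b.
Variables (etaB : {rmorphism O -> B}) (lambdaB : {rmorphism B -> O}).
Hypothesis hetaB : forall r, etaB r = h (eta r).
Hypothesis hlambdaB : forall a, lambdaB (h a) = lambda a.
Local Notation q := (kerr lambdaB).
Hypothesis kerh : forall a, h a = 0 <-> exists c, a = c * f.
Let mq := mem_q hlambdaB.

Let ker_m (a : A) : h a = 0 -> a \in m.
Proof. by move=> /kerh[c ->]; apply: idealMl; exact: (p_sub_m noeA hm fp). Qed.

(** The chain of primes that computes the dimension of A_p is rerouted through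
    f, and p is generated at p by f and ys. *)
Lemma quotient_cat : adic_complete m -> regular_local (ring_at hp) n.+1 ->
  cat_C etaB lambdaB n.
Proof.
move=> cm [_ [ch _] _]; split.
- exact/noetherianI/(surj_noeth h_surj noeA).
- exists (image_ideal h_surj m); first exact: image_local.
  exact: image_complete.
- exact: etaBK.
- by move=> r; exists (etaB r); exact: (etaBK etaK hetaB hlambdaB).
have loc := loc_ring_at hp; have [P0 [Q0 c0]] := (proj1 (prime_chainP _ _)) ch.
have hP0 := pch_prime_bot c0.
have cP := pch_contr loc c0 hP0.
have Qp := contr_le loc (pch_prime c0).
have cp : pch n.+1 (contr_ideal (loc_map hp) P0) p.
  case: cP => _ [Q' cQ' [l1 l2]]; split; first exact: hp.
  exists Q' => //; split; first by move=> a /l1/Qp.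
  by move=> l; apply: l2 => a /Qp/l.
have [P [cP' hP _ fP]] := pch_through noeA cp (contr_prime _ hP0) fp.
have locB := loc_instance (aug_prime lambdaB) h_surj.
have pe (a : A) : a \in pull_ideal h q <-> a \in p.
  by rewrite -mq; exact: contrP.
have [s sp gs] := gen_A.
rewrite -sz in cP' *.
apply: (@regular_loc A _ (loc_map (aug_prime lambdaB) \o h) (pull_ideal h q) [set a | h a = 0]
  noeA _ locB _ [:: f] ys s P p) => //.
- exact: contr_prime (aug_prime lambdaB).
- by move=> a /= ha; apply/contrP; rewrite ha; exact: ideal0.
- by apply: contra sp => /pe.
- by move=> x; rewrite inE => /eqP ->; apply/kerh; exists 1; rewrite mul1r.
- by move=> x /ysp xp; apply/pe.
- move=> a /pe/gs[b hb]; exists (f * b) => //.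
  by apply/kerh; exists b; rewrite mulrC.
- by move=> a /pe/gs.
- by move=> a /= /kerh[c ->]; exact: idealMl.
- by move=> a ap; apply/pe.
Qed.

(** Two lifts of an element of B differ by a multiple of f. *)
Lemma plin_descent (z : A -> O) : plin lambda z -> z f = 0 ->
  exists2 zB, plin lambdaB zB & forall a : A, a \in p -> zB (h a) = z a.
Proof.
move=> hz zf; have [k hk] := choice h_surj.
have zk (a : A) : a \in p -> z (k (h a)) = z a.
  move=> ap; have /kerh[c ec] : h (k (h a) - a) = 0 by rewrite rmorphB hk subrr.
  have kp : k (h a) \in p by apply/mq; rewrite hk; exact/mq.
  apply/eqP; rewrite -subr_eq0 -(plinB hz kp ap) ec hz.2 // zf.
  by rewrite mulr0.
exists (z \o k); last exact: zk.
split=> [b b'|b b'] /=; have [a <-] := h_surj b; have [a' <-] := h_surj b'.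
  move=> /mq ap /mq ap'; rewrite -rmorphD !zk //; last exact: idealD.
  exact: hz.1.
by move=> /mq ap; rewrite -rmorphM hlambdaB !zk //; [exact: hz.2|exact: idealMl].
Qed.

Let dual_B : dual_family lambdaB 1 (map h ys).
Proof.
have [_ xip _ _] := cb.
have /choice[z hz] : forall j : 'I_n, exists zB, plin lambdaB zB /\
    forall a : A, a \in p -> zB (h a) = xi (lift ord0 j) a.
  move=> j; have [|zB h1 h2] := plin_descent (xip (lift ord0 j)); last by exists zB.
  by apply: (xi_f fp cb fv).
pose zz i := if insub i is Some j then z j else fun=> 0.
have zzE i (lt : (i < n)%N) : zz i = z (Ordinal lt) by rewrite /zz insubT.
apply: (dual_family_intro (xi := zz)) => [i|i j]; rewrite size_map sz => lti.
  by rewrite zzE; exact: (hz _).1.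
move=> ltj; rewrite zzE (nth_map 0) ?sz // (hz _).2; last by apply/ysp/mem_nth; rewrite sz.
by rewrite (xiy _ (Ordinal ltj)) (inj_eq lift_inj).
Qed.

Variables (M : lmodType A) (N : lmodType B) (g : M -> N).
Hypothesis fgM : fg_module M.
Hypothesis regf : nzdiv f M.
Hypothesis regy : mreg M [:: f] ys.
Hypothesis gB : forall x y, g (x - y) = g x - g y.
Hypothesis gZ : forall (a : A) x, g (a *: x) = h a *: g x.
Hypothesis gs : forall y, exists x, g x = y.
Hypothesis g0 : forall x, g x = 0 <-> idm [:: f] x.

Let gD x y : g (x + y) = g x + g y.
Proof.
have e : x + y = x - (-1 : A) *: y by rewrite scaleN1r opprK.
by rewrite e gB gZ rmorphN1 scaleN1r opprK.
Qed.

Let fgN : fg_module N.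
Proof.
have [s hs] := fgM; exists (map g s) => y; have [x <-] := gs y; apply/span_lc.
have /span_lc := hs x; move: {y} x.
apply: (lc_ind (s := s) (P := [set x | lc (map g s) (g x)])) => [|x xs].
  split=> [|a x y hx hy] /=; last by rewrite gD gZ; exact: (lc_sub _).2.
  by rewrite -(subrr (0 : M)) gB subrr; exact: (lc_sub _).1.
exact: (lc_mem (map_f g xs)).
Qed.

Local Notation T := (redm eta lambda M).
Local Notation Q := (@red _ _ eta lambda M).

(** [wiles_defect_eval] for ws = f :: ys over A and for the image of ys over B,
    with t and with 1. Both use the same T and I1, because p x lies in (f, ys)M
    if and only if q times the class of x lies in (ys)(M/fM). *)
Lemma wiles_defect_quotient : wiles_defect eta lambda M n.+1 = wiles_defect etaB lambdaB N n.
Proof.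
have QD := @redD _ _ eta lambda M; have QZ := @redZ _ _ eta lambda etaK M.
have Qs := @red_surj _ _ eta lambda M; have Qk := @red_ker _ _ eta lambda etaK M.
have [r [e he]] := tf_basis hO (@tf_torsion_free O _) (redm_fg (eta := eta) (lambda := lambda) etaK fgM).
have [k hk] := choice gs.
(* Q factors through M/fM since f acts on T as lambda f = 0. *)
pose QN (y : N) : T := Q (k y).
have QNg x : QN (g x) = Q x.
  apply/eqP; rewrite -subr_eq0 -(QB QD QZ); apply/eqP.
  apply: (Q_idm QD QZ (ys := [:: f])); first by move=> z; rewrite inE => /eqP ->.
  by apply/g0; rewrite gB hk subrr.
have QND y y' : QN (y + y') = QN y + QN y'.
  by rewrite -[y]hk -[y']hk -gD !QNg QD.
have QNZ b y : QN (b *: y) = lambdaB b *: QN y.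
  by have [a <-] := h_surj b; rewrite -[y]hk -gZ !QNg QZ hlambdaB.
have QNs z : exists y, QN y = z by have [x <-] := Qs z; exists (g x).
have QNk y : QN y = 0 <-> exists2 s : B, s \notin q & s *: y \in smulm q (submodT N).
  split.
    rewrite -[y]hk QNg => /Qk[s sp hs]; exists (h s); first by apply: contra sp => /mq.
    rewrite -gZ; move: (s *: k y) hs.
    apply: (smulm_ind (P := [set x | g x \in smulm q (submodT N)])) => [|a x ap _ /=].
      split=> [|a x x' hx hx'] /=; last by rewrite gD gZ; apply: rpredD => //; exact: rpredZ.
      by rewrite -(subrr (0 : M)) gB subrr; exact: rpred0.
    by rewrite gZ; apply: pM_mem; apply/mq.
  case=> s sq hs; have : QN (s *: y) = 0.
    move: (s *: y) hs; apply: (smulm_ind (P := [set y | QN y = 0])) => [|b x bq _ /=].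
      split=> [|b x x' /= hx hx']; last by rewrite QND QNZ hx hx' scaler0 addr0.
      by rewrite /= -(scale0r (0 : N)) QNZ rmorph0 scale0r.
    by rewrite QNZ (proj1 (pE lambdaB b) bq) scale0r.
  rewrite QNZ => /(@tf_torsion_free O _)[/eqP z|//].
  by rewrite (negbTE (lambda_neq0 sq)) in z.
have noeB := surj_noeth h_surj noeA.
have locB := image_local h_surj noeA hm ker_m.
pose I1 : set T := [set z | exists2 x, z = Q x & forall a : A, a \in p -> idm (f :: ys) (a *: x)].
have hI1 : submod_set I1.
  split=> [|c _ _ [x -> hx] [y -> hy]].
    exists 0; first by rewrite (Q0 QZ).
    by move=> a _; rewrite scaler0; exact: (idm_sub _ _).1.
  exists (eta c *: x + y); first by rewrite QD QZ etaK.
  move=> a ap; rewrite scalerDr scalerA mulrC -scalerA.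
  by apply: (idm_sub _ _).2; [exact: hx|exact: hy].
have perm (x : M) : idm (ys ++ [:: f]) x <-> idm (f :: ys) x.
  by split; apply: idm_subset => z; rewrite mem_cat !inE orbC.
have I1N z : I1 z <-> exists2 y, z = QN y & forall b : B, b \in q -> idm (map h ys) (b *: y).
  split=> [[x -> hx]|[y -> hy]].
    exists (g x); first by rewrite QNg.
    move=> b; have [a <-] := h_surj b; move=> /mq ap.
    by rewrite -gZ; apply/(idm_descent gB gZ gs g0)/perm/hx.
  exists (k y) => // a ap; apply/perm/(idm_descent gB gZ gs g0).
  by rewrite gZ hk; apply: hy; apply/mq.
have genB : exists2 s : B, s \notin q & forall b : B, b \in q -> idm (map h ys) (s * b : B^o).
  have [s sp hs] := gen_A; exists (h s); first by apply: contra sp => /mq.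
  move=> b; have [a <-] := h_surj b; move=> /mq ap; rewrite -rmorphM.
  have h0 (x : A^o) : h x = 0 <-> idm [:: f] x.
    split=> [/kerh[c ->]|[c /eqP]]; first by exists c; apply/eqP; rewrite subr_eq0 mulrC.
    by rewrite subr_eq0 => /eqP ->; apply/kerh; exists c; rewrite -[_ *: _]/(f * c) mulrC.
  apply/(idm_descent (M := A^o) (N := B^o) (rmorphB h) (rmorphM h) h_surj h0).
  by apply: (idm_subset (ws := f :: ys)) (hs a ap) => z; rewrite mem_cat !inE orbC.
have slotA : exists x s : A, [/\ x \in p, s \notin p & s * (f - eta t * x) \in smulm p p].
  have [s sp hs] := fv; exists (v ord0), s; split=> //.
  by have [vp _ _ _] := cb.
have wspB : {subset map h ys <= q} by move=> _ /mapP[y /ysp yp ->]; apply/mq.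
have [a ha] := fin_has_length (tors_fin_length hO (cot_fg etaK noeA)).
have fgq (c : O) : fg_module (quom (span [set c : O^o])).
  apply: (fg_surj (f := quom_pi (span [set c : O^o]))); last exact: fg_regular.
  by move=> y; exists (quom_repr y); exact: quom_reprK.
have [l hl] : exists l, has_length (quom (span [set t : O^o])) l.
  apply: fin_has_length; apply: (dvr_torsion_length hO (fgq t) t0) => y.
  rewrite -[y]quom_reprK -lin_Z; apply/quom_pi0/span1E.
  by exists (quom_repr y : O); rewrite mulrC.
have h1 : has_length (quom (span [set (1 : O) : O^o])) 0.
  apply: length0 => y; rewrite -[y]quom_reprK; apply/quom_pi0/span1E.
  by exists (quom_repr y : O); rewrite mulr1.
have [b hb] : exists b, has_length (quom (submod_of hI1)) b.
  apply: fin_has_length; have [s sp hs] := gen_A.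
  apply: (dvr_torsion_length hO _ (lambda_neq0 sp)).
    apply: (fg_surj (f := quom_pi (submod_of hI1))) (redm_fg etaK fgM) => y.
    by exists (quom_repr y); exact: quom_reprK.
  move=> y; rewrite -[y]quom_reprK -lin_Z; apply/quom_pi0/submod_ofE.
  have [x <-] := Qs (quom_repr y); exists (s *: x); first by rewrite QZ.
  move=> c cp; rewrite scalerA mulrC.
  have lf : linear (fun c : A^o => (c : A) *: x).
    by move=> c' x1 x2; rewrite scalerDl -scalerA.
  exact: (idm_map (mklin lf) (hs c cp)).
have I1A z : I1 z <-> exists2 x, z = Q x & forall a : A, a \in p -> idm (f :: ys) (a *: x) by [].
have regA : mreg M [::] (f :: ys) by split.
have regB : mreg N [::] (map h ys) := mreg_descent gB gZ gs g0 (zs := [::]) regy.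
have eA := wiles_defect_eval hO etaK noeA hm fgM QD QZ Qs Qk wsp regA gen_A he dual_A slotA I1A
  ha hl hb.
have eB : wiles_defect etaB lambdaB N (size (map h ys)) = (r * (a + l + 0))%N%:Z - b%:Z.
  apply: (wiles_defect_eval hO (etaBK etaK hetaB hlambdaB) noeB locB fgN QND QNZ QNs QNk wspB regB
    genB he dual_B _ I1N (Phi_length etaK h_surj hetaB hlambdaB fp kerh cb t0 xif fv ha hl) h1 hb).
  move: ysp; case: (ys) => //= y ys' hy; exists (h y), 1; split.
  - by apply/mq/hy; rewrite mem_head.
  - exact: (aug_prime lambdaB).1.
  - by rewrite rmorph1 !mul1r subrr; exact: ideal0.
rewrite size_map sz addn0 in eB; rewrite /= sz in eA.
by rewrite eA eB.
Qed.
End Quotient.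
End Final.

(** * The theorem *)

Section QuotientFacts.
Variables (A : comPzRingType) (f : A).
Local Notation pi := (rquot_pi (principal f)).

Lemma rquot_pi_surj (b : rquot (principal f)) : exists a, pi a = b.
Proof. by exists (quom_repr b); exact: rquot_reprK. Qed.

Lemma rquot_pi0 (a : A) : pi a = 0 <-> exists c, a = c * f.
Proof. by rewrite -span1E; exact: quom_pi0. Qed.

Lemma quo_augE (C : pzRingType) (h : {rmorphism A -> C}) (hf : f \in kerr h) a :
  quo_aug hf (pi a) = h a.
Proof. exact: rquot_liftE. Qed.

Variable M : lmodType A.
Definition mquot_pi (x : M) : mquot (principal f) M :=
  quom_pi (smulm (principal f) (submodT M)) x.

Lemma mquot_piB x y : mquot_pi (x - y) = mquot_pi x - mquot_pi y.
Proof. exact: raddfB. Qed.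
Lemma mquot_piZ (a : A) x : mquot_pi (a *: x) = pi a *: mquot_pi x.
Proof. by rewrite -[RHS]/(mquot_scale _ _) mquot_scaleE -lin_Z. Qed.
Lemma mquot_pi_surj y : exists x, mquot_pi x = y.
Proof. by exists (quom_repr y); exact: quom_reprK. Qed.
Lemma mquot_pi0 x : mquot_pi x = 0 <-> idm [:: f] x.
Proof.
have e : principal f =i span [set y : A^o | y \in [:: f]].
  by move=> a; congr (_ \in span _); apply/seteqP; split=> z /=; rewrite inE => /eqP.
rewrite -(smulm_idm x e); exact: quom_pi0.
Qed.
End QuotientFacts.

Theorem theorem3 (O : idomainType) (hO : is_dvr O)
    (A : comPzRingType) (eta : {rmorphism O -> A})
    (lambda : {rmorphism A -> O}) (c : nat) (hA : cat_C eta lambda c)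
    (M : lmodType A) (hM : fg_module M) (hdepth : depth_ge M c.+1)
    (f : A) (hf : f \in kerr lambda) (hf2 : ~ symb_square (aug_prime lambda) f)
    (hfM : nzdiv f M) :
  cat_C (quo_struct (principal f) eta) (quo_aug hf) c.-1 /\
  wiles_defect eta lambda M c =
  wiles_defect (quo_struct (principal f) eta) (quo_aug hf)
    (mquot (principal f) M) c.-1.
Proof.
have [noe [m hm cm] etaK _ reg] := hA; have noeA := noetherianP noe.
have [n [v [xi [t [cb t0 xif fv]]]]] := cotangent_basis_ex hO etaK noeA hf hf2.
have ec := cotangent_dim etaK noeA cb reg; rewrite -ec in hdepth reg *.
have [ys [sz ysp regy xiy]] := sequence_ex hO etaK noeA hm cb hM hdepth hfM.
have heta r : quo_struct (principal f) eta r = rquot_pi (principal f) (eta r) by [].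
split.
  exact: (quotient_cat etaK noeA hm hf cb t0 xif fv sz ysp xiy (@rquot_pi_surj _ f) heta
    (quo_augE hf) (@rquot_pi0 _ f) cm reg).
exact: (wiles_defect_quotient hO etaK noeA hm hf cb t0 xif fv sz ysp xiy (@rquot_pi_surj _ f)
  heta (quo_augE hf) (@rquot_pi0 _ f) hM hfM regy (@mquot_piB _ f M) (@mquot_piZ _ f M)
  (@mquot_pi_surj _ f M) (@mquot_pi0 _ f M)).
Qed.
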